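(* Let $n\ge m\ge 1$ and let $H(z)=\sum_{j=0}^n A_j z^j+\sum_{j=0}^m B_j\overline{z}^{\,j}$, where $A_0,\dots,A_n,B_0,\dots,B_m$ are mutually independent complex Gaussian random variables with $\mathbb{E}A_j=\mathbb{E}B_j=0$, $\mathbb{E}[A_j^2]=\mathbb{E}[B_j^2]=0$, $\mathbb{E}|A_j|^2=\alpha_j>0$ and $\mathbb{E}|B_j|^2=\beta_j>0$. Then for every open set $T\subseteq\mathbb{C}$, the expected number $\mathbb{E}N_H(T)$ of zeros of $H$ in $T$ equals $$\frac{1}{\pi}\int_T \frac{1}{|z|^2}\,\frac{r_1^2+r_2^2-2r_{12}^2}{r_3^2\sqrt{(r_1+r_2)^2-4r_{12}^2}}\,dA(z),$$ where, writing $s_k=\sum_{j=1}^n j^k\alpha_j|z|^{2j}$ and $t_k=\sum_{j=1}^m j^k\beta_j|z|^{2j}$, $$r_3=\sum_{j=0}^n\alpha_j|z|^{2j}+\sum_{j=0}^m\beta_j|z|^{2j},\quad r_{12}=s_1t_1,\quad r_1=r_3 s_2-s_1^2,\quad r_2=r_3 t_2-t_1^2.$$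
   Context: $dA$ denotes Lebesgue measure on $\mathbb{C}$; $N_H(T)$ is the number of points $z\in T$ with $H(z)=0$. *)

(* Defs.v *)
(* MathComp + MathComp-Analysis, complex numbers from mathcomp-real-closed. *)
From HB Require Import structures.
From mathcomp Require Import all_boot all_order all_algebra.
From mathcomp Require Import all_classical all_reals all_analysis.
From mathcomp Require Import finmap complex.
Set Implicit Arguments. Unset Strict Implicit. Unset Printing Implicit Defensive.
Import Order.TTheory GRing.Theory Num.Theory.
Import numFieldTopology.Exports numFieldNormedType.Exports.
Local Open Scope classical_set_scope.
Local Open Scope ring_scope.

(* Mutual independence of a finite family of real random variables:
   product rule for every finite subfamily and every choice of Borel sets. *)
Definition mutually_independent {d} {T : measurableType d} {R : realType}
  (P : probability T R) {I : finType} (X : I -> T -> R) : Prop :=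
  (forall i, measurable_fun setT (X i)) /\
  forall (J : {set I}) (B : I -> set R), (forall i, measurable (B i)) ->
    P (\big[setI/setT]_(i in J) (X i @^-1` B i))
    = (\prod_(i in J) P (X i @^-1` B i))%E.

(* X is distributed as N(0, v) (mean 0, variance v > 0). *)
Definition centered_normal_rv {d} {T : measurableType d} {R : realType}
  (P : probability T R) (X : T -> R) (v : R) : Prop :=
  forall V : set R, measurable V ->
    P (X @^-1` V) = normal_prob 0 (Num.sqrt v) V.

(* Number of points of a set, +oo if infinite. *)
Definition npoints {T : choiceType} {R : realType} (A : set T) : \bar R :=
  if `[< finite_set A >] then ((#|` fset_set A|)%:R)%:E else +oo%E.

(* The random harmonic polynomial H(z) = sum A_j z^j + sum B_j conj(z)^j
   evaluated at a sample point; A j = a j + i a' j, B j = b j + i b' j. *)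
Definition harm_poly {R : rcfType} (n m : nat) (A B : nat -> R[i]) (z : R[i]) : R[i] :=
  \sum_(j < n.+1) A j * z ^+ j + \sum_(j < m.+1) B j * (z^*)%C ^+ j.

(* N_H(T): number of zeros of H in T (T a set of points (x,y) ~ x + i y). *)
Definition zero_count {R : realType} (n m : nat) (A B : nat -> R[i])
  (T : set (R * R)) : \bar R :=
  npoints [set z : R[i] | T (complex.Re z, complex.Im z) /\ harm_poly n m A B z = 0].

(* The density of the expected number of zeros, at z = x + i y. *)
Definition zero_density {R : realType} (n m : nat) (alpha beta : nat -> R)
  (x y : R) : R :=
  let rho := x ^+ 2 + y ^+ 2 in (* |z|^2 *)
  let s k := \sum_(1 <= j < n.+1) (j%:R ^+ k * alpha j * rho ^+ j) in
  let t k := \sum_(1 <= j < m.+1) (j%:R ^+ k * beta j * rho ^+ j) in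
  let r3 := \sum_(0 <= j < n.+1) (alpha j * rho ^+ j)
          + \sum_(0 <= j < m.+1) (beta j * rho ^+ j) in
  let r12 := s 1%N * t 1%N in
  let r1 := r3 * s 2%N - s 1%N ^+ 2 in
  let r2 := r3 * t 2%N - t 1%N ^+ 2 in
  rho^-1 * ((r1 ^+ 2 + r2 ^+ 2 - 2 * r12 ^+ 2)
            / (r3 ^+ 2 * Num.sqrt ((r1 + r2) ^+ 2 - 4 * r12 ^+ 2))).

(* Main.v *)
(* Condition on all coefficients except A_0. The zeros of H are then the points where the smooth map
   f = -(H - A_0) takes the value A_0, so the area formula, integrated against the density of A_0, yields
   a Kac-Rice formula: the intensity at z is the mean of exp(- |f|^2 / alpha_0) |J f| / (pi alpha_0),
   where J f = |h_z|^2 - |g_zbar|^2 with h, g the holomorphic and antiholomorphic parts of H. The pairs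
   (h - A_0, z h_z) and (g, zbar g_zbar) are Gaussian linear forms in the coefficients. Orthogonal and
   unitary changes of the Gaussian variables turn the exponential weight into a change of variance of a single
   variable, leaving the mean of ||Z|^2 - |W|^2| for a centred complex Gaussian pair (Z, W) with an
   explicit covariance. A hyperbolic rotation preserves this indefinite form and decorrelates Z and W,
   so the problem reduces to E|l X - m Y| = (l^2 + m^2) / (l + m) for independent standard exponential
   variables X, Y. *)
Require Import Defs.
From HB Require Import structures.
From mathcomp Require Import all_boot all_order all_algebra.
From mathcomp Require Import all_classical all_reals all_analysis.
From mathcomp Require Import finmap complex.
From mathcomp Require Import measurable_realfun.
From mathcomp Require Import zify ring lra.
Set Implicit Arguments. Unset Strict Implicit. Unset Printing Implicit Defensive.
Import Order.TTheory GRing.Theory Num.Theory.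
Import numFieldTopology.Exports numFieldNormedType.Exports.
Local Open Scope classical_set_scope.
Local Open Scope ring_scope.

(** * Counting points *)

Section npoints_theory.
Context {R : realType}.
Local Open Scope ereal_scope.

Lemma npoints_ge0 (T : choiceType) (A : set T) : 0 <= npoints A :> \bar R.
Proof. by rewrite /npoints; case: ifP; rewrite ?leey// => _; rewrite lee_fin. Qed.

Lemma npoints_geP (T : choiceType) (A : set T) (m : nat) :
  m%:R%:E <= npoints A :> \bar R <->
  exists s : seq T, [/\ uniq s, size s = m & forall x, x \in s -> A x].
Proof.
split=> [|[s [us <- sA]]].
  rewrite /npoints; case: ifPn => [/asboolP fA|/asboolPn iA _].
    rewrite lee_fin ler_nat => mA; exists (take m (fset_set A)).
    rewrite take_uniq ?fset_uniq// size_takel//; split => // x /mem_take xA.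
    by move: (xA : x \in fset_set A); rewrite in_fset_set// => /set_mem.
  have [B BA mB] := @infinite_set_fset _ _ m iA; exists (take m B).
  rewrite take_uniq ?fset_uniq// size_takel//; split=> // x /mem_take xB.
  exact: BA.
rewrite /npoints; case: ifPn => [/asboolP fA|_]; last by rewrite leey.
rewrite lee_fin ler_nat -(undup_id us) -card_fseq.
apply/fsubset_leq_card/fsubsetP => x; rewrite in_fset_set// inE/= => /sA.
exact: mem_set.
Qed.

Lemma npointsE (T : choiceType) (A : set T) :
  npoints A = \esum_(x in A) 1 :> \bar R.
Proof.
rewrite /npoints; case: ifPn => [/asboolP fA|/asboolPn iA].
  rewrite esum_fset// fsbig_finite//= sumEFin; congr (_%:E).
  by rewrite card_fset_sum1 natr_sum big_seq_fsetE.
apply/esym/eqyP => r r0.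
have [B BA rB] := @infinite_set_fset _ _ (Num.truncn r).+1 iA.
apply: esum_ge; exists [set` B]; first by split => //; exact: finite_fset.
rewrite fsbig_finite//= sumEFin set_fsetK lee_fin.
apply: (le_trans (ltW (truncnS_gt r))).
rewrite (le_trans _ (_ : #|` B|%:R <= _))%R// ?ler_nat//.
by rewrite card_fset_sum1 natr_sum big_seq_fsetE.
Qed.

Lemma npoints_bigcup (T : choiceType) (F : nat -> set T) :
  trivIset setT F ->
  npoints (\bigcup_n F n) = \sum_(n <oo) npoints (F n) :> \bar R.
Proof.
move=> tF; rewrite npointsE esum_bigcupT//.
rewrite (_ : [set: nat] = [set x | xpredT x])//; last by apply/seteqP; split.
rewrite -nneseries_esum//.
  by apply: eq_eseriesr => n _; rewrite npointsE.
by move=> n _; rewrite -npointsE npoints_ge0.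
Qed.

Lemma npoints_image (T T' : choiceType) (f : T -> T') (A : set T) :
  {in A &, injective f} -> npoints (f @` A) = npoints A :> \bar R.
Proof.
move=> fA; rewrite !npointsE (reindex_esum A _ f)//.
by apply: inj_bij.
Qed.

Lemma npoints0 (T : choiceType) : npoints (@set0 T) = 0 :> \bar R.
Proof. by rewrite npointsE esum_set0. Qed.

Lemma npoints_le1 (T : choiceType) (A : set T) :
  (forall x y, A x -> A y -> x = y) ->
  npoints A = (`[< A !=set0 >] : nat)%:R%:E :> \bar R.
Proof.
move=> Axy; case: asboolP => [[x Ax]|A0].
  rewrite (_ : A = [set x]) ?npointsE ?esum_set1//.
  by apply/seteqP; split => [y Ay|y ->//]; exact: Axy.
rewrite (_ : A = set0) ?npoints0//.
by apply/seteqP; split => // y Ay; apply: A0; exists y.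
Qed.
End npoints_theory.

(** * Dyadic decomposition of open sets *)

Section whitney.
Variables (T : Type) (I : countType) (c : nat -> T -> I).
Hypothesis c_refine : forall k x y, c k.+1 x = c k.+1 y -> c k x = c k y.

Let refine l k x y : (l <= k)%N -> c k x = c k y -> c l x = c l y.
Proof.
elim: k => [|k IH]; first by rewrite leqn0 => /eqP ->.
rewrite leq_eqVlt => /predU1P[->//|]; rewrite ltnS => lk /c_refine; exact: IH.
Qed.

(* Each point is put in the coarsest good cell that contains it. *)
Lemma whitney (Good : nat -> I -> Prop) (U : set T) :
  (forall x, U x <-> exists k, Good k (c k x)) ->
  exists W : nat -> set T, [/\ trivIset setT W, \bigcup_n W n = U &
    forall n, W n = set0 \/
      exists k i, Good k i /\ W n = [set x | c k x = i]].
Proof.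
move=> UG.
pose W n := match @pickle_inv (nat * I)%type n with
  | None => set0
  | Some (k, i) => [set x | [/\ c k x = i, Good k i &
      forall l, (l < k)%N -> ~ Good l (c l x)]] end.
exists W; split.
- move=> n n' _ _ [x []]; rewrite /W.
  case En : (pickle_inv n) => [[k i]|//]; case En' : (pickle_inv n') => [[k' i']|//].
  move=> [ci G m] [ci' G' m'].
  have kk : k = k'.
    apply/eqP; rewrite eqn_leq; apply/andP; split; rewrite leqNgt; apply/negP.
      by move=> /m; apply; rewrite ci'.
    by move=> /m'; apply; rewrite ci.
  have ii : i = i' by rewrite -ci -ci' kk.
  have := @pickle_invK (nat * I)%type n; rewrite En/= => <-.
  by have := @pickle_invK (nat * I)%type n'; rewrite En'/= => <-; rewrite kk ii.
- apply/seteqP; split => [x [n _]|x /UG exG].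
    rewrite /W; case: pickle_inv => // -[k i] [ci G _]; apply/UG; exists k.
    by rewrite ci.
  have /asboolP exG' : exists k, `[< Good k (c k x) >].
    by case: exG => k Gk; exists k; apply/asboolP.
  have ex : exists k, `[< Good k (c k x) >] by apply/asboolP.
  case: (ex_minnP ex) => k /asboolP Gk mk.
  exists (choice.pickle (k, c k x)) => //; rewrite /W pickleK_inv; split => // l lk Gl.
  by move: lk; rewrite ltnNge mk//; apply/asboolP.
- move=> n; have [->|] := eqVneq (W n) set0; first by left.
  move=> /set0P[x]; rewrite /W => Wx; right; move: Wx.
  case: pickle_inv => // -[k i] [ci G m]; exists k, i; split => //.
  apply/seteqP; split => y /=; first by case.
  move=> cy; split => // l lk; rewrite (_ : c l y = c l x); first exact: m.
  by apply: (refine (ltnW lk)); rewrite cy.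
Qed.
End whitney.

Section dyadic.
Context {R : realType}.
Implicit Types (k : nat) (x y : R) (i : int).

Definition didx k x : int := Num.floor (2 ^+ k * x).
Definition dend k i : R := i%:~R / 2 ^+ k.

Lemma dend_lt k i : dend k i < dend k (i + 1).
Proof. by rewrite /dend ltr_pM2r ?invr_gt0 ?exprn_gt0// ltr_int; lia. Qed.

Lemma didx_itv k x : dend k (didx k x) <= x < dend k (didx k x + 1).
Proof.
have k0 : 0 < 2 ^+ k :> R by rewrite exprn_gt0.
by rewrite /dend ler_pdivrMr// ltr_pdivlMr// ![x * _]mulrC floor_itv.
Qed.

Lemma didxP k x i : didx k x = i <-> dend k i <= x < dend k (i + 1).
Proof.
split=> [<-|]; first exact: didx_itv.
have k0 : 0 < 2 ^+ k :> R by rewrite exprn_gt0.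
rewrite /dend ler_pdivrMr// ltr_pdivlMr// ![x * _]mulrC => xi.
exact: floor_def.
Qed.

Lemma didx_set k i : [set x | didx k x = i] = `[dend k i, dend k (i + 1)[%classic.
Proof. by apply/seteqP; split=> x /=; rewrite in_itv/= => /didxP. Qed.

Lemma didx_refine k x y : didx k.+1 x = didx k.+1 y -> didx k x = didx k y.
Proof.
move=> xy; set j := didx k.+1 y in xy.
have half z : didx k.+1 z = j -> didx k z = (j %/ 2)%Z.
  move=> /didxP; rewrite /dend exprS => /andP[jz zj]; apply/didxP; rewrite /dend.
  have k0 : 0 < 2 ^+ k :> R by rewrite exprn_gt0.
  have := divz_eq j 2; have := modz_ge0 j (isT : (2 : int) != 0).
  have := ltz_pmod j (isT : 0 < (2 : int)).
  set q := (j %/ 2)%Z; set r := (j %% 2)%Z => r2 r0 jE.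
  move: jz zj; rewrite !ler_pdivrMr ?mulr_gt0// !ltr_pdivlMr ?mulr_gt0//.
  have H1 : (q * 2)%:~R <= j%:~R :> R by rewrite ler_int; lia.
  have H2 : (j + 1)%:~R <= ((q + 1) * 2)%:~R :> R by rewrite ler_int; lia.
  move: H1 H2; rewrite !intrM => H1 H2 H3 H4; apply/andP; split.
    by rewrite -(ler_pM2r (_ : 0 < 2%:~R))//; apply: (le_trans H1); rewrite mulrAC [_ * 2]mulrC -mulrA mulrCA in H3 *; lra.
  by rewrite -(ltr_pM2r (_ : 0 < 2%:~R))//; apply: lt_le_trans H2; nra.
by rewrite (half x)// (half y).
Qed.


Lemma dend_width k i : dend k (i + 1) = dend k i + (2 ^+ k)^-1.
Proof. by rewrite /dend intrD mulrDl mul1r. Qed.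

Lemma didx_near x (U : set R) : nbhs x U ->
  \forall k \near \oo, `[dend k (didx k x), dend k (didx k x + 1)] `<=` U.
Proof.
move=> [e /= e0 eU]; near=> k; move=> y; rewrite /= in_itv/= => /andP[y1 y2].
apply: eU => /=; have /andP[x1 x2] := didx_itv k x.
have ke : 1 / 2 ^+ k < e.
  by near: k; exact: (near_infty_natSinv_expn_lt (PosNum e0)).
rewrite mul1r in ke; move: y2 x2; rewrite dend_width ltr_norml; lra.
Unshelve. all: by end_near. Qed.

Definition didx2 k (p : R * R) : int * int := (didx k p.1, didx k p.2).

Definition dbox k (ij : int * int) : set (R * R) :=
  `[dend k ij.1, dend k (ij.1 + 1)] `*` `[dend k ij.2, dend k (ij.2 + 1)].

Lemma didx2_refine k p q : didx2 k.+1 p = didx2 k.+1 q -> didx2 k p = didx2 k q.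
Proof. by case=> /didx_refine p1 /didx_refine p2; rewrite /didx2 p1 p2. Qed.

Lemma didx2_box k p : dbox k (didx2 k p) p.
Proof.
have /andP[x1 x2] := didx_itv k p.1; have /andP[y1 y2] := didx_itv k p.2.
by split; rewrite /= in_itv/= ?x1 ?y1/= ltW.
Qed.

Lemma didx2_set k ij : [set p | didx2 k p = ij] =
  `[dend k ij.1, dend k (ij.1 + 1)[ `*` `[dend k ij.2, dend k (ij.2 + 1)[.
Proof.
apply/seteqP; split=> p /=; rewrite !in_itv/=.
  by move=> <-; split; exact: didx_itv.
by case: ij => i j /= [/didxP p1 /didxP p2]; rewrite /didx2 p1 p2.
Qed.

Lemma didx2_near p (U : set (R * R)) : nbhs p U ->
  \forall k \near \oo, dbox k (didx2 k p) `<=` U.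
Proof.
move=> [[A B] /= [pA pB] ABU]; near=> k => q [q1 q2]; apply: ABU; split.
  by move: q.1 q1; near: k; exact: didx_near.
by move: q.2 q2; near: k; exact: didx_near.
Unshelve. all: by end_near. Qed.

Lemma whitney1 (U : set R) : open U -> exists W : nat -> set R,
  [/\ trivIset setT W, \bigcup_n W n = U & forall n, W n = set0 \/
    exists a b, [/\ a < b, `[a, b] `<=` U & W n = `[a, b[%classic]].
Proof.
move=> oU; have [|W [tW WU Wi]] := whitney didx_refine
  (Good := fun k i => `[dend k i, dend k (i + 1)] `<=` U) (U := U).
  move=> x; split => [Ux|[k]]; last first.
    by apply; have /andP[x1 x2] := didx_itv k x; rewrite /= in_itv/= x1 ltW.
  have /didx_near [k _ kU] : nbhs x U by apply: open_nbhs_nbhs.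
  by exists k; exact: kU (leqnn k).
exists W; split => // n; have [->|[k [i [G ->]]]] := Wi n; [by left|right].
by exists (dend k i), (dend k (i + 1)); split; rewrite ?dend_lt ?didx_set.
Qed.

Lemma whitney2 (U : set (R * R)) : open U -> exists W : nat -> set (R * R),
  [/\ trivIset setT W, \bigcup_n W n = U & forall n, W n = set0 \/
    exists k ij, dbox k ij `<=` U /\ W n = [set p | didx2 k p = ij]].
Proof.
move=> oU; have := whitney didx2_refine
  (Good := fun k ij => dbox k ij `<=` U) (U := U).
apply; move=> x; split => [Ux|[k]]; last by apply; exact: didx2_box.
have /didx2_near [k _ kU] : nbhs x U by apply: open_nbhs_nbhs.
by exists k; exact: kU (leqnn k).
Qed.

Lemma measurable_didx2 k ij : measurable [set p | didx2 k p = ij].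
Proof. by rewrite didx2_set; apply: measurableX; exact: measurable_itv. Qed.

Lemma open_measurable2 (U : set (R * R)) : open U -> measurable U.
Proof.
move=> /whitney2[W [_ <- Wi]]; apply: bigcup_measurable => n _.
have [->|[k [ij [_ ->]]]] := Wi n; first exact: measurable0.
exact: measurable_didx2.
Qed.

End dyadic.

(** * The area formula for maps of the plane *)

Section one_dim.
Context {R : realType}.
Local Notation mu := (@lebesgue_measure R).

Lemma lebesgue_integral_affine (a b : R) (f : R -> \bar R) : a != 0 ->
  measurable_fun setT f -> (forall x, 0 <= f x)%E ->
  (\int[mu]_x f (a * x + b)%R = (`|a|^-1)%:E * \int[mu]_x f x)%E.
Proof.
move=> a0 mf f0; have na0 : 0 < `|a| by rewrite normr_gt0.
have maff : measurable_fun setT (fun x : measurableTypeR R => (a * x + b : measurableTypeR R)).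
  by apply: measurable_funD => //; apply: measurable_funM.
pose aff := fun x : measurableTypeR R => (a * x + b : measurableTypeR R).
have E : forall A : set (measurableTypeR R), measurable A ->
    (mu A = `|a|%:E * mu (aff @^-1` A))%E.
  move=> A mA; rewrite -[RHS]/(mscale (NngNum (normr_ge0 a)) (measure_function_pushforward__canonical__measure_function_Measure mu maff) A).
  apply: lebesgue_measure_unique => // _ [[p q] _ <-]/=.
  rewrite /mscale/= /pushforward/=.
  have [a_gt|a_lt] : (0 < a) \/ (a < 0) by move: a0; rewrite neq_lt => /orP[]; [right|left].
  - rewrite (_ : _ @^-1` _ = `](p - b) / a, (q - b) / a]%classic).
      rewrite !lebesgue_measure_itv/= !lte_fin ltr_pM2r ?invr_gt0// ltrD2r.
      case: ifPn => pq; last by rewrite mule0.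
      by rewrite -!EFinD -EFinM gtr0_norm//; congr (_%:E); field; rewrite ?gt_eqF.
    apply/seteqP; split=> x /=; rewrite !in_itv/= ltr_pdivrMr// ler_pdivlMr//; lra.
  - rewrite (_ : _ @^-1` _ = `[(q - b) / a, (p - b) / a[%classic).
      rewrite !lebesgue_measure_itv/= !lte_fin ltr_nM2r ?invr_lt0// ltrD2r.
      case: ifPn => pq; last by rewrite mule0.
      by rewrite -!EFinD -EFinM ltr0_norm//; congr (_%:E); field; rewrite ?lt_eqF.
    apply/seteqP; split=> x /=; rewrite !in_itv/= ler_ndivrMr// ltr_ndivlMr//; lra.
transitivity (\int[mu]_(x in aff @^-1` setT) (f \o aff) x)%E.
  by rewrite preimage_setT; apply: eq_integral.
rewrite -(ge0_integral_pushforward maff)//.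
have na1 : 0 <= `|a|^-1 by rewrite invr_ge0.
rewrite (_ : (`|a|^-1)%:E = (NngNum na1)%:num%:E)// -ge0_integral_mscale//.
apply: eq_measure_integral => A mA _.
transitivity (mu (aff @^-1` A)); first by [].
transitivity ((`|a|^-1)%:E * mu A)%E; last by [].
rewrite (E A mA) muleA -EFinM.
by rewrite mulVf ?mul1e// gt_eqF.
Qed.

Lemma nonzero_same_sign (h' : R -> R) (a b : R) : a <= b ->
  {within `[a, b], continuous h'} -> (forall x, x \in `[a, b] -> h' x != 0) ->
  (forall x, x \in `[a, b] -> 0 < h' x) \/ (forall x, x \in `[a, b] -> h' x < 0).
Proof.
move=> ab ch h0.
have aab : a \in `[a, b] by rewrite in_itv/= lexx.
have key x : x \in `[a, b] -> 0 < h' a * h' x.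
  move=> xab; rewrite ltNge; apply/negP => le0.
  have ax : a <= x by case/andP: xab.
  have xb : x <= b by case/andP: xab.
  have cx : {within `[a, x], continuous h'}.
    apply: continuous_subspaceW ch => y /=; rewrite !in_itv/= => /andP[-> yx].
    by rewrite (le_trans yx xb).
  have /(IVT ax cx)[c] : Num.min (h' a) (h' x) <= 0 <= Num.max (h' a) (h' x).
    rewrite ge_min le_max; case: (ltgtP (h' a) 0) (h0 a aab) => // ha _ /=.
      by move: le0; rewrite nmulr_rle0//.
    by rewrite andbT; move: le0; rewrite pmulr_rle0.
  move=> /andP[ac cx'] hc0; have := h0 c; rewrite hc0 eqxx => /(_ _)/negP; apply.
    move: ac cx'; rewrite !bnd_simp in_itv/= => -> cx'/=.
    exact: le_trans cx' xb.
  by [].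
have := h0 a aab; case: ltgtP => // ha _; [right|left] => x /key.
  by rewrite nmulr_rgt0.
by rewrite pmulr_rgt0.
Qed.

Lemma subst_local (h h' g : R -> R) (a b : R) : a < b ->
  (forall x, x \in `[a, b] -> is_derive x 1 h (h' x)) ->
  (forall x, x \in `[a, b] -> {for x, continuous h'}) ->
  (forall x, x \in `[a, b] -> h' x != 0) ->
  (forall x, x \in `[a, b] -> {for h x, continuous g}) ->
  {in `[a, b] &, injective h} /\
  (\int[mu]_(t in h @` `[a, b[) (g t)%:E =
   \int[mu]_(x in `[a, b[) (g (h x) * `|h' x|)%:E)%E /\ measurable (h @` `[a, b[).
Proof.
move=> ab dh ch' h'0 cg.
have hoo x : x \in `]a, b[ -> x \in `[a, b].
  by rewrite !in_itv/= => /andP[/ltW -> /ltW ->].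
have aab : a \in `[a, b] by rewrite in_itv/= lexx ltW.
have bab : b \in `[a, b] by rewrite in_itv/= lexx ltW.
have chx x : x \in `[a, b] -> {for x, continuous h}.
  by move=> /dh dx; apply/differentiable_continuous/derivable1_diffP; exact: ex_derive.
have chw : {within `[a, b], continuous h}.
  by apply: continuous_in_subspaceT => x /set_mem /chx.
have ch'w : {within `[a, b], continuous h'}.
  by apply: continuous_in_subspaceT => x /set_mem /ch'.
have hE x : x \in `[a, b] -> h^`()%classic x = h' x.
  by move=> /dh dx; rewrite derive1E; exact: derive_val.
have C1 : {in `]a, b[, continuous h^`()%classic}.
  move=> x xab; rewrite /continuous_at (hE _ (hoo _ xab)).
  apply: cvg_trans (ch' _ (hoo _ xab)); apply: near_eq_cvg.
  by near=> y; rewrite hE//; apply: hoo; near: y; exact: near_in_itvoo.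
have C2 : cvg (h^`()%classic x @[x --> a^'+]).
  apply/cvg_ex; exists (h' a); apply: cvg_trans (cvg_at_right_filter (ch' _ aab)).
  apply: near_eq_cvg; near=> y; rewrite hE// in_itv/=; apply/andP; split.
    by near: y; exact: nbhs_right_ge.
  by near: y; exact: nbhs_right_le.
have C3 : cvg (h^`()%classic x @[x --> b^'-]).
  apply/cvg_ex; exists (h' b); apply: cvg_trans (cvg_at_left_filter (ch' _ bab)).
  apply: near_eq_cvg; near=> y; rewrite hE// in_itv/=; apply/andP; split.
    by near: y; exact: nbhs_left_ge.
  by near: y; exact: nbhs_left_le.
have C4 : derivable_oo_LRcontinuous h a b.
  split; first by move=> x /hoo/dh dx; exact: ex_derive.
    exact/cvg_at_right_filter/chx.
  exact/cvg_at_left_filter/chx.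
have dho x : x \in `]a, b[ -> derivable h x 1.
  by move=> /hoo/dh dx; exact: ex_derive.
have mI : measurable_fun `]a, b[ (fun x => g (h x) * `|h' x|).
  apply: subspace_continuous_measurable_fun => //.
  apply: continuous_in_subspaceT => x /set_mem /hoo xab.
  apply: cvgM; first by apply: continuous_comp; [exact: chx|exact: cg].
  by apply: cvg_norm; exact: ch'.
have RHS0 (k : R -> R) : (forall x, x \in `]a, b[ -> k x = g (h x) * `|h' x|) ->
    (\int[mu]_(x in `[a, b]) (k x)%:E = \int[mu]_(x in `[a, b[) (g (h x) * `|h' x|)%:E)%E.
  move=> kE; rewrite [LHS]integral_itv_bndoo; last first.
    apply/measurable_EFinP; apply: eq_measurable_fun mI => x /set_mem xab.
    by rewrite kE.
  rewrite [RHS]integral_itv_bndoo; last exact/measurable_EFinP.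
  by apply: eq_integral => x /set_mem xab; rewrite kE.
have cgw t : t \in h @` `[a, b] -> {for t, continuous g}.
  by move=> /set_mem[x xab <-]; exact: cg.
have [h'p|h'n] := nonzero_same_sign (ltW ab) ch'w h'0.
- have incr : {in `[a, b] &, {homo h : x y / x < y}}.
    apply: gtr0_derive1_lt_cc => // x xab; rewrite hE ?h'p//; exact: hoo.
  have incr' : {in `[a, b] &, {mono h : x y / x <= y}} := le_mono_in incr.
  have hab : h a <= h b by rewrite ltW// incr.
  have surj t : t \in `[h a, h b] -> exists2 x, x \in `[a, b] & h x = t.
    move=> tab; have [x xab <-] := segment_continuous_le_surjective (ltW ab) hab chw tab.
    by exists x.
  have imE : h @` `[a, b[ = `[h a, h b[%classic.
    apply/seteqP; split => t /=.
      move=> [x xab <-]; move: xab; rewrite !in_itv/= => /andP[ax xb].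
      by rewrite incr' ?ax ?incr// in_itv/= ?ax ?ltW.
    rewrite in_itv/= => /andP[at_ tb].
    have [|x xab xt] := surj t; first by rewrite in_itv/= at_ ltW.
    exists x => //; move: (xab); rewrite !in_itv/= => /andP[-> xb]/=.
    by rewrite lt_neqAle xb andbT; apply/eqP => xb'; rewrite -xt xb' ltxx in tb.
  have cgw' : {within `[h a, h b], continuous g}.
    apply: continuous_in_subspaceT => t /set_mem/surj[x xab <-]; exact: cg.
  split; first exact: inc_inj_in.
  rewrite imE; split => //.
  have mg : measurable_fun `[h a, h b[ g.
    apply: subspace_continuous_measurable_fun => //.
    by apply: continuous_subspaceW cgw' => t /=; rewrite !in_itv/= => /andP[-> /ltW].
  rewrite integral_itv_bndo_bndc; last exact/measurable_EFinP.
  rewrite (integration_by_substitution_increasing (ltW ab))//.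
  apply: RHS0 => x xab; rewrite !fctE/= hE ?gtr0_norm ?h'p//; exact: hoo.
- have decr : {in `[a, b] &, {homo h : x y /~ x < y}}.
    apply: ltr0_derive1_lt_cc => // x xab; rewrite hE ?h'n//; exact: hoo.
  have decr' : {in `[a, b] &, {mono h : x y /~ x <= y}} := le_nmono_in decr.
  have hab : h b <= h a by rewrite ltW// decr.
  have surj t : t \in `[h b, h a] -> exists2 x, x \in `[a, b] & h x = t.
    move=> tab; have [x xab <-] := segment_continuous_ge_surjective (ltW ab) hab chw tab.
    by exists x.
  have imE : h @` `[a, b[ = `]h b, h a]%classic.
    apply/seteqP; split => t /=.
      move=> [x xab <-]; move: xab; rewrite !in_itv/= => /andP[ax xb].
      by rewrite decr' ?ax ?decr// in_itv/= ?ax ?ltW.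
    rewrite in_itv/= => /andP[at_ tb].
    have [|x xab xt] := surj t; first by rewrite in_itv/= tb ltW.
    exists x => //; move: (xab); rewrite !in_itv/= => /andP[-> xb]/=.
    by rewrite lt_neqAle xb andbT; apply/eqP => xb'; rewrite -xt xb' ltxx in at_.
  have cgw' : {within `[h b, h a], continuous g}.
    apply: continuous_in_subspaceT => t /set_mem/surj[x xab <-]; exact: cg.
  split; first exact: dec_inj_in.
  rewrite imE; split => //.
  have mg : measurable_fun `]h b, h a] g.
    apply: subspace_continuous_measurable_fun => //.
    by apply: continuous_subspaceW cgw' => t /=; rewrite !in_itv/= => /andP[/ltW ->].
  rewrite integral_itv_obnd_cbnd; last exact/measurable_EFinP.
  rewrite (integration_by_substitution_decreasing (ltW ab))//.
  apply: RHS0 => x xab; rewrite !fctE/= hE ?ltr0_norm ?h'n//; exact: hoo.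
Unshelve. all: by end_near. Qed.

Lemma area_formula1 (X : set R) (h h' : R -> R) (g : R -> R) : open X ->
  (forall x, X x -> is_derive x 1 h (h' x)) ->
  (forall x, X x -> {for x, continuous h'}) ->
  (forall x, X x -> h' x != 0) ->
  (forall x, X x -> {for h x, continuous g}) ->
  (forall t, 0 <= g t) -> measurable_fun setT g ->
  (\int[mu]_t ((g t)%:E * npoints [set x | X x /\ h x = t]) =
   \int[mu]_(x in X) (g (h x) * `|h' x|)%:E)%E.
Proof.
move=> oX dh ch' h'0 cg g0 mg; have [W [tW WX WI]] := whitney1 oX.
have WXn n : W n `<=` X by rewrite -WX; exact: bigcup_sup.
have chx x : X x -> {for x, continuous h}.
  by move=> /dh dx; apply/differentiable_continuous/derivable1_diffP; exact: ex_derive.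
have WP n : [/\ {in W n &, injective h}, measurable (W n), measurable (h @` W n) &
   (\int[mu]_(t in h @` W n) (g t)%:E =
     \int[mu]_(x in W n) (g (h x) * `|h' x|)%:E)%E].
  have [->|[a [b [ab abX ->]]]] := WI n.
    split; rewrite ?image_set0 ?integral_set0//.
    by move=> x y; rewrite in_set0.
  have [||||hinj [ih mh]] := @subst_local h h' g a b ab.
  - by move=> x /abX; exact: dh.
  - by move=> x /abX; exact: ch'.
  - by move=> x /abX; exact: h'0.
  - by move=> x /abX; exact: cg.
  split => // x y /set_mem + /set_mem; rewrite /= !in_itv/= => /andP[ax xb] /andP[ay yb].
  by apply: hinj; rewrite in_itv/= ?ax ?ay ltW.
have mF : measurable_fun X (fun x => g (h x) * `|h' x|).
  apply: open_continuous_measurable_fun => // x /set_mem Xx.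
  apply: cvgM; first by apply: continuous_comp; [exact: chx|exact: cg].
  by apply: cvg_norm; exact: ch'.
rewrite -[in RHS]WX ge0_integral_bigcup//=; first last.
- by move=> x _; rewrite lee_fin mulr_ge0.
- by rewrite WX; exact/measurable_EFinP.
- by move=> n; have [] := WP n.
transitivity (\int[mu]_t \sum_(n <oo) ((g t)%:E * (\1_(h @` W n) t)%:E))%E.
  apply: eq_integral => t _; rewrite nneseriesZl//.
  congr (_ * _)%E.
  rewrite (_ : [set x | _] = \bigcup_n (W n `&` [set x | h x = t])).
    rewrite npoints_bigcup; last by apply: trivIset_setIr.
    apply: eq_eseriesr => n _; rewrite npoints_le1.
      rewrite indicE; congr ((_ : bool)%:R%:E); apply/asboolP/idP.
        by move=> [x [Wx hx]]; apply/mem_set; exists x.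
      by move=> /set_mem[x Wx hx]; exists x.
    move=> x y [Wx <-] [Wy]; have [hinj _ _ _] := WP n.
    by move/esym; apply: hinj; exact/mem_set.
  rewrite -setI_bigcupl WX//.
rewrite integral_nneseries//.
- apply: eq_eseriesr => n _; have [_ _ mh <-] := WP n.
  rewrite [RHS]integral_mkcond; apply: eq_integral => t _.
  by rewrite patchE indicE; case: ifP => _; rewrite ?mule1 ?mule0.
- move=> n; apply: emeasurable_funM; first exact/measurable_EFinP.
  by apply/measurable_EFinP/measurable_indic; have [] := WP n.
- by move=> n x _; rewrite mule_ge0// lee_fin.
Qed.
End one_dim.

Section C1_functions.
Context {R : realType}.
Implicit Types u : R -> R -> R.

Definition cont2 u := forall a b, u z.1 z.2 @[z --> (a, b)] --> u a b.

Definition C1fun (u ux uy : R -> R -> R) := [/\ forall x y : R, is_derive x 1 (u ^~ y) (ux x y),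
  forall x y : R, is_derive y 1 (u x) (uy x y), cont2 u, cont2 ux & cont2 uy].

Lemma mean_value_between (f df : R -> R) (x s : R) :
  (forall t : R, is_derive t 1 f (df t)) ->
  exists2 c, `|c - x| <= `|s - x| & f s - f x = df c * (s - x).
Proof.
move=> dfE; have cf a b : {within `[a, b], continuous f}.
  apply: continuous_subspaceT => t; apply/differentiable_continuous/derivable1_diffP.
  by have dt := dfE t; exact: ex_derive.
have [xs|sx] := leP x s.
  have [c ci ->] := MVT_segment xs (fun t _ => dfE t) (@cf _ _).
  exists c => //; move: ci; rewrite in_itv/= => /andP[xc cs].
  by rewrite !ger0_norm ?subr_ge0// lerB.
have [c ci E] := MVT_segment (ltW sx) (fun t _ => dfE t) (@cf _ _).
exists c; last by rewrite -opprB E; ring.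
move: ci; rewrite in_itv/= => /andP[sc cx].
by rewrite !ler0_norm; lra.
Qed.

Lemma C1fun_caratheodory u ux uy x y : C1fun u ux uy ->
  exists (A : R -> R -> R) (B : R -> R),
  [/\ forall s t, u s t - u x y = A s t * (s - x) + B t * (t - y),
      A z.1 z.2 @[z --> (x, y)] --> ux x y, B t @[t --> y] --> uy x y,
      A x y = ux x y & B y = uy x y].
Proof.
move=> [dx dy cu cx cy].
have [B [BE cB By]] := (is_derive1_caratheodory (u x) y (uy x y)).1 (dy x y).
exists (fun s t => if s == x then ux x t else (u s t - u x t) / (s - x)), B.
split.
- move=> s t; rewrite -BE; case: eqVneq => [->|sx]; first by rewrite subrr; ring.
  by rewrite divfK ?subr_eq0//; ring.
- apply/cvgrPdist_le => e e0.
  have /cvgrPdist_le/(_ _ e0) := cx x y.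
  move=> [[P Q]/= [Px Qy] PQ].
  move: Px => [d /= d0 dP]; near=> z => /=.
  have zd : `|x - z.1| < d.
    near: z; exists (ball x d, setT) => /=; first by split; [exact: nbhsx_ballx|exact: filterT].
    by move=> z [/= + _].
  have Qz : Q z.2.
    by near: z; exists (setT, Q) => /=; [split => //; exact: filterT|move=> z []].
  case: eqVneq => [zx|zx].
    by apply: (PQ (x, z.2)); split => //=; apply: dP; rewrite /= subrr normr0.
  have [c cx' ->] := mean_value_between x z.1 (fun t => dx t z.2).
  rewrite mulfK ?subr_eq0//; apply: (PQ (c, z.2)); split => //=; apply: dP => /=.
  by rewrite distrC (le_lt_trans cx')// distrC.
- by rewrite -By.
- by rewrite eqxx.
- by [].
Unshelve. all: by end_near. Qed.

Lemma cont2_cvg u (T : Type) (F : set_system T) (f g : T -> R) a b :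
  Filter F -> cont2 u -> f t @[t --> F] --> a -> g t @[t --> F] --> b ->
  u (f t) (g t) @[t --> F] --> u a b.
Proof. by move=> FF cu; apply: continuous2_cvg; exact: cu. Qed.

Lemma C1fun_chain u ux uy (Y : R -> R) (x y' : R) : C1fun u ux uy ->
  is_derive x 1 Y y' -> is_derive x 1 (fun t => u t (Y t)) (ux x (Y x) + uy x (Y x) * y').
Proof.
move=> C1 dY; have cY : {for x, continuous Y}.
  by apply/differentiable_continuous/derivable1_diffP; exact: ex_derive.
have [A [B [E cA cB Axy By]]] := C1fun_caratheodory x (Y x) C1.
have [g [gE cg gx]] := (is_derive1_caratheodory Y x y').1 dY.
apply/is_derive1_caratheodory.
pose k := fun t => A t (Y t) + B (Y t) * g t.
have cAx : A t (Y t) @[t --> x] --> ux x (Y x).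
  apply: (cvg_comp2 (h := A) _ _ cA); [exact: cvg_id|exact: cY].
have cBx : B (Y t) @[t --> x] --> uy x (Y x) by apply: (cvg_comp _ _ cY).
have kx : k t @[t --> x] --> ux x (Y x) + uy x (Y x) * y'.
  by apply: cvgD => //; apply: cvgM => //; rewrite -gx; exact: cg.
have kE : k x = ux x (Y x) + uy x (Y x) * y' by rewrite /k Axy By gx.
exists k; split => //; first by move=> t; rewrite E gE /k; ring.
by rewrite -kE in kx; exact: kx.
Qed.
End C1_functions.

Section measurable_plane.
Context {R : realType}.

Lemma open_continuous_measurable_fun2 (U : set (R * R)) (f : R * R -> R) :
  open U -> (forall p, U p -> {for p, continuous f}) -> measurable_fun U f.
Proof.
move=> oU cf; apply: (measurability _ (RGenOpens.measurableE R)).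
move=> _ [_ [a [b ->] <-]]; apply: open_measurable2.
rewrite openE => p [Up fp]; have oab : open `]a, b[%classic by exact: interval_open.
apply: filterI; first by apply: open_nbhs_nbhs.
by apply: (cf _ Up); apply: open_nbhs_nbhs.
Qed.

End measurable_plane.

Section implicit_function.
Context {R : realType}.
Variables (u ux uy : R -> R -> R) (x0 x1 y0 y1 : R).
Hypothesis C1u : C1fun u ux uy.
Hypothesis uy0 : forall x y, x0 <= x <= x1 -> y0 <= y <= y1 -> uy x y != 0.

Definition ifun (x c : R) : R := xget 0 [set y | y0 < y < y1 /\ u x y = c].

(* The domain of [ifun]: the image of the open box under [(x, y) |-> (x, u x y)]. *)
Definition idom : set (R * R) :=
  [set p | x0 < p.1 < x1 /\ exists y, y0 < y < y1 /\ u p.1 y = p.2].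

Let duy x y : is_derive y (1 : R) (u x) (uy x y).
Proof. by case: C1u. Qed.

Let cux x a b : {within `[a, b], continuous (u x)}.
Proof.
apply: continuous_subspaceT => t; apply/differentiable_continuous/derivable1_diffP.
by have dt := duy x t; exact: ex_derive.
Qed.

Lemma implicit_inj x y y' : x0 <= x <= x1 -> y0 <= y <= y1 -> y0 <= y' <= y1 ->
  u x y = u x y' -> y = y'.
Proof.
have W a b : x0 <= x <= x1 -> y0 <= a -> a < b -> b <= y1 -> u x a != u x b.
  move=> xx ya ab yb; apply/eqP => uab.
  have [c] := MVT ab (fun t _ => duy x t) (@cux x _ _).
  rewrite in_itv/= => /andP[ac cb] /eqP; rewrite uab subrr eq_sym mulf_eq0 subr_eq0.
  rewrite (gt_eqF ab) orbF; apply/negP/uy0 => //.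
  by rewrite (le_trans ya (ltW ac)) (le_trans (ltW cb) yb).
move=> xx /andP[ya yb] /andP[ya' yb'] /eqP uu; apply/eqP.
case: (ltgtP y y') => // lt; [|move: uu; rewrite eq_sym => uu].
  by move: uu; apply: contraLR => _; exact: W.
by move: uu; apply: contraLR => _; exact: W.
Qed.

Lemma ifunP x c : idom (x, c) -> y0 < ifun x c < y1 /\ u x (ifun x c) = c.
Proof.
move=> [_ [y yc]]; apply: (@xgetPex _ 0 [set y | y0 < y < y1 /\ u x y = c]).
by exists y.
Qed.

Lemma ifun_u x y : x0 < x < x1 -> y0 < y < y1 -> ifun x (u x y) = y.
Proof.
move=> xx yy; have [yi ui] : y0 < ifun x (u x y) < y1 /\ u x (ifun x (u x y)) = u x y.
  by apply: ifunP; split => //; exists y.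
case/andP: xx yy yi => [/ltW ? /ltW ?] /andP[/ltW ? /ltW ?] /andP[/ltW ? /ltW ?].
by apply: (@implicit_inj x) => //; apply/andP.
Qed.

Lemma implicit_near x c (e : R) : idom (x, c) -> 0 < e ->
  \forall p \near ((x, c) : R * R), idom p /\ `|ifun p.1 p.2 - ifun x c| < e.
Proof.
move=> xc e0; have [/andP[ya yb] uc] := ifunP xc; have [/= /andP[xa xb] _] := xc.
set y := ifun x c in ya yb uc *.
have [d [d0 de d1 d2]] : exists d, [/\ 0 < d, d < e, y0 < y - d & y + d < y1].
  pose d := Num.min (e / 2) (Num.min ((y - y0) / 2) ((y1 - y) / 2)).
  have h1 : d <= e / 2 by rewrite ge_min lexx.
  have h2 : d <= (y - y0) / 2 by rewrite !ge_min lexx orbT.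
  have h3 : d <= (y1 - y) / 2 by rewrite !ge_min lexx !orbT.
  exists d; split; [by rewrite !lt_min !divr_gt0 ?subr_gt0| | |].
  - by clearbody d; lra.
  - by clearbody d; lra.
  - by clearbody d; lra.
have cu : cont2 u by case: C1u.
(* [u x] is monotone near [y], so [u - c] takes opposite signs at the ends. *)
have [s [sa sb]] : exists s : R, 0 < s * (u x (y + d) - c) /\ s * (u x (y - d) - c) < 0.
  have [h|h] : (u x (y - d) < c < u x (y + d)) \/ (u x (y + d) < c < u x (y - d)).
    have iab t : t \in `[y - d, y + d] -> x0 <= x <= x1 /\ y0 <= t <= y1.
      rewrite in_itv/= => /andP[yt ty]; rewrite (ltW xa) (ltW xb); split => //.
      by apply/andP; split; lra.
    have dux t : t \in `]y - d, y + d[ -> derivable (u x) t 1.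
      by move=> _; have dt := duy x t; exact: ex_derive.
    have duE t : (u x)^`()%classic t = uy x t.
      by have dt := duy x t; rewrite derive1E; exact: derive_val.
    have yd : y - d <= y + d by lra.
    have cuy : {within `[y - d, y + d], continuous (uy x)}.
      apply: continuous_subspaceT => t.
      case: C1u => _ _ _ _ cuy; apply: (@cont2_cvg R uy _ _ (cst x) id x t _ cuy).
        exact: cvg_cst.
      exact: cvg_id.
    have io t : t \in `]y - d, y + d[ -> t \in `[y - d, y + d].
      by rewrite !in_itv/= => /andP[/ltW -> /ltW ->].
    have [|pos|neg] := nonzero_same_sign yd cuy.
    - by move=> t /iab[]; exact: uy0.
    - left; rewrite -uc.
      have incr : {in `[y - d, y + d] &, {homo u x : x y / x < y}}.
        apply: gtr0_derive1_lt_cc; [exact: dux| |exact: cux].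
        by move=> t /io tt; rewrite duE pos.
      by rewrite !incr// ?in_itv/=; lra.
    - right; rewrite -uc.
      have decr : {in `[y - d, y + d] &, {homo u x : x y /~ x < y}}.
        apply: ltr0_derive1_lt_cc; [exact: dux| |exact: cux].
        by move=> t /io tt; rewrite duE neg.
      by rewrite !decr// ?in_itv/=; lra.
  - by exists 1; rewrite !mul1r subr_gt0 subr_lt0; case/andP: h.
  - by exists (-1); rewrite !mulN1r oppr_gt0 oppr_lt0 subr_gt0 subr_lt0; case/andP: h.
have pd r : s * (u z.1 (y + r) - z.2) @[z --> ((x, c) : R * R)] --> s * (u x (y + r) - c).
  apply: cvgM; first exact: cvg_cst.
  apply: cvgB; last exact: cvg_snd.
  apply: (@cont2_cvg R u _ _ fst (cst (y + r)) x (y + r) _ cu).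
    exact: cvg_fst.
  exact: cvg_cst.
near=> p.
have px : x0 < p.1 < x1.
  near: p; exists (`]x0, x1[%classic, setT); last by move=> q [/= + _]; rewrite in_itv.
  split; last exact: filterT.
  by apply: open_nbhs_nbhs; split; [exact: interval_open|rewrite /= in_itv/= xa].
have pa : 0 < s * (u p.1 (y + d) - p.2).
  by near: p; apply: (cvgr_gt _ (pd d)).
have pb : s * (u p.1 (y - d) - p.2) < 0.
  by near: p; apply: (cvgr_lt _ (pd (- d))).
have [t tI tE] : exists2 t, t \in `[y - d, y + d] & s * (u p.1 t - p.2) = 0.
  apply: (@IVT _ (fun t => s * (u p.1 t - p.2))); first by lra.
    apply: continuous_subspaceT => t; apply: cvgM; first exact: cvg_cst.
    apply: cvgB; last exact: cvg_cst.
    apply/differentiable_continuous/derivable1_diffP.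
    by have dt := duy p.1 t; exact: ex_derive.
  by rewrite ge_min (ltW pb) le_max (ltW pa) orbT.
have ut : u p.1 t = p.2.
  apply/eqP; rewrite -subr_eq0; move/eqP: tE; rewrite mulf_eq0 => /orP[/eqP s0|//].
  by move: pa; rewrite s0 mul0r ltxx.
move: tI; rewrite in_itv/= => /andP[td dt].
have ty : y0 < t < y1 by apply/andP; split; lra.
split; first by split => //; exists t.
rewrite -ut ifun_u// ltr_norml; apply/andP; split; lra.
Unshelve. all: by end_near. Qed.
End implicit_function.

Section implicit_regularity.
Context {R : realType}.
Variables (u ux uy : R -> R -> R) (x0 x1 y0 y1 : R).
Hypothesis C1u : C1fun u ux uy.
Hypothesis uy0 : forall x y, x0 <= x <= x1 -> y0 <= y <= y1 -> uy x y != 0.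
Local Notation Y := (ifun u y0 y1).
Local Notation D := (idom u x0 x1 y0 y1).

Lemma idom_open : open D.
Proof.
rewrite openE => -[x c] xc.
by apply: filterS (implicit_near C1u uy0 xc ltr01) => p [].
Qed.

Lemma ifun_cvg x c : D (x, c) -> Y z.1 z.2 @[z --> (x, c)] --> Y x c.
Proof.
move=> xc; apply/cvgrPdist_lt => e e0.
by apply: filterS (implicit_near C1u uy0 xc e0) => p [_]; rewrite distrC.
Qed.

Lemma ifun_cvg1 x c : D (x, c) -> Y t c @[t --> x] --> Y x c.
Proof.
move=> xc; have := ifun_cvg xc.
by move=> /(continuous2_cvg) h; apply: (h R (nbhs x) _ id (cst c)); [exact: cvg_id|exact: cvg_cst].
Qed.

Lemma idom_near x c : D (x, c) -> \forall t \near x, D (t, c).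
Proof.
move=> xc; have : nbhs (x, c) D by apply: open_nbhs_nbhs; split => //; exact: idom_open.
move=> [[P Q] /= [Px Qc] PQ]; apply: filterS Px => t Pt; apply: (PQ (t, c)); split => //.
exact: nbhs_singleton.
Qed.

Lemma ifun_box x c : D (x, c) ->
  [/\ x0 <= x <= x1, y0 <= Y x c <= y1 & u x (Y x c) = c].
Proof.
move=> xc; have [/andP[yy yy'] uc] := ifunP xc; case: xc => [/= /andP[xx xx'] _].
by split => //; apply/andP; split; exact: ltW.
Qed.

Lemma ifun_derive x c : D (x, c) ->
  is_derive x 1 (Y ^~ c) (- (ux x (Y x c) / uy x (Y x c))).
Proof.
move=> xc; have [xb yb uc] := ifun_box xc.
have [A [B [E cA cB Axy By]]] := C1fun_caratheodory x (Y x c) C1u.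
have cY := ifun_cvg1 xc.
have uy00 := uy0 xb yb.
pose k t := - (A t (Y t c) / B (Y t c)).
have kx : k t @[t --> x] --> - (ux x (Y x c) / uy x (Y x c)).
  apply: cvgN; apply: cvgM.
    by apply: (cvg_comp2 (h := A) _ _ cA); [exact: cvg_id|exact: cY].
  by apply: cvgV => //; apply: (cvg_comp _ _ cY cB).
apply/is_derive1_caratheodory.
pose G t := if t == x then - (ux x (Y x c) / uy x (Y x c))
  else (Y t c - Y x c) / (t - x).
have Gx : G x = - (ux x (Y x c) / uy x (Y x c)) by rewrite /G eqxx.
exists G; split => //.
- by move=> t; rewrite /G; case: eqVneq => [->|tx]; rewrite ?subrr ?mulr0// divfK ?subr_eq0.
- suff : G t @[t --> x] --> G x by [].
  rewrite Gx; apply: cvg_trans kx; apply: near_eq_cvg; near=> t.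
  have tc : D (t, c) by near: t; exact: idom_near.
  have [_ _ utc] := ifun_box tc.
  have Bt : B (Y t c) != 0.
    near: t; apply: (cvgr_neq0 (uy x (Y x c))) => //.
    exact: (cvg_comp _ _ cY cB).
  rewrite /k /G; case: eqVneq => [->|tx]; first by rewrite Axy By.
  have := E t (Y t c); rewrite utc uc subrr => e.
  have e' : Y t c - Y x c = - (A t (Y t c) * (t - x) / B (Y t c)).
    by apply: (mulfI Bt); rewrite mulrN mulrCA divff// mulr1; lra.
  by rewrite e' [_ * (t - x) / _]mulrAC mulNr mulfK ?subr_eq0.
Unshelve. all: by end_near. Qed.
End implicit_regularity.

Lemma continuous_cvg1 (R : realType) (T : Type) (F : set_system T) (f : T -> R)
    (g : R -> R) (a : R) : Filter F -> continuous g ->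
  f t @[t --> F] --> a -> g (f t) @[t --> F] --> g a.
Proof. by move=> FF cg fa; apply: (cvg_comp f g fa); exact: cg. Qed.

Section cell_area.
Context {R : realType}.
Local Notation mu := (@lebesgue_measure R).
Variables (u ux uy v vx vy : R -> R -> R) (x0 x1 y0 y1 : R) (g1 g2 : R -> R).
Hypothesis C1u : C1fun u ux uy.
Hypothesis C1v : C1fun v vx vy.
Local Notation J x y := (ux x y * vy x y - uy x y * vx x y).
Hypothesis uy0 : forall x y, x0 <= x <= x1 -> y0 <= y <= y1 -> uy x y != 0.
Hypothesis J0 : forall x y, x0 <= x <= x1 -> y0 <= y <= y1 -> J x y != 0.
Hypotheses (cg1 : continuous g1) (cg2 : continuous g2).
Hypotheses (g10 : forall t, 0 <= g1 t) (g20 : forall t, 0 <= g2 t).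

Local Notation Y := (ifun u y0 y1).
Local Notation D := (idom u x0 x1 y0 y1).
Let h' (x c : R) := vx x (Y x c) + vy x (Y x c) * - (ux x (Y x c) / uy x (Y x c)).
Let F (p : R * R) := g1 p.2 * g2 (v p.1 (Y p.1 p.2)) * `|h' p.1 p.2|.
Let Q : set (R * R) := [set p | x0 < p.1 < x1 /\ y0 < p.2 < y1].

Let h'E x c : D (x, c) -> h' x c = - (J x (Y x c) / uy x (Y x c)).
Proof.
move=> /(ifun_box (u := u))[xb yb _]; rewrite /h'; field.
exact: uy0.
Qed.

Let h'_cvg x c : D (x, c) -> h' z.1 z.2 @[z --> (x, c)] --> h' x c.
Proof.
move=> xc; have cY := ifun_cvg C1u uy0 xc; have [xb yb _] := ifun_box xc.
have cvgY (f : R -> R -> R) : cont2 f -> f z.1 (Y z.1 z.2) @[z --> (x, c)] --> f x (Y x c).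
  by move=> cf; apply: (@cont2_cvg R f _ _ fst (fun z => Y z.1 z.2) x (Y x c) _ cf) => //; exact: cvg_fst.
case: C1u => _ _ _ cux cuy; case: C1v => _ _ _ cvx cvy.
apply: cvgD; first exact: cvgY.
apply: cvgM; first exact: cvgY.
apply: cvgN; apply: cvgM; first exact: cvgY.
by apply: cvgV; [exact: uy0|exact: cvgY].
Qed.

Let F_cvg p : D p -> {for p, continuous F}.
Proof.
case: p => x c xc; have cY := ifun_cvg C1u uy0 xc.
have cv : v z.1 (Y z.1 z.2) @[z --> (x, c)] --> v x (Y x c).
  case: C1v => _ _ cv _ _.
  by apply: (@cont2_cvg R v _ _ fst (fun z => Y z.1 z.2) x (Y x c) _ cv) => //; exact: cvg_fst.
apply: cvgM; last by apply: cvg_norm; exact: h'_cvg.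
apply: cvgM.
  have cs : z.2 @[z --> (x, c)] --> c by exact: cvg_snd.
  exact: (continuous_cvg1 _ cg1 cs).
exact: (continuous_cvg1 _ cg2 cv).
Qed.

Let mF : measurable_fun setT (F \_ D).
Proof.
have oD : open D := idom_open C1u uy0.
apply/(measurable_restrictT F (open_measurable2 oD)).
by apply: open_continuous_measurable_fun2 => // p; exact: F_cvg.
Qed.

Let F0 p : 0 <= (F \_ D) p.
Proof. by rewrite patchE; case: ifP => // _; rewrite /F !mulr_ge0. Qed.

Let inner_c c : (\int[mu]_d ((g1 c * g2 d)%:E *
    npoints [set p : R * R | Q p /\ (u p.1 p.2 = c /\ v p.1 p.2 = d)]) =
  \int[mu]_x ((F \_ D) (x, c))%:E)%E.
Proof.
pose X := [set x | D (x, c)].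
have oX : open X.
  by rewrite openE => x xc; exact: (idom_near C1u uy0 xc).
pose h x := v x (Y x c).
transitivity (\int[mu]_d ((g1 c * g2 d)%:E * npoints [set x | X x /\ h x = d]))%E.
  apply: eq_integral => d _; congr (_ * _)%E.
  rewrite -(@npoints_image R _ _ (fun x => (x, Y x c)) [set x | X x /\ h x = d]).
    congr npoints; apply/seteqP; split => [[x y] /= [[xx yy] [ux' vx']]|_ [x [xc hx] <-]]/=.
      have e : Y x c = y by rewrite -ux' (ifun_u C1u uy0).
      exists x; rewrite /X/h/= e //; split => //; split => //=.
      by exists y.
    have [yy ue] := ifunP xc; have [xx _] := xc.
    by split.
  by move=> x x' _ _ [].
transitivity (\int[mu]_(x in X) (g1 c * g2 (h x) * `|h' x c|)%:E)%E; last first.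
  rewrite integral_mkcond; apply: eq_integral => x _; rewrite !patchE.
  rewrite (_ : (x \in X) = ((x, c) \in D)); first by case: ifP.
  by apply/idP/idP => /set_mem ?; exact/mem_set.
have cpair x : X x -> {for x, continuous (h' ^~ c)}.
  move=> xc; have := h'_cvg xc => /continuous2_cvg H.
  by apply: (H R (nbhs x) _ id (cst c)); [exact: cvg_id|exact: cvg_cst].
apply: (@area_formula1 R X h (h' ^~ c) (fun d => g1 c * g2 d)) => //.
- move=> x xc; have dY := ifun_derive C1u uy0 xc.
  exact: (C1fun_chain C1v dY).
- move=> x xc; have [xb yb _] := ifun_box xc; rewrite h'E// oppr_eq0 mulf_eq0.
  by rewrite (negbTE (J0 xb yb)) invr_eq0 (negbTE (uy0 xb yb)).
- by move=> x xc; apply: cvgM; [exact: cvg_cst|exact: cg2].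
- by move=> t; rewrite mulr_ge0.
- apply: measurable_funM => //; exact: continuous_measurable_fun.
Qed.

Let inner_x x : (\int[mu]_c ((F \_ D) (x, c))%:E =
  \int[mu]_y (((fun p : R * R => g1 (u p.1 p.2) * g2 (v p.1 p.2) * `|J p.1 p.2|)
     \_ Q) (x, y))%:E)%E.
Proof.
have [xx|xx] := boolP (x0 < x < x1); last first.
  rewrite !integral0_eq// => t _; rewrite patchE memNset// /Q/idom/=.
    by move=> [xx' _]; rewrite xx' in xx.
  by move=> [xx' _]; rewrite xx' in xx.
have xb : x0 <= x <= x1 by case/andP: xx => /ltW -> /ltW ->.
have duy y : is_derive y (1 : R) (u x) (uy x y) by case: C1u.
transitivity (\int[mu]_c (((F \_ D) (x, c))%:E *
    npoints [set y | `]y0, y1[%classic y /\ u x y = c]))%E.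
  apply: eq_integral => c _; rewrite patchE; case: ifPn => [/set_mem xc|_]; last by rewrite mul0e.
  rewrite npoints_le1; last first.
    move=> y y' /=; rewrite !in_itv/= => -[/andP[ya yb] e] [/andP[ya' yb'] e'].
    by apply: (implicit_inj C1u uy0 xb); rewrite ?e ?e' ?ltW.
  rewrite asboolT ?mule1//; case: xc => _ [y [yy uy']].
  by exists y; rewrite /= in_itv/= yy.
transitivity (\int[mu]_(y in `]y0, y1[) ((F \_ D) (x, u x y) * `|uy x y|)%:E)%E.
  apply: (@area_formula1 R `]y0, y1[%classic (u x) (uy x) (fun c => (F \_ D) (x, c))) => //.
  - move=> y _; case: C1u => _ _ _ _ cuy.
    apply: (@cont2_cvg R uy _ _ (cst x) id x y _ cuy); first exact: cvg_cst.
    exact: cvg_id.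
  - move=> y; rewrite /= in_itv/= => /andP[ya yb]; apply: uy0 => //.
    by apply/andP; split; exact: ltW.
  - move=> y; rewrite /= in_itv/= => yy.
    have xc : D (x, u x y) by split => //; exists y.
    have Fxc := F_cvg xc.
    have Dn : \forall p \near ((x, u x y) : R * R), D p.
      by apply: open_nbhs_nbhs; split => //; exact: (idom_open C1u uy0).
    have FDc : (F \_ D) p @[p --> ((x, u x y) : R * R)] --> F (x, u x y).
      apply: cvg_trans Fxc; apply: near_eq_cvg; near=> p.
      by rewrite patchE mem_set//; near: p.
    have e : (F \_ D) (x, u x y) = F (x, u x y) by rewrite patchE mem_set.
    suff : (F \_ D) (x, c) @[c --> u x y] --> (F \_ D) (x, u x y) by [].
    rewrite e; apply: (cvg_comp (fun c => (x, c)) (F \_ D) _ FDc).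
    exact: (@cvg_pair _ _ _ (nbhs (u x y)) (nbhs x) (nbhs (u x y)) _ _ _ (cst x) id (cvg_cst _) cvg_id).
  - exact: (measurableT_comp mF (measurable_pair1 x)).
rewrite integral_mkcond; apply: eq_integral => y _; rewrite !patchE.
have [/set_mem/=|] := boolP (y \in `]y0, y1[%classic).
  rewrite in_itv/= => yy; have xc : D (x, u x y) by split => //; exists y.
  rewrite !mem_set//.
  have e := ifun_u C1u uy0 xx yy.
  rewrite /F/= e h'E// e normrN normf_div -mulrA divfK//.
  by rewrite normr_eq0 uy0//; case/andP: yy => /ltW -> /ltW ->.
move=> /negP yy; rewrite memNset// => -[_ yy']; apply: yy; apply/mem_set.
by rewrite /= in_itv.
Unshelve. all: by end_near. Qed.

(* On a cell the implicit function [Y] of [u = c] makes [c] a coordinate; for fixed [c] the remaining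
   equation [v x (Y x c) = d] is handled by the one-dimensional formula. *)
Lemma cell_area : (\int[mu]_c \int[mu]_d ((g1 c * g2 d)%:E *
    npoints [set p : R * R | Q p /\ (u p.1 p.2 = c /\ v p.1 p.2 = d)]) =
  \int[(mu \x mu)%E]_(p in Q) (g1 (u p.1 p.2) * g2 (v p.1 p.2) * `|J p.1 p.2|)%:E)%E.
Proof.
under eq_integral do rewrite inner_c.
transitivity (\int[mu]_x \int[mu]_c ((F \_ D) (x, c))%:E)%E.
  apply/esym/(@fubini_tonelli _ _ _ _ R mu mu (fun p => ((F \_ D) p)%:E)).
    exact/measurable_EFinP.
  by move=> p; rewrite lee_fin.
under eq_integral do rewrite inner_x.
have oQ : open Q.
  rewrite openE => -[x y] [/= /andP[xa xb] /andP[ya yb]].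
  exists (`]x0, x1[%classic, `]y0, y1[%classic).
    by split; apply: open_nbhs_nbhs; split; rewrite /= ?in_itv/= ?xa ?ya//; exact: interval_open.
  by move=> p [/=]; rewrite !in_itv/=.
set G := fun p : R * R => g1 (u p.1 p.2) * g2 (v p.1 p.2) * `|J p.1 p.2|.
have G0 p : 0 <= (G \_ Q) p by rewrite patchE; case: ifP => // _; rewrite /G !mulr_ge0.
have mG : measurable_fun setT (G \_ Q).
  apply/(measurable_restrictT G (open_measurable2 oQ)).
  apply: open_continuous_measurable_fun2 => // -[x y] _.
  case: C1u => _ _ cu cux cuy; case: C1v => _ _ cv cvx cvy.
  apply: cvgM; last first.
    by apply: cvg_norm; apply: cvgB; apply: cvgM; [exact: cux|exact: cvy|exact: cuy|exact: cvx].
  apply: cvgM; first exact: (continuous_cvg1 _ cg1 (cu x y)).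
  exact: (continuous_cvg1 _ cg2 (cv x y)).
rewrite [RHS]integral_mkcond fubini_tonelli1.
- apply: eq_integral => x _; apply: eq_integral => y _.
  by rewrite !patchE; case: ifP.
- have := mG => /measurable_EFinP; apply: eq_measurable_fun => p _.
  by rewrite /= !patchE; case: ifP.
- by move=> p; rewrite patchE; case: ifP => // _; rewrite lee_fin /G !mulr_ge0.
Qed.
End cell_area.

Section measurable_count.
Context {R : realType} d (M : measurableType d).

Lemma measurable_hit_box (w : M -> R * R -> R) (a b c e : R) :
  a <= b -> c <= e ->
  (forall x, continuous (w x)) -> (forall p, measurable_fun setT (w ^~ p)) ->
  (forall x p, 0 <= w x p) ->
  measurable [set x | exists p, (`[a, b] `*` `[c, e]) p /\ w x p = 0].
Proof.
move=> ab ce cw mw w0; set K := (`[a, b] `*` `[c, e])%classic.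
have cK : compact K by apply: compact_setX; exact: segment_compact.
pose pt (rs : rat * rat) : R * R :=
  (a + (b - a) * ratr rs.1, c + (e - c) * ratr rs.2).
pose ok (rs : rat * rat) := [&& 0 <= rs.1 <= 1 & 0 <= rs.2 <= 1].
have Kpt rs : ok rs -> K (pt rs).
  move=> /andP[/andP[r0 r1] /andP[s0 s1]].
  have r0' : 0 <= ratr rs.1 :> R by rewrite ler0q.
  have s0' : 0 <= ratr rs.2 :> R by rewrite ler0q.
  have r1' : ratr rs.1 <= 1 :> R by rewrite -(rmorph1 (@ratr R)) ler_rat.
  have s1' : ratr rs.2 <= 1 :> R by rewrite -(rmorph1 (@ratr R)) ler_rat.
  by split; rewrite /= in_itv/=; apply/andP; split; nra.
rewrite (_ : mkset _ = \bigcap_k \bigcup_rs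
   [set x | ok rs /\ w x (pt rs) < k.+1%:R^-1]).
  apply: bigcapT_measurable => k; apply: countable_bigcupT_measurable => // rs.
  have [okr|okr] := boolP (ok rs); last first.
    by rewrite (_ : mkset _ = set0)//; apply/seteqP; split => // x [].
  rewrite (_ : mkset _ = setT `&` (w ^~ (pt rs)) @^-1` `]-oo, k.+1%:R^-1[%classic).
    exact: mw.
  by apply/seteqP; split => x /=; rewrite in_itv/=; [move=> []|move=> [_]].
apply/seteqP; split => x /=.
  move=> [p [Kp wp]] k _.
  have : \forall q \near p, w x q < k.+1%:R^-1.
    by apply: (cvgr_lt (w x p) (cw x p)); rewrite wp invr_gt0.
  move=> [[A B] /= [/= Ap Bp] AB].
  have dens (lo hi z : R) (U : set R) : lo <= hi -> z \in `[lo, hi] -> nbhs z U ->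
      exists r : rat, 0 <= r <= 1 /\ U (lo + (hi - lo) * ratr r).
    move=> lohi zI [r0 /= r00 zU]; move: zI; rewrite in_itv/= => /andP[lz zh].
    move: lohi; rewrite le_eqVlt => /predU1P[lh|lh].
      exists 0; split => //; apply: zU => /=.
      have zl : z = lo by apply/eqP; rewrite eq_le lz andbT lh.
      by rewrite rmorph0 mulr0 addr0 zl subrr normr0.
    have lh' : 0 < hi - lo by rewrite subr_gt0.
    pose t := (z - lo) / (hi - lo).
    have t0 : 0 <= t by rewrite divr_ge0 ?subr_ge0// ltW.
    have t1 : t <= 1 by rewrite ler_pdivrMr// mul1r lerB.
    have tE : z = lo + (hi - lo) * t by rewrite mulrC divfK ?gt_eqF//; ring.
    have h0 : 0 < r0 / (hi - lo) by rewrite divr_gt0.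
    have hE : (hi - lo) * (r0 / (hi - lo)) = r0 by rewrite mulrC divfK ?gt_eqF.
    have [|q] := @rat_in_itvoo R (Num.max 0 (t - r0 / (hi - lo))) (Num.min 1 (t + r0 / (hi - lo))).
      by rewrite gt_max !lt_min; apply/andP; split; apply/andP; split; lra.
    rewrite in_itv/= gt_max !lt_min => /andP[/andP[q0 q1] /andP[q2 q3]].
    exists q; split.
      by rewrite -(ler0q R) -(ler_rat R) rmorph1 !ltW.
    apply: zU => /=; rewrite tE ltr_norml; apply/andP; split; nra.
  have [r [r01 Ar]] := dens a b p.1 A ab Kp.1 Ap.
  have [s [s01 Bs]] := dens c e p.2 B ce Kp.2 Bp.
  exists (r, s) => //; split; first by rewrite /ok/= r01 s01.
  exact: (AB (_, _)).
move=> H; apply: contrapT => nz.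
have nz' p : K p -> w x p != 0.
  by move=> Kp; apply/eqP => wp; apply: nz; exists p.
have cwK : compact (w x @` K).
  by apply: continuous_compact => //; exact: continuous_subspaceT.
have : open (~` (w x @` K)).
  by apply: closed_openC; apply: compact_closed => //; exact: Rhausdorff.
rewrite openE => /(_ 0)[|ep /= ep0 epK].
  by move=> [p Kp wp]; move: (nz' p Kp); rewrite wp eqxx.
have [k kep] : exists k : nat, k.+1%:R^-1 < ep.
  have [k _ /(_ k (leqnn k)) h] := near_infty_natSinv_lt (PosNum ep0).
  by exists k.
have [rs _ [ok_ wrs]] := H k I.
apply: (epK (w x (pt rs))); last by exists (pt rs) => //; exact: Kpt.
by rewrite /= sub0r normrN ger0_norm// (lt_trans wrs).
Qed.

Variables (u v : M -> R -> R -> R).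
Hypotheses (cu : forall x, cont2 (u x)) (cv : forall x, cont2 (v x)).
Hypotheses (mu_ : forall p : R * R, measurable_fun setT (fun x => u x p.1 p.2))
           (mv_ : forall p : R * R, measurable_fun setT (fun x => v x p.1 p.2)).

Local Notation zeros T x := [set p : R * R | T p /\ (u x p.1 p.2 = 0 /\ v x p.1 p.2 = 0)].

Lemma measurable_hit_cell k ij :
  measurable [set x | zeros (fun p => didx2 k p = ij) x !=set0].
Proof.
pose w x (p : R * R) := `|u x p.1 p.2| + `|v x p.1 p.2|.
have wE x p : w x p = 0 <-> u x p.1 p.2 = 0 /\ v x p.1 p.2 = 0.
  rewrite /w; split => [/eqP|[-> ->]]; last by rewrite normr0 addr0.
  by rewrite paddr_eq0// !normr_eq0 => /andP[/eqP -> /eqP ->].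
pose q (l : nat) (i : int) : R := dend k i + (1 - l.+1%:R^-1) / 2 ^+ k.
have k0 : 0 < (2 ^+ k)^-1 :> R by rewrite invr_gt0 exprn_gt0.
have qle l i : dend k i <= q l i.
  rewrite /q lerDl mulr_ge0 ?(ltW k0)// subr_ge0 invf_le1 ?ler1n//.
rewrite (_ : mkset _ = \bigcup_l [set x | exists p,
    (`[dend k ij.1, q l ij.1] `*` `[dend k ij.2, q l ij.2]) p /\ w x p = 0]).
  apply: bigcup_measurable => l _; apply: measurable_hit_box => //.
  - move=> x -[p1 p2]; apply: cvgD; apply: cvg_norm; [exact: cu|exact: cv].
  - by move=> p; apply: measurable_funD; apply: measurableT_comp.
  - by move=> x p; rewrite addr_ge0.
have qlt l i : q l i < dend k (i + 1).
  rewrite dend_width ltrD2l -[ltRHS]mul1r ltr_pM2r// ltrBlDr ltrDl invr_gt0//.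
apply/seteqP; split => x /=.
  move=> [p [pij] /wE wp].
  have : [set p | didx2 k p = ij] p by [].
  rewrite didx2_set => -[/=]; rewrite !in_itv/= => /andP[p1 p1'] /andP[p2 p2'].
  have ex z i : dend k i <= z -> z < dend k (i + 1) ->
      \forall l \near \oo, z <= q l i.
    move=> z1 z2; near=> l.
    have : l.+1%:R^-1 < (dend k (i + 1) - z) * 2 ^+ k.
      near: l; have e0 : 0 < (dend k (i + 1) - z) * 2 ^+ k.
        by rewrite mulr_gt0 ?subr_gt0// exprn_gt0.
      exact: (near_infty_natSinv_lt (PosNum e0)).
    rewrite -ltr_pdivrMr ?exprn_gt0// dend_width /q => h.
    by rewrite mulrBl mul1r addrA lerBrDr -lerBrDl ltW.
  have [l /= H1 H2] : exists2 l, p.1 <= q l ij.1 & p.2 <= q l ij.2.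
    have [l _ /(_ l (leqnn l)) [? ?]] := filterI (ex _ _ p1 p1') (ex _ _ p2 p2').
    by exists l.
  exists l => //; exists p; split => //.
  by split; rewrite /= in_itv/= ?p1 ?p2.
move=> [l _ [p [[/=]]]]; rewrite !in_itv/= => /andP[p1 p1'] /andP[p2 p2'] /wE wp.
exists p; split => //.
have : (`[dend k ij.1, dend k (ij.1 + 1)[ `*` `[dend k ij.2, dend k (ij.2 + 1)[) p.
  by split; rewrite /= in_itv/= ?p1 ?p2; apply: le_lt_trans (qlt l _).
by rewrite -didx2_set.
Unshelve. all: by end_near. Qed.

Let near_seq (S : eqType) (s : seq S) (P : nat -> S -> Prop) :
  (forall p, p \in s -> \forall k \near \oo, P k p) ->
  \forall k \near \oo, forall p, p \in s -> P k p.
Proof.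
elim: s => [|p s IH] H; first by near=> k.
have h1 := H p (mem_head _ _).
have h2 : \forall k \near \oo, forall p, p \in s -> P k p.
  by apply: IH => q qs; apply: H; rewrite in_cons qs orbT.
by apply: filterS2 h1 h2 => k h1 h2 q; rewrite in_cons => /predU1P[->|]; [exact: h1|exact: h2].
Unshelve. all: by end_near. Qed.

(* Measurability of the count: distinct zeros lie in distinct cells of every sufficiently fine grid. *)
Lemma npoints_ge_cells (T : set (R * R)) (Z : set (R * R)) m : open T ->
  (m%:R%:E <= npoints (T `&` Z) :> \bar R)%E <->
  exists k (s : seq (int * int)), [/\ uniq s, size s = m &
    forall ij, ij \in s -> [set p | didx2 k p = ij] `<=` T /\
      (Z `&` [set p | didx2 k p = ij]) !=set0].
Proof.
move=> oT; rewrite npoints_geP; split => [[s [us sm sZ]]|[k [s [us sm sZ]]]].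
  have H1 p : p \in s -> \forall k \near \oo, [set q | didx2 k q = didx2 k p] `<=` T.
    move=> /sZ [Tp _]; have : nbhs p T by apply: open_nbhs_nbhs.
    move=> /didx2_near; apply: filterS => k; apply: subset_trans => q /= <-.
    exact: didx2_box.
  have H2 p q : p != q -> \forall k \near \oo, didx2 k p != didx2 k q.
    move=> pq; have : nbhs p (~` [set q]).
      apply: open_nbhs_nbhs; split; last by apply/eqP.
      by apply: closed_openC; apply: accessible_closed_set1; apply: hausdorff_accessible; exact: norm_hausdorff.
    move=> /didx2_near; apply: filterS => k kq; apply/eqP => e.
    by apply: (kq q) => //; rewrite e; exact: didx2_box.
  have [k [kT kinj]] : exists k, (forall p, p \in s -> [set q | didx2 k q = didx2 k p] `<=` T) /\
     {in s &, injective (didx2 k)}.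
    have A1 := near_seq H1.
    have A2 : \forall k \near \oo, forall p, p \in s -> forall q, q \in s ->
        p != q -> didx2 k p != didx2 k q.
      apply: near_seq => p _; apply: near_seq => q _.
      by have [->|/H2] := eqVneq p q; [near=> k|apply: filterS].
    have [k _ /(_ k (leqnn k)) [A1k A2k]] := filterI A1 A2.
    exists k; split => // p q ps qs /eqP; apply: contraTeq; exact: A2k.
  exists k, (map (didx2 k) s); rewrite size_map map_inj_in_uniq//; split => //.
  move=> ij /mapP[p ps ->]; split; first exact: kT.
  by exists p; split => //; have [] := sZ p ps.
pose f ij := xget (0, 0) (Z `&` [set p | didx2 k p = ij]).
have fP ij : ij \in s -> Z (f ij) /\ didx2 k (f ij) = ij.
  by move=> /sZ[_ ?]; exact: (@xgetPex _ (0, 0) (Z `&` [set p | didx2 k p = ij])).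
exists (map f s); rewrite size_map map_inj_in_uniq//.
  split => // p /mapP[ij ijs ->]; have [Zf fE] := fP _ ijs; split => //.
  by apply: (sZ ij ijs).1.
by move=> i j /fP[_ fi] /fP[_ fj] fij; rewrite -fi -fj fij.
Unshelve. all: by end_near. Qed.

Lemma measurable_npoints_zeros (T : set (R * R)) : open T ->
  measurable_fun setT (fun x => npoints (zeros T x) : \bar R).
Proof.
move=> oT.
have mE m : measurable [set x | (m%:R%:E <= npoints (zeros T x) :> \bar R)%E].
  rewrite (_ : mkset _ = \bigcup_(ks in [set: nat * seq (int * int)])
    [set x | [/\ uniq ks.2, size ks.2 = m &
      (forall ij, ij \in ks.2 -> [set p | didx2 ks.1 p = ij] `<=` T)] /\
      (\bigcap_(ij in [set` ks.2]) [set x | zeros (fun p => didx2 ks.1 p = ij) x !=set0]) x]).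
    apply: countable_bigcupT_measurable => // -[k s] /=.
    have [H|H] := pselect [/\ uniq s, size s = m &
      (forall ij, ij \in s -> [set p : R * R | didx2 k p = ij] `<=` T)].
      rewrite (_ : mkset _ = \bigcap_(ij in [set` s]) [set x | zeros (fun p => didx2 k p = ij) x !=set0]).
        apply: fin_bigcap_measurable => // ij _; exact: measurable_hit_cell.
      by apply/seteqP; split => x /=; tauto.
    by rewrite (_ : mkset _ = set0)//; apply/seteqP; split => x //= [].
  apply/seteqP; split => x /=.
    rewrite (npoints_ge_cells [set p | u x p.1 p.2 = 0 /\ v x p.1 p.2 = 0] m oT).
    move=> [k [s [us sm sZ]]]; exists (k, s) => //=; split.
      by split => // ij /sZ[].
    move=> ij /= /sZ[_ [p [Zp pij]]]; exists p; split => //.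
  move=> [[k s] _ /= [[us sm sT] H]].
  rewrite (npoints_ge_cells [set p | u x p.1 p.2 = 0 /\ v x p.1 p.2 = 0] m oT).
  exists k, s; split => // ij ijs; split; first exact: sT.
  by have [p [pij Zp]] := H ij ijs; exists p.
apply: (measurability _ (ErealGenCInfty.measurableE R)) => _ [_ [c ->] <-].
have [m cm] : exists m : nat, forall n : nat, (c <= n%:R) = (m <= n)%N.
  have ex : exists n : nat, c <= n%:R.
    by exists (Num.truncn c).+1; exact/ltW/truncnS_gt.
  case: (ex_minnP ex) => m cm mm; exists m => n; apply/idP/idP => [/mm//|mn].
  by rewrite (le_trans cm)// ler_nat.
rewrite setTI (_ : _ @^-1` _ = [set x | (m%:R%:E <= npoints (zeros T x) :> \bar R)%E])//.
apply/seteqP; split => x /=; rewrite in_itv/= andbT /npoints; case: ifP => _;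
  by rewrite ?leey// !lee_fin cm ler_nat.
Qed.
End measurable_count.

Section null_image.
Context {R : realType}.
Local Notation mu := (@lebesgue_measure R).
Local Notation mu2 := (mu \x mu)%E.

Lemma cont2_continuous (f : R -> R -> R) : cont2 f -> continuous (fun p : R * R => f p.1 p.2).
Proof. by move=> cf -[a b]; exact: cf. Qed.

Lemma cont2_bounded (f : R -> R -> R) (m : R) : cont2 f ->
  exists2 L : R, 0 <= L & forall x y, `|x| <= m -> `|y| <= m -> `|f x y| <= L.
Proof.
move=> cf; set K := (`[- m, m] `*` `[- m, m])%classic : set (R * R).
have cK : compact K by apply: compact_setX; exact: segment_compact.
have : compact ((fun p : R * R => f p.1 p.2) @` K).
  by apply: continuous_compact => //; apply: continuous_subspaceT; exact: cont2_continuous.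
move=> /compact_bounded [L [_ HL]]; exists (Num.max 0 (L + 1)); first by rewrite le_max lexx.
move=> x y xm ym; rewrite le_max; apply/orP; right.
apply: (HL (L + 1)); first by rewrite ltrDl.
by exists (x, y) => //; split; rewrite /= in_itv/= -ler_norml.
Qed.

Lemma C1fun_lipschitz (u ux uy : R -> R -> R) (m : R) : C1fun u ux uy ->
  exists2 L : R, 0 <= L & forall x y x' y', `|x| <= m -> `|y| <= m -> `|x'| <= m -> `|y'| <= m ->
    `|u x' y' - u x y| <= L * (`|x' - x| + `|y' - y|).
Proof.
move=> [dx dy _ cx cy].
have [L1 L10 HL1] := cont2_bounded m cx; have [L2 L20 HL2] := cont2_bounded m cy.
have mvt (f df : R -> R) a b (L : R) : (forall t : R, is_derive t 1 f (df t)) ->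
    `|a| <= m -> `|b| <= m -> (forall t, `|t| <= m -> `|df t| <= L) ->
    `|f b - f a| <= L * `|b - a|.
  move=> dfE am bm dfL.
  have cf p q : {within `[p, q], continuous f}.
    apply: continuous_subspaceT => t; apply/differentiable_continuous/derivable1_diffP.
    by have dt := dfE t; exact: ex_derive.
  wlog ab : a b am bm / a <= b.
    move=> H; have [h|/ltW h] := leP a b; first exact: H.
    by rewrite distrC (_ : `|b - a| = `|a - b|) ?H// distrC.
  have [c + ->] := MVT_segment ab (fun t _ => dfE t) (@cf _ _).
  rewrite in_itv/= => /andP[ac cb]; rewrite normrM ler_wpM2r// dfL//.
  by move: am bm; rewrite !ler_norml => /andP[? ?] /andP[? ?]; apply/andP; split; lra.
exists (L1 + L2) => [|x y x' y' xm ym xm' ym']; first by rewrite addr_ge0.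
have -> : u x' y' - u x y = (u x' y' - u x y') + (u x y' - u x y) by ring.
apply: (le_trans (ler_normD _ _)).
have h1 := mvt (u ^~ y') (ux ^~ y') x x' L1 (dx ^~ y') xm xm' (fun t tm => HL1 t y' tm ym').
have h2 := mvt (u x) (uy x) y y' L2 (dy x) ym ym' (fun t tm => HL2 x t xm tm).
have := normr_ge0 (x' - x); have := normr_ge0 (y' - y); move: h1 h2 => /=.
set A := `|x' - x|; set B := `|y' - y|; nra.
Qed.

Lemma didx_dist k (x y : R) : didx k x = didx k y -> `|x - y| <= (2 ^+ k)^-1.
Proof.
move=> xy; have := didx_itv k x; have := didx_itv k y; rewrite xy dend_width ler_norml.
move=> /andP[? ?] /andP[? ?]; apply/andP; split; lra.
Qed.

Lemma didx2_measure k ij : mu2 [set p | didx2 k p = ij] = ((2 ^+ k)^-1 ^+ 2)%:E.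
Proof.
rewrite didx2_set product_measure1E//; try exact: measurable_itv.
rewrite [X in (_ * X)%E]lebesgue_measure_itv [X in (X * _)%E]lebesgue_measure_itv/= !lte_fin !dend_lt.
by rewrite -!EFinD -EFinM !dend_width; congr (_%:E); ring.
Qed.

Let enum_pairs : exists e : nat -> option (int * int),
  (forall ij, exists n, e n = Some ij) /\
  (forall n n' ij, e n = Some ij -> e n' = Some ij -> n = n').
Proof.
exists (@pickle_inv (int * int)%type); split.
  by move=> ij; exists (choice.pickle ij); rewrite pickleK_inv.
move=> n n' ij En En'; have := @pickle_invK (int * int)%type n.
by have := @pickle_invK (int * int)%type n'; rewrite En En'/= => -> ->.
Qed.

Let near_bound (m a b : R) : `|a| <= m -> `|a - b| <= (2 ^+ 0)^-1 ->
  `[- m - 1, m + 1]%classic b.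
Proof.
rewrite expr0 invr1 /= in_itv/= !ler_norml => /andP[? ?] /andP[? ?].
by apply/andP; split; lra.
Qed.

(* The cells of side [2^-k] meeting the compact null set [Z] have total area tending to 0, and their
   images lie in squares of comparable area. *)
Lemma null_image_bounded (u ux uy v vx vy : R -> R -> R) (Z : set (R * R)) (m : R) :
  C1fun u ux uy -> C1fun v vx vy -> closed Z -> mu2 Z = 0%E ->
  Z `<=` [set p | `|p.1| <= m /\ `|p.2| <= m] ->
  mu2.-negligible [set c | exists p, Z p /\ u p.1 p.2 = c.1 /\ v p.1 p.2 = c.2].
Proof.
move=> C1u C1v cZ Z0 Zm.
have [L1 L10 HL1] := C1fun_lipschitz m C1u; have [L2 L20 HL2] := C1fun_lipschitz m C1v.
have [e [esurj einj]] := enum_pairs; pose L := L1 + L2.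
have L0 : 0 <= L by rewrite addr_ge0.
pose hit k (ij : int * int) := (Z `&` [set p | didx2 k p = ij]) !=set0.
pose A k n := if e n is Some ij then
  if `[< hit k ij >] then [set p : R * R | didx2 k p = ij] else set0 else set0.
pose r k := L * 2 * (2 ^+ k)^-1.
pose sq k p0 : set (R * R) := `[u p0.1 p0.2 - r k, u p0.1 p0.2 + r k] `*` `[v p0.1 p0.2 - r k, v p0.1 p0.2 + r k].
pose B k n := if e n is Some ij then
  if `[< hit k ij >] then sq k (xget (0, 0) (Z `&` [set p | didx2 k p = ij])) else set0 else set0.
have k0 k : 0 < (2 ^+ k)^-1 :> R by rewrite invr_gt0 exprn_gt0.
have r0 k : 0 <= r k by rewrite /r !mulr_ge0// ltW.
have mA k n : measurable (A k n).
  by rewrite /A; case: (e n) => // ij; case: ifP => // _; exact: measurable_didx2.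
have mB k n : measurable (B k n).
  rewrite /B; case: (e n) => // ij; case: ifP => // _.
  by apply: measurableX; exact: measurable_itv.
have tA k : trivIset setT (A k).
  move=> n n' _ _ [p []]; rewrite /A.
  case En : (e n) => [ij|//]; case En' : (e n') => [ij'|//].
  case: ifP => // _; case: ifP => // _ pij pij'.
  have eij : ij = ij' by rewrite -(pij : didx2 k p = ij) -(pij' : didx2 k p = ij').
  by apply: (einj _ _ ij) => //; rewrite eij.
have AB k n : (mu2 (B k n) = ((4 * L) ^+ 2)%:E * mu2 (A k n))%E.
  rewrite /A /B; case: (e n) => [ij|]; last by rewrite !measure0 mule0.
  case: ifP => _; last by rewrite !measure0 mule0.
  rewrite didx2_measure /sq product_measure1E//; try exact: measurable_itv.
  have wd (c : R) : mu `[c - r k, c + r k] = (2 * r k)%:E.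
    rewrite lebesgue_measure_itv/= lte_fin; case: ltP => h.
      by rewrite -EFinD; congr (_%:E); ring.
    by congr (_%:E); have := r0 k; lra.
  transitivity ((2 * r k)%:E * (2 * r k)%:E)%E; first by congr (_ * _)%E; exact: wd.
  by rewrite -!EFinM; congr (_%:E); rewrite /r; ring.
pose U k := \bigcup_n A k n.
have UE k : U k = [set p | hit k (didx2 k p)].
  apply/seteqP; split => p.
    move=> [n _]; rewrite /A; case: (e n) => // ij; case: ifP => // /asboolP h pij.
    have pijE : didx2 k p = ij := pij.
    by rewrite -pijE in h.
  move=> h; have [n En] := esurj (didx2 k p); exists n; first by [].
  by rewrite /A En asboolT.
have Ucvg : mu2 (U k) @[k --> \oo] --> 0%E.
  have -> : 0%E = mu2 (\bigcap_k U k).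
    rewrite -[LHS]Z0; congr (mu2 _); apply/seteqP; split => p.
      by move=> Zp k _; rewrite UE; exists p.
    move=> Up; apply: contrapT => Zp.
    have : nbhs p (~` Z) by apply: open_nbhs_nbhs; split => //; exact: closed_openC.
    move=> /didx2_near [k _ /(_ k (leqnn k)) kZ].
    have := Up k I; rewrite UE => -[q [Zq qp]]; apply: (kZ q) => //.
    by rewrite -qp; exact: didx2_box.
  have mU k : measurable (U k) by apply: bigcup_measurable => n _; exact: mA.
  apply: nonincreasing_cvg_mu => //.
  - have UM : U 0%N `<=` `[- m - 1, m + 1] `*` `[- m - 1, m + 1].
      move=> p; rewrite UE => -[q [/Zm[q1 q2] [/didx_dist d1 /didx_dist d2]]].
      by split; [exact: near_bound q1 d1|exact: near_bound q2 d2].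
    have mbox : measurable (`[- m - 1, m + 1] `*` `[- m - 1, m + 1] : set (R * R)).
      by apply: measurableX; exact: measurable_itv.
    have boxoo : (mu2 (`[(- m - 1)%R, (m + 1)%R] `*` `[(- m - 1)%R, (m + 1)%R]) < +oo)%E.
      rewrite product_measure1E//; try exact: measurable_itv.
      rewrite [X in (_ * X)%E]lebesgue_measure_itv [X in (X * _)%E]lebesgue_measure_itv/=.
      by case: ifP => _; rewrite -?EFinD -?EFinM ?mule0 ltry.
    exact: (le_lt_trans (le_measure mu2 (mem_set (mU 0%N)) (mem_set mbox) UM) boxoo).
  - exact: bigcapT_measurable.
  - move=> k l kl; apply/subsetPset => p; rewrite !UE => -[q [Zq ql]]; exists q; split => //.
    elim: l kl p q ql {Zq} => [|l IH]; first by rewrite leqn0 => /eqP ->.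
    rewrite leq_eqVlt => /predU1P[->//|]; rewrite ltnS => kl p q /didx2_refine.
    exact: IH.
have cover k : [set c | exists p, Z p /\ u p.1 p.2 = c.1 /\ v p.1 p.2 = c.2] `<=` \bigcup_n B k n.
  move=> [c1 c2] [p [Zp [/= <- <-]]]; have [n En] := esurj (didx2 k p).
  exists n; first by [].
  have hp : hit k (didx2 k p) by exists p.
  rewrite /B En asboolT//.
  set q := xget _ _.
  have [Zq qk] : (Z `&` [set p' | didx2 k p' = didx2 k p]) q by exact: xgetPex.
  have [pm1 pm2] := Zm _ Zp; have [qm1 qm2] := Zm _ Zq.
  have hu := HL1 q.1 q.2 p.1 p.2 qm1 qm2 pm1 pm2.
  have hv := HL2 q.1 q.2 p.1 p.2 qm1 qm2 pm1 pm2.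
  move: (qk) => -[/esym/didx_dist d1 /esym/didx_dist d2].
  have rk L' : 0 <= L' -> L' <= L -> L' * (`|p.1 - q.1| + `|p.2 - q.2|) <= r k.
    move=> L'0 L'L; rewrite /r -mulrA; apply: ler_pM => //.
    by rewrite mulr_natl mulr2n lerD.
  split; rewrite /= in_itv/= -ler_distl.
    by apply: (le_trans hu); apply: rk => //; rewrite lerDl.
  by apply: (le_trans hv); apply: rk => //; rewrite lerDr.
have BU k : (mu2 (\bigcup_n B k n) <= ((4 * L) ^+ 2)%:E * mu2 (U k))%E.
  have mBk : measurable (\bigcup_n B k n) by exact: bigcup_measurable.
  have S := measure_sigma_subadditive mu2 (mB k) mBk (@subset_refl _ _).
  apply: (le_trans S).
  have -> : mu2 (U k) = (\sum_(n <oo) mu2 (A k n))%E.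
    apply/esym/cvg_lim => //; apply: measure_semi_sigma_additive.
    - exact: mA.
    - exact: tA.
    - by apply: bigcup_measurable => n _; exact: mA.
  rewrite -nneseriesZl//.
  by rewrite le_eqVlt; apply/orP; left; apply/eqP/eq_eseriesr => n _; exact: AB.
exists (\bigcap_k \bigcup_n B k n); split.
- by apply: bigcapT_measurable => k; apply: bigcup_measurable => n _; exact: mB.
- apply/eqP; rewrite eq_le measure_ge0 andbT.
  have C : ((((4 * L) ^+ 2)%:E * mu2 (U k))%E @[k --> \oo] --> 0)%E.
    by rewrite -(mule0 ((4 * L) ^+ 2)%:E); apply: cvgeZl => //.
  rewrite -(cvg_lim _ C)//; apply: lime_ge; first by apply/cvg_ex; exists 0%E.
  near=> k; apply: le_trans (BU k); apply: (le_measure mu2).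
  + by apply: mem_set; apply: bigcapT_measurable => l; apply: bigcup_measurable => n _; exact: mB.
  + by apply: mem_set; apply: bigcup_measurable => n _; exact: mB.
  + exact: bigcap_inf.
- by move=> c Hc k _; exact: cover.
Unshelve. all: by end_near. Qed.
End null_image.

Lemma closed_level (R : realType) (f : R * R -> R) (a : R) :
  continuous f -> closed [set p | f p = a].
Proof.
by move=> cf; rewrite (_ : mkset _ = f @^-1` [set a])//; apply: (@preimage_closed _ _ f).
Qed.

Lemma closed_measurable2 (R : realType) (F : set (R * R)) : closed F -> measurable F.
Proof.
move=> cF; rewrite -(setCK F); apply: measurableC; apply: open_measurable2.
exact: closed_openC.
Qed.

Lemma negligible_countable_bigcup d (T : measurableType d) (R : realType)
    (m : {measure set T -> \bar R}) (I : countType) (F : I -> set T) :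
  (forall i, m.-negligible (F i)) -> m.-negligible (\bigcup_i F i).
Proof.
move=> F0; pose G n := if @pickle_inv I n is Some i then F i else set0.
have sub : \bigcup_i F i `<=` \bigcup_n G n.
  by move=> x [i _ Fx]; exists (choice.pickle i) => //; rewrite /G pickleK_inv.
apply: (negligibleS sub); apply: negligible_bigcup => n; rewrite /G.
by case: pickle_inv => [i|]; [exact: F0|exact: negligible_set0].
Qed.

Section area_formula.
Context {R : realType}.
Local Notation mu := (@lebesgue_measure R).
Local Notation mu2 := (mu \x mu)%E.
Variables (u ux uy v vx vy : R -> R -> R).
Hypothesis C1u : C1fun u ux uy.
Hypothesis C1v : C1fun v vx vy.
Local Notation fiber c := [set p : R * R | u p.1 p.2 = c.1 /\ v p.1 p.2 = c.2].

Lemma null_image (Z : set (R * R)) : closed Z -> mu2 Z = 0%E ->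
  mu2.-negligible [set c | exists p, Z p /\ u p.1 p.2 = c.1 /\ v p.1 p.2 = c.2].
Proof.
move=> cZ Z0.
pose Zm (m : nat) := Z `&` (`[- m%:R, m%:R] `*` `[- m%:R, m%:R]) : set (R * R).
have cI (m : nat) : closed (`[- m%:R, m%:R] `*` `[- m%:R, m%:R] : set (R * R)).
  apply: compact_closed; last by apply: compact_setX; exact: segment_compact.
  exact: norm_hausdorff.
have sub : [set c | exists p, Z p /\ u p.1 p.2 = c.1 /\ v p.1 p.2 = c.2] `<=`
    \bigcup_m [set c | exists p, Zm m p /\ u p.1 p.2 = c.1 /\ v p.1 p.2 = c.2].
  move=> c [p [Zp pc]]; pose m := (Num.truncn (`|p.1| + `|p.2|)).+1.
  exists m => //; exists p; split => //; split => //.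
  have h : `|p.1| + `|p.2| < m%:R by exact: truncnS_gt.
  have := normr_ge0 p.1; have := normr_ge0 p.2 => h2 h1.
  by split; rewrite /= in_itv/= -ler_norml; lra.
apply: (@negligibleS _ _ _ mu2 _ _ sub); apply: negligible_bigcup => m.
apply: (@null_image_bounded R u ux uy v vx vy (Zm m) m%:R C1u C1v).
- exact: closedI.
- apply/eqP; rewrite eq_le measure_ge0 andbT -Z0.
  apply: (le_measure mu2); [|apply: mem_set; exact: closed_measurable2|exact: subIsetl].
  by apply: mem_set; apply: closed_measurable2; exact: closedI.
- by move=> p [_ [/=]]; rewrite !in_itv/= -!ler_norml.
Qed.

Definition gridline (l : bool * (nat * int)) : set (R * R) :=
  [set p | (if l.1 then p.1 else p.2) = dend l.2.1 l.2.2].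

Lemma closed_gridline l : closed (gridline l).
Proof.
case: l => -[] [k i]; apply: closed_level => p /=; [exact: cvg_fst|exact: cvg_snd].
Qed.

Lemma gridline_null l : mu2 (gridline l) = 0%E.
Proof.
case: l => -[] [k i].
  rewrite (_ : gridline _ = [set dend k i] `*` setT); last first.
    by apply/seteqP; split => p /=; rewrite /gridline/=; [split|case].
  by rewrite product_measure1E// [X in (X * _)%E](_ : _ = 0%E) ?mul0e//; exact: lebesgue_measure_set1.
rewrite (_ : gridline _ = setT `*` [set dend k i]); last first.
  by apply/seteqP; split => p /=; rewrite /gridline/=; [split|case].
by rewrite product_measure1E// [X in (_ * X)%E](_ : _ = 0%E) ?mule0//; exact: lebesgue_measure_set1.
Qed.

Local Notation J p := (ux p.1 p.2 * vy p.1 p.2 - uy p.1 p.2 * vx p.1 p.2).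
Variables g1 g2 : R -> R.
Hypotheses (cg1 : continuous g1) (cg2 : continuous g2).
Hypotheses (g10 : forall t, 0 <= g1 t) (g20 : forall t, 0 <= g2 t).
Let g (c : R * R) := g1 c.1 * g2 c.2.

Let mg : measurable_fun setT g.
Proof.
apply: measurable_funM; apply: measurableT_comp => //; exact: continuous_measurable_fun.
Qed.

Let g0 c : 0 <= g c. Proof. by rewrite mulr_ge0. Qed.

Lemma measurable_npoints_fiber (T : set (R * R)) : open T ->
  measurable_fun setT (fun c : R * R => npoints (T `&` fiber c) : \bar R).
Proof.
move=> oT; case: C1u => _ _ cu _ _; case: C1v => _ _ cv _ _.
pose U (c : R * R) a b := u a b - c.1; pose V (c : R * R) a b := v a b - c.2.
have cU c : cont2 (U c) by move=> a b; apply: cvgB; [exact: cu|exact: cvg_cst].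
have cV c : cont2 (V c) by move=> a b; apply: cvgB; [exact: cv|exact: cvg_cst].
have mU (p : R * R) : measurable_fun setT (fun c => U c p.1 p.2).
  by apply: measurable_funB => //; exact: measurable_cst.
have mV (p : R * R) : measurable_fun setT (fun c => V c p.1 p.2).
  by apply: measurable_funB => //; exact: measurable_cst.
apply: eq_measurable_fun (measurable_npoints_zeros cU cV mU mV oT) => c _.
congr npoints; apply/seteqP; split => p [Tp [/= h1 h2]]; split => //; rewrite /U /V.
  by move: h1 h2; rewrite /U /V => /eqP + /eqP; rewrite !subr_eq0 => /eqP ? /eqP.
by rewrite h1 h2 !subrr.
Qed.

Lemma area_formula (T : set (R * R)) : open T ->
  mu2 [set p | uy p.1 p.2 * J p = 0] = 0%E ->
  (\int[mu2]_c ((g c)%:E * npoints (T `&` fiber c)) =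
   \int[mu2]_(p in T) (g (u p.1 p.2, v p.1 p.2) * `|J p|)%:E)%E.
Proof.
move=> oT Z0.
case: (C1u) => _ _ cu cux cuy; case: (C1v) => _ _ cv cvx cvy.
have cJ : continuous (fun p : R * R => J p).
  by move=> -[a b]; apply: cvgB; apply: cvgM; [exact: cux|exact: cvy|exact: cuy|exact: cvx].
pose D (p : R * R) := uy p.1 p.2 * J p.
have cD : continuous D.
  by move=> p; apply: cvgM; [case: p => a b; exact: cuy|exact: cJ].
pose Z := [set p | D p = 0].
have cZ : closed Z by exact: closed_level.
have oU : open (T `\` Z) by rewrite setDE; apply: openI => //; exact: closed_openC.
have [W [tW WU WI]] := whitney2 oU.
pose bad := Z `|` \bigcup_l gridline l.
have mbad : measurable bad.
  apply: measurableU; first exact: closed_measurable2.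
  apply: countable_bigcupT_measurable => // l; apply: closed_measurable2; exact: closed_gridline.
have bad0 : mu2 bad = 0%E.
  apply/(negligibleP mu2 mbad)/negligibleU.
    by apply/(negligibleP mu2); [exact: closed_measurable2|exact: Z0].
  apply: negligible_countable_bigcup => l; apply/(negligibleP mu2).
    by apply: closed_measurable2; exact: closed_gridline.
  exact: gridline_null.
have mnp (V : set (R * R)) : open V ->
    measurable_fun setT (fun c : R * R => (g c)%:E * npoints (V `&` fiber c) : \bar R)%E.
  move=> oV; apply: emeasurable_funM; first exact/measurable_EFinP.
  exact: measurable_npoints_fiber.
have /choice[I IP] : forall n, exists I : set (R * R),
    [/\ open I, I `<=` W n, W n `<=` I `|` \bigcup_l gridline l &
     (\int[mu2]_c ((g c)%:E * npoints (I `&` fiber c)) =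
     \int[mu2]_(p in I) (g (u p.1 p.2, v p.1 p.2) * `|J p|)%:E)%E].
  move=> n; have [->|[k [ij [kT Wn]]]] := WI n.
    exists set0; split => //.
    rewrite integral_set0 integral0_eq// => c _.
    by rewrite set0I npoints0 mule0.
  have uyJ x y : dend k ij.1 <= x <= dend k (ij.1 + 1) ->
      dend k ij.2 <= y <= dend k (ij.2 + 1) -> uy x y * J (x, y) != 0.
    by move=> xx yy; apply/eqP => h; have [] := kT (x, y) _; rewrite /dbox/= ?in_itv//=.
  exists [set p | dend k ij.1 < p.1 < dend k (ij.1 + 1) /\
                  dend k ij.2 < p.2 < dend k (ij.2 + 1)].
  have oI : open [set p : R * R | dend k ij.1 < p.1 < dend k (ij.1 + 1) /\
                  dend k ij.2 < p.2 < dend k (ij.2 + 1)].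
    rewrite openE => -[x y] [/= /andP[xa xb] /andP[ya yb]].
    exists (`]dend k ij.1, dend k (ij.1 + 1)[%classic, `]dend k ij.2, dend k (ij.2 + 1)[%classic).
      by split; apply: open_nbhs_nbhs; split; rewrite /= ?in_itv/= ?xa ?ya//; exact: interval_open.
    by move=> p [/=]; rewrite !in_itv/=.
  split => //.
  - move=> p [/andP[p1 p1'] /andP[p2 p2']]; rewrite Wn didx2_set.
    by split; rewrite /= in_itv/= ?p1' ?p2' ltW.
  - move=> p; rewrite Wn didx2_set => -[/=]; rewrite !in_itv/=.
    move=> /andP[p1 p1'] /andP[p2 p2'].
    have [h1|h1] := eqVneq p.1 (dend k ij.1).
      by right; exists (true, (k, ij.1)).
    have [h2|h2] := eqVneq p.2 (dend k ij.2).
      by right; exists (false, (k, ij.2)).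
    by left; split; rewrite ?p1' ?p2' andbT lt_neqAle eq_sym ?h1 ?h2.
  - rewrite fubini_tonelli1; [|exact: mnp|]; last first.
      by move=> c; rewrite mule_ge0 ?lee_fin ?npoints_ge0.
    rewrite -(@cell_area R u ux uy v vx vy (dend k ij.1) (dend k (ij.1 + 1))
      (dend k ij.2) (dend k (ij.2 + 1)) g1 g2)// => x y xx yy.
      by have := uyJ x y xx yy; rewrite mulf_eq0 negb_or => /andP[].
    by have := uyJ x y xx yy; rewrite mulf_eq0 negb_or => /andP[].
have tI : trivIset setT I.
  apply/trivIsetP => i j _ _ ij; have [_ Ii _ _] := IP i; have [_ Ij _ _] := IP j.
  by apply: (subsetI_eq0 Ii Ij); move/trivIsetP: tW; exact.
have IT n : I n `<=` T `\` Z.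
  by have [_ IW _ _] := IP n; rewrite -WU; apply: (subset_trans IW); exact: bigcup_sup.
have TI p : T p -> ~ bad p -> exists n, I n p.
  move=> Tp bp; have : (T `\` Z) p by split => // Zp; apply: bp; left.
  rewrite -WU => -[n _ Wp]; have [_ _ WIn _] := IP n; exists n.
  by have [//|gp] := WIn _ Wp; exfalso; apply: bp; right.
have mIU : measurable (\bigcup_n I n).
  by apply: bigcup_measurable => n _; apply: open_measurable2; have [] := IP n.
have mF : measurable_fun T (fun p => (g (u p.1 p.2, v p.1 p.2) * `|J p|)%:E).
  apply/measurable_EFinP; apply: open_continuous_measurable_fun2 => // p _.
  apply: cvgM; last by apply: cvg_norm; exact: cJ.
  case: p => a b; apply: cvgM; [exact: (continuous_cvg1 _ cg1 (cu a b))|exact: (continuous_cvg1 _ cg2 (cv a b))].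
transitivity (\int[mu2]_c (\sum_(n <oo) (g c)%:E * npoints (I n `&` fiber c)))%E.
  apply: ge0_ae_eq_integral => //.
  - exact: mnp.
  - apply: ge0_emeasurable_sum => [n c _ _|n _]; first by rewrite mule_ge0 ?lee_fin ?npoints_ge0.
    by apply: mnp; have [] := IP n.
  - by move=> c _; rewrite mule_ge0 ?lee_fin ?npoints_ge0.
  - by move=> c _; apply: nneseries_ge0 => n _ _; rewrite mule_ge0 ?lee_fin ?npoints_ge0.
  - have : mu2.-negligible [set c | exists p, bad p /\ u p.1 p.2 = c.1 /\ v p.1 p.2 = c.2].
      have sub : [set c | exists p, bad p /\ u p.1 p.2 = c.1 /\ v p.1 p.2 = c.2] `<=`
        [set c | exists p, Z p /\ u p.1 p.2 = c.1 /\ v p.1 p.2 = c.2] `|`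
        \bigcup_l [set c | exists p, gridline l p /\ u p.1 p.2 = c.1 /\ v p.1 p.2 = c.2].
        move=> c [p [[Zp|[l _ lp]] pc]]; first by left; exists p.
        by right; exists l => //; exists p.
      apply: (@negligibleS _ _ _ mu2 _ _ sub); apply: negligibleU; first exact: null_image.
      apply: negligible_countable_bigcup => l.
      by apply: null_image; [exact: closed_gridline|exact: gridline_null].
    apply: negligibleS => c /=; apply: contra_notP => nc _.
    rewrite nneseriesZl//; last by move=> n _; exact: npoints_ge0.
    rewrite -npoints_bigcup; last by apply: trivIset_setIr.
    congr (_ * npoints _)%E; rewrite -setI_bigcupl; apply/seteqP; split => p [Tp pc].
      split => //; have [|n In] := TI p Tp; first by move=> bp; apply: nc; exists p.
      by exists n.
    by split => //; case: Tp => n _ /IT[].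
rewrite integral_nneseries//; first last.
- by move=> n c _; rewrite mule_ge0 ?lee_fin ?npoints_ge0.
- by move=> n; apply: mnp; have [] := IP n.
have F0 (S : set (R * R)) p : S p -> (0 <= (g (u p.1 p.2, v p.1 p.2) * `|J p|)%:E)%E.
  by move=> _; rewrite lee_fin mulr_ge0.
have mFI : measurable_fun (\bigcup_n I n) (fun p => (g (u p.1 p.2, v p.1 p.2) * `|J p|)%:E).
  apply: measurable_funS mF; first exact: open_measurable2.
  by move=> p [n _ /IT[]].
have drop (S : set (R * R)) : measurable S ->
    measurable_fun S (fun p => (g (u p.1 p.2, v p.1 p.2) * `|J p|)%:E) ->
    (\int[mu2]_(p in S) (g (u p.1 p.2, v p.1 p.2) * `|J p|)%:E =
     \int[mu2]_(p in S `\` bad) (g (u p.1 p.2, v p.1 p.2) * `|J p|)%:E)%E.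
  by move=> mS mFS; apply: (@ge0_negligible_integral _ _ _ mu2) => //; exact: F0.
rewrite (drop _ (open_measurable2 oT) mF).
have -> : T `\` bad = (\bigcup_n I n) `\` bad.
  apply/seteqP; split => p [Tp bp]; split => //; last by case: Tp => n _ /IT[].
  by have [n In] := TI p Tp bp; exists n.
rewrite -(drop _ mIU mFI) (@ge0_integral_bigcup _ _ _ mu2)//.
- by apply: eq_eseriesr => n _; have [_ _ _ ->] := IP n.
- by move=> n; apply: open_measurable2; have [] := IP n.
- exact: F0.
Qed.
End area_formula.

(** * Complex Gaussian vectors and pairs of linear forms *)

(* The library's Lebesgue and normal measures live on the Borel structure generated by the half-open
   intervals, whose display differs from the canonical one of [R]. *)
Definition borel_retype (R : realType) (x : g_sigma_algebraType (R.-ocitv.-measurable)) : R := x.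
Lemma measurable_borel_retype (R : realType) : measurable_fun setT (@borel_retype R).
Proof. exact: (@measurable_id _ R). Qed.
HB.instance Definition _ (R : realType) :=
  @isMeasurableFun.Build _ _ _ _ (@borel_retype R) (@measurable_borel_retype R).
(* The real and imaginary parts of a standard complex Gaussian variable have variance 1/2. *)
Definition gauss1 (R : realType) : probability R R :=
  distribution (normal_prob 0 (Num.sqrt (2^-1 : R))) (@borel_retype R).
Definition gauss2 (R : realType) : probability (R * R)%type R := (gauss1 R \x gauss1 R)%E.

Section gaussian.
Context {R : realType}.
Local Notation mu := (@lebesgue_measure R).
Local Notation gam := (gauss1 R).
Local Notation gam2 := (gauss2 R).
Local Open Scope ereal_scope.

Lemma ge0_integral_normal_prob (m s : R) (f : R -> \bar R) :
  measurable_fun setT f -> (forall x, 0 <= f x) ->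
  \int[normal_prob m s]_x f x = \int[mu]_x (f x * (normal_pdf m s x)%:E).
Proof.
move=> mf f0; have dom := normal_prob_dominates m s.
rewrite -(Radon_Nikodym_SigmaFinite.change_of_variables dom f0 measurableT mf).
have mp : measurable_fun setT (fun x => (normal_pdf m s x)%:E).
  by apply/measurable_EFinP; exact: measurable_normal_pdf.
have id := Radon_Nikodym_SigmaFinite.f_integrable dom.
apply: ge0_ae_eq_integral => //.
- by apply: emeasurable_funM => //; exact: measurable_int id.
- exact: emeasurable_funM.
- by move=> x _; rewrite mule_ge0 ?Radon_Nikodym_SigmaFinite.f_ge0.
- by move=> x _; rewrite mule_ge0 ?lee_fin ?normal_pdf_ge0.
- have : ae_eq mu setT (Radon_Nikodym_SigmaFinite.f (normal_prob m s) mu)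
      (fun x => (normal_pdf m s x)%:E).
    apply: integral_ae_eq => // E _ mE.
    by rewrite -Radon_Nikodym_SigmaFinite.f_integral.
  by apply: filterS => x + _ => ->.
Qed.

Lemma normal_pdf_gam (x : R) :
  normal_pdf 0 (Num.sqrt (2^-1)) x = (expR (- x ^+ 2) / Num.sqrt pi)%R.
Proof.
have s0 : Num.sqrt (2^-1 : R) != 0%R by rewrite gt_eqF// sqrtr_gt0 invr_gt0.
rewrite normal_pdfE// /normal_peak /normal_fun sqr_sqrtr ?invr_ge0//.
rewrite subr0 mulrC; congr (expR _ / Num.sqrt _)%R.
  by rewrite -[(2^-1 *+ 2)%R]mulr_natr mulVf// divr1.
by rewrite -mulr_natr mulrAC mulVf// mul1r.
Qed.

Lemma ge0_integral_gam (f : R -> \bar R) :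
  measurable_fun setT f -> (forall x, 0 <= f x) ->
  \int[gam]_x f x = \int[mu]_x (f x * (expR (- x ^+ 2) / Num.sqrt pi)%:E).
Proof.
move=> mf f0; rewrite /gauss1 ge0_integral_distribution// ge0_integral_normal_prob//.
by apply: eq_integral => x _; rewrite normal_pdf_gam.
Qed.

Let w (x : R) : R := (expR (- x ^+ 2) / Num.sqrt pi)%R.

Let w0 x : (0 <= w x)%R.
Proof. by rewrite divr_ge0 ?expR_ge0 ?sqrtr_ge0. Qed.

Let mw : measurable_fun setT w.
Proof.
apply: measurable_funM => //; apply: measurableT_comp => //.
by apply: measurableT_comp => //; exact: measurable_funX.
Qed.

Lemma measurable_partial1 d1 d2 d (T1 : measurableType d1) (T2 : measurableType d2)
    (T : measurableType d) (f : T1 * T2 -> T) y :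
  measurable_fun setT f -> measurable_fun setT (fun x => f (x, y)).
Proof. by move=> mf; apply: measurableT_comp => //; exact: measurable_fun_pair. Qed.

Lemma measurable_partial2 d1 d2 d (T1 : measurableType d1) (T2 : measurableType d2)
    (T : measurableType d) (f : T1 * T2 -> T) x :
  measurable_fun setT f -> measurable_fun setT (fun y => f (x, y)).
Proof. by move=> mf; apply: measurableT_comp => //; exact: measurable_fun_pair. Qed.

Lemma measurable_inner_integral d1 d2 (T1 : measurableType d1) (T2 : measurableType d2)
    (m : {sigma_finite_measure set T2 -> \bar R}) (f : T1 * T2 -> \bar R) :
  measurable_fun setT f -> (forall p, 0 <= f p) ->
  measurable_fun setT (fun x => \int[m]_y f (x, y)).
Proof. by move=> mf f0; exact: measurable_fun_fubini_tonelli_F. Qed.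

Lemma measurable_inner_integral' d1 d2 (T1 : measurableType d1) (T2 : measurableType d2)
    (m : {sigma_finite_measure set T1 -> \bar R}) (f : T1 * T2 -> \bar R) :
  measurable_fun setT f -> (forall p, 0 <= f p) ->
  measurable_fun setT (fun y => \int[m]_x f (x, y)).
Proof. by move=> mf f0; exact: measurable_fun_fubini_tonelli_G. Qed.

Lemma iterated_integral_gam (f : R * R -> \bar R) :
  measurable_fun setT f -> (forall x, 0 <= f x) ->
  \int[gam]_x \int[gam]_y f (x, y) =
  \int[mu]_x \int[mu]_y (f (x, y) * (expR (- (x ^+ 2 + y ^+ 2)) / pi)%:E).
Proof.
move=> mf f0; rewrite ge0_integral_gam; first last.
- by move=> x; apply: integral_ge0 => y _.
- exact: measurable_inner_integral.
apply: eq_integral => x _; rewrite ge0_integral_gam//; last exact: measurable_partial2.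
rewrite -ge0_integralZr//; first last.
- by move=> y _; rewrite mule_ge0// lee_fin w0.
- apply: emeasurable_funM; first exact: measurable_partial2.
  exact/measurable_EFinP.
apply: eq_integral => y _; rewrite -muleA; congr (_ * _); rewrite -EFinM; congr EFin.
rewrite opprD expRD mulrACA -invfM -expr2 sqr_sqrtr ?pi_ge0//.
by rewrite [(expR (- y ^+ 2) * _)%R]mulrC.
Qed.

Lemma integral_gauss2 (f : R * R -> \bar R) :
  measurable_fun setT f -> (forall x, 0 <= f x) ->
  \int[gam2]_p f p = \int[gam]_x \int[gam]_y f (x, y).
Proof. by move=> mf f0; apply: (@fubini_tonelli1 _ _ _ _ _ (gauss1 R) (gauss1 R) f mf f0). Qed.

Lemma integral_gam2 (f : R * R -> \bar R) :
  measurable_fun setT f -> (forall x, 0 <= f x) ->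
  \int[gam2]_p f p =
  \int[mu \x mu]_p (f p * (expR (- (p.1 ^+ 2 + p.2 ^+ 2)) / pi)%:E).
Proof.
move=> mf f0; rewrite integral_gauss2// iterated_integral_gam//.
rewrite fubini_tonelli1//.
- apply: emeasurable_funM => //; apply/measurable_EFinP; apply: measurable_funM => //.
  apply: measurableT_comp => //; apply: measurableT_comp => //.
  by apply: measurable_funD; apply: measurable_funX.
- by move=> p; rewrite mule_ge0// lee_fin divr_ge0 ?expR_ge0 ?pi_ge0.
Qed.

Lemma measurable_lin2 d (T : measurableType d) (f : R * R -> T) (a b c e : R) :
  measurable_fun setT f ->
  measurable_fun setT (fun p : R * R => f (a * p.1 + b * p.2, c * p.1 + e * p.2)%R).
Proof.
move=> mf; apply: measurableT_comp => //; apply: measurable_fun_pair;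
  by apply: measurable_funD; apply: measurable_funM.
Qed.

Lemma rotation_lebesgue (f : R * R -> \bar R) (c s : R) : (c ^+ 2 + s ^+ 2 = 1)%R ->
  measurable_fun setT f -> (forall x, 0 <= f x) ->
  \int[mu]_x \int[mu]_y f (c * x - s * y, s * x + c * y)%R =
  \int[mu]_x \int[mu]_y f (x, y).
Proof.
move=> cs mf f0; have [c0|c0] := eqVneq c 0%R.
  move: cs; rewrite c0 expr0n add0r => s1.
  have s0 : s != 0%R by apply/eqP => s0; move: s1; rewrite s0 expr0n/=; lra.
  have ns : `|s|%R = 1%R by apply/eqP; rewrite -(@eqrXn2 _ 2)// real_normK ?num_real// s1 expr1n.
  transitivity (\int[mu]_x \int[mu]_y f (y, s * x + 0)%R).
    apply: eq_integral => x _.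
    rewrite -[RHS]mul1e -[in RHS](invr1 R) -[in RHS]ns -normrN.
    rewrite -(@lebesgue_integral_affine _ (- s) 0 (fun y => f (y, s * x + 0)%R))//.
    + by apply: eq_integral => y _; congr (f (_, _)); ring.
    + by rewrite oppr_eq0.
    + exact: measurable_partial1.
  rewrite (@lebesgue_integral_affine _ s 0 (fun x => \int[mu]_y f (y, x)))//.
  - by rewrite ns invr1 mul1e; apply: esym; exact: fubini_tonelli.
  - exact: measurable_inner_integral'.
  - by move=> x; apply: integral_ge0.
transitivity (\int[mu]_x (`|c|^-1%:E * \int[mu]_y f ((x - s * y) / c, y)%R)).
  apply: eq_integral => x _.
  rewrite -(@lebesgue_integral_affine _ c (s * x) (fun y => f ((x - s * y) / c, y)%R))//.
    apply: eq_integral => y _; congr (f (_, _)); last by rewrite addrC.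
    apply: (mulIf c0); rewrite divfK//; apply/eqP; rewrite -subr_eq0; apply/eqP.
    transitivity ((c ^+ 2 + s ^+ 2 - 1) * x)%R; first by ring.
    by rewrite cs subrr mul0r.
  apply: measurableT_comp => //; apply: measurable_fun_pair => //.
  by apply: measurable_funM => //; apply: measurable_funB.
have mf' : measurable_fun setT (fun p : R * R => f ((p.1 - s * p.2) / c, p.2)%R).
  apply: measurableT_comp => //; apply: measurable_fun_pair => //.
  apply: measurable_funM => //; apply: measurable_funB => //.
  exact: measurable_funM.
rewrite ge0_integralZl//; first last.
- by move=> x _; apply: integral_ge0.
- by apply: (@measurable_inner_integral _ _ _ _ mu _ mf') => p.
rewrite (@fubini_tonelli _ _ _ _ _ mu mu _ mf')//=.
transitivity (`|c|^-1%:E * \int[mu]_y (`|c^-1|^-1%:E * \int[mu]_x f (x, y))).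
  congr (_ * _); apply: eq_integral => y _.
  rewrite -(@lebesgue_integral_affine _ c^-1 (- s * y / c) (fun x => f (x, y)))//.
  - by apply: eq_integral => x _; congr (f (_, _)); ring.
  - by rewrite invr_eq0.
  - exact: measurable_partial1.
rewrite ge0_integralZl//; first last.
- by move=> x _; apply: integral_ge0.
- exact: measurable_inner_integral'.
rewrite muleA -EFinM normfV mulfV ?mul1e; last by rewrite invr_eq0 normr_eq0.
by rewrite fubini_tonelli.
Qed.

Lemma rotation_gam (f : R * R -> \bar R) (c s : R) : (c ^+ 2 + s ^+ 2 = 1)%R ->
  measurable_fun setT f -> (forall x, 0 <= f x) ->
  \int[gam]_x \int[gam]_y f (c * x - s * y, s * x + c * y)%R =
  \int[gam]_x \int[gam]_y f (x, y).
Proof.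
move=> cs mf f0.
have mk : measurable_fun setT (fun p : R * R => (expR (- (p.1 ^+ 2 + p.2 ^+ 2)) / pi)%:E).
  apply/measurable_EFinP; apply: measurable_funM => //.
  apply: measurableT_comp => //; apply: measurableT_comp => //.
  by apply: measurable_funD; apply: measurable_funX.
rewrite (iterated_integral_gam mf f0).
rewrite -(@rotation_lebesgue (fun p => f p * (expR (- (p.1 ^+ 2 + p.2 ^+ 2)) / pi)%:E) c s)//.
- have ms : measurable_fun setT (fun p : R * R => f (c * p.1 - s * p.2, s * p.1 + c * p.2)%R).
    rewrite (_ : (fun _ => _) = fun p => f (c * p.1 + - s * p.2, s * p.1 + c * p.2)%R).
      exact: measurable_lin2.
    by apply/funext => p; rewrite mulNr.
  have ms0 p : 0 <= f (c * p.1 - s * p.2, s * p.1 + c * p.2)%R by exact: f0.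
  apply: (etrans (iterated_integral_gam ms ms0)).
  apply: eq_integral => x _; apply: eq_integral => y _; congr (_ * (expR (- _) / _)%:E)%E.
  rewrite /= -[LHS]mul1r -cs; ring.
- exact: emeasurable_funM.
- by move=> p; rewrite mule_ge0// lee_fin divr_ge0 ?expR_ge0 ?pi_ge0.
Qed.
End gaussian.

Definition unit_circle {R : realType} (w : R * R) := w.1 ^+ 2 + w.2 ^+ 2 = 1.
Definition cmul {R : realType} (w z : R * R) : R * R :=
  (w.1 * z.1 - w.2 * z.2, w.2 * z.1 + w.1 * z.2).
Definition axpy {R : realType} (p : R) (z r : R * R) : R * R :=
  (p * z.1 + r.1, p * z.2 + r.2).
Definition rscale {R : realType} (p : R) (z : R * R) : R * R := (p * z.1, p * z.2).

Ltac meas := repeat lazymatch goal with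
  | |- measurable_fun _ (fun x => (@?f x, @?g x)) => apply: measurable_fun_pair
  | |- measurable_fun _ (fun x => (@?f x - @?g x)%R) => apply: measurable_funB
  | |- measurable_fun _ (fun x => (@?f x + @?g x)%R) => apply: measurable_funD
  | |- measurable_fun _ (fun x => (@?f x * @?g x)%R) => apply: measurable_funM
  | |- measurable_fun _ (fun x => (@?g x).1) => apply: (measurableT_comp measurable_fst)
  | |- measurable_fun _ (fun x => (@?g x).2) => apply: (measurableT_comp measurable_snd)
  | _ => by [] end.

Section gaussian2.
Context {R : realType}.
Local Notation mu := (@lebesgue_measure R).
Local Notation gam := (gauss1 R).
Local Notation gam2 := (gauss2 R).
Local Open Scope ereal_scope.

Lemma measurable_axpy d (T : measurableType d) (p : R) (f g : T -> R * R) :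
  measurable_fun setT f -> measurable_fun setT g ->
  measurable_fun setT (fun x => axpy p (f x) (g x)).
Proof. by move=> mf mg; rewrite /axpy; meas. Qed.

Lemma measurable_rscale d (T : measurableType d) (p : R) (f : T -> R * R) :
  measurable_fun setT f -> measurable_fun setT (fun x => rscale p (f x)).
Proof. by move=> mf; rewrite /rscale; meas. Qed.

Lemma measurable_cmul d (T : measurableType d) (f g : T -> R * R) :
  measurable_fun setT f -> measurable_fun setT g ->
  measurable_fun setT (fun x => cmul (f x) (g x)).
Proof. by move=> mf mg; rewrite /cmul; meas. Qed.

Lemma phase_gam2 (f : R * R -> \bar R) w : unit_circle w ->
  measurable_fun setT f -> (forall z, 0 <= f z) ->
  \int[gam2]_z f (cmul w z) = \int[gam2]_z f z.
Proof.
move=> w1 mf f0; rewrite !integral_gauss2//; last first.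
  by apply: measurableT_comp => //; exact: measurable_cmul.
exact: rotation_gam.
Qed.

Lemma swap_gam2 (f : (R * R) * (R * R) -> \bar R) :
  measurable_fun setT f -> (forall z, 0 <= f z) ->
  \int[gam2]_t \int[gam2]_z f (t, z) =
  \int[gam]_a \int[gam]_b \int[gam]_c \int[gam]_d f ((a, c), (b, d)).
Proof.
move=> mf f0; rewrite integral_gauss2; first last.
- by move=> t; apply: integral_ge0.
- exact: (@measurable_inner_integral _ _ _ _ _ gam2 f mf f0).
apply: eq_integral => a _.
transitivity (\int[gam]_c \int[gam]_b \int[gam]_d f ((a, c), (b, d))).
  by apply: eq_integral => c _; rewrite integral_gauss2//; exact: measurable_partial2.
have mg : measurable_fun setT (fun p : R * R => \int[gam]_d f ((a, p.1), (p.2, d))).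
  apply: (@measurable_inner_integral _ _ _ _ _ gam (fun q : (R * R) * R => f ((a, q.1.1), (q.1.2, q.2))))%E.
    by apply: measurableT_comp => //; meas.
  by move=> q.
apply: (@fubini_tonelli _ _ _ _ _ gam gam _ mg) => p.
exact: integral_ge0.
Qed.

Lemma rotation_gam2 (f : (R * R) * (R * R) -> \bar R) (c s : R) : (c ^+ 2 + s ^+ 2 = 1)%R ->
  measurable_fun setT f -> (forall z, 0 <= f z) ->
  \int[gam2]_t \int[gam2]_z f (axpy c t (rscale (- s) z), axpy s t (rscale c z)) =
  \int[gam2]_t \int[gam2]_z f (t, z).
Proof.
move=> cs mf f0.
rewrite (@swap_gam2 (fun q => f (axpy c q.1 (rscale (- s) q.2), axpy s q.1 (rscale c q.2))))//;
  last by apply: measurableT_comp => //; rewrite /axpy/rscale; meas.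
rewrite (swap_gam2 mf f0).
pose g (p : R * R) := \int[gam]_c \int[gam]_d f ((p.1, c), (p.2, d)).
have mg1 : measurable_fun setT (fun q : (R * R) * R => \int[gam]_d f ((q.1.1, q.2), (q.1.2, d))).
  apply: (@measurable_inner_integral _ _ _ _ _ gam (fun r : ((R * R) * R) * R => f ((r.1.1.1, r.1.2), (r.1.1.2, r.2)))).
    by apply: measurableT_comp => //; meas.
  by move=> q.
have mg : measurable_fun setT g.
  apply: (@measurable_inner_integral _ _ _ _ _ gam _ mg1) => q.
  exact: integral_ge0.
have g0 p : 0 <= g p by apply: integral_ge0 => ? _; exact: integral_ge0.
transitivity (\int[gam]_a \int[gam]_b g (c * a - s * b, s * a + c * b)%R).
  apply: eq_integral => a _; apply: eq_integral => b _; rewrite /g.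
  have mh : measurable_fun setT (fun p : R * R => f ((c * a - s * b, p.1), (s * a + c * b, p.2))%R).
    by apply: measurableT_comp => //; meas.
  apply: (etrans _ (@rotation_gam _ _ c s cs mh (fun p => f0 _))).
  apply: eq_integral => x _; apply: eq_integral => y _.
  by rewrite /axpy /rscale/= !mulNr.
exact: (@rotation_gam _ g).
Qed.

Lemma tilt_gam (f : R -> \bar R) (t : R) : (0 < t)%R ->
  measurable_fun setT f -> (forall z, 0 <= f z) ->
  \int[gam]_x ((expR (- (t ^+ 2 - 1) * x ^+ 2))%:E * f x) =
  t^-1%:E * \int[gam]_x f (t^-1 * x)%R.
Proof.
move=> t0 mf f0.
have me : measurable_fun setT (fun x : R => (expR (- (t ^+ 2 - 1) * x ^+ 2))%:E).
  apply/measurable_EFinP; apply: measurableT_comp => //; apply: measurable_funM => //.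
have mf' : measurable_fun setT (fun x => f (t^-1 * x)%R).
  by apply: measurableT_comp => //; exact: measurable_funM.
have mw : measurable_fun setT (fun x : R => (expR (- x ^+ 2) / Num.sqrt pi)%:E).
  apply/measurable_EFinP; apply: measurable_funM => //; apply: measurableT_comp => //.
  by apply: measurableT_comp => //; exact: measurable_funX.
rewrite !ge0_integral_gam//; first last.
- by move=> x; rewrite mule_ge0// lee_fin expR_ge0.
- exact: emeasurable_funM.
rewrite -[X in X^-1%:E](gtr0_norm t0).
rewrite -(@lebesgue_integral_affine _ t 0
  (fun x => f (t^-1 * x)%R * (expR (- x ^+ 2) / Num.sqrt pi)%:E)) ?gt_eqF//.
- apply: eq_integral => x _; rewrite addr0 mulKf ?gt_eqF// [in LHS]muleC muleA [in LHS]muleC.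
  rewrite -EFinM; congr (_ * _%:E); rewrite mulrAC -expRD; congr (expR _ / _)%R; ring.
- exact: emeasurable_funM.
- by move=> x; rewrite mule_ge0// lee_fin divr_ge0 ?expR_ge0 ?sqrtr_ge0.
Qed.

Lemma tilt_gam2 (f : R * R -> \bar R) (t : R) : (0 < t)%R ->
  measurable_fun setT f -> (forall z, 0 <= f z) ->
  \int[gam2]_z ((expR (- (t ^+ 2 - 1) * (z.1 ^+ 2 + z.2 ^+ 2)))%:E * f z) =
  (t ^- 2)%:E * \int[gam2]_z f (rscale t^-1 z).
Proof.
move=> t0 mf f0.
have me : measurable_fun setT (fun z : R * R => (expR (- (t ^+ 2 - 1) * (z.1 ^+ 2 + z.2 ^+ 2)))%:E).
  apply/measurable_EFinP; apply: measurableT_comp => //; apply: measurable_funM => //.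
  by apply: measurable_funD; apply: measurable_funX.
have me' : measurable_fun setT (fun y : R => (expR (- (t ^+ 2 - 1) * y ^+ 2))%:E).
  by apply/measurable_EFinP; apply: measurableT_comp => //; apply: measurable_funM.
have mf' : measurable_fun setT (fun z => f (rscale t^-1 z)).
  by apply: measurableT_comp => //; exact: measurable_rscale.
rewrite 2?integral_gauss2//; first last.
- by move=> z; rewrite mule_ge0// lee_fin expR_ge0.
- exact: emeasurable_funM.
have mg x : measurable_fun setT (fun y => f (x, y)) by exact: measurable_partial2.
have mh : measurable_fun setT (fun p : R * R => f (p.1, t^-1 * p.2)%R).
  by apply: measurableT_comp => //; meas.
transitivity (\int[gam]_x ((expR (- (t ^+ 2 - 1) * x ^+ 2))%:E *
   (t^-1%:E * \int[gam]_y f (x, t^-1 * y)%R))).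
  apply: eq_integral => x _; rewrite -(tilt_gam t0 (mg x))// -ge0_integralZl//.
  - apply: eq_integral => y _; rewrite muleA -EFinM -expRD; congr ((expR _)%:E * _); rewrite /=; ring.
  - by apply: emeasurable_funM => //; exact: mg.
  - by move=> y _; rewrite mule_ge0// lee_fin expR_ge0.
rewrite (tilt_gam t0 (f := fun x => t^-1%:E * \int[gam]_y f (x, t^-1 * y)%R)); first last.
- by move=> x; apply: mule_ge0; [rewrite lee_fin invr_ge0 ltW|exact: integral_ge0].
- apply: emeasurable_funM => //.
  by apply: (@measurable_inner_integral _ _ _ _ _ gam _ mh) => p.
rewrite ge0_integralZl//; first last.
- by rewrite lee_fin invr_ge0 ltW.
- by move=> x _; exact: integral_ge0.
- by apply: (@measurable_inner_integral _ _ _ _ _ gam _ mf') => p.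
by rewrite muleA -EFinM -invfM -expr2.
Qed.
End gaussian2.

Section iid.
Context {d} {T : measurableType d} {R : realType}.

Definition tcons n (p : T * n.-tuple T) : n.+1.-tuple T := [tuple of p.1 :: p.2].

Lemma measurable_tcons n : measurable_fun setT (@tcons n).
Proof. exact: measurable_cons. Qed.

HB.instance Definition _ n := @isMeasurableFun.Build _ _ _ _ (@tcons n) (@measurable_tcons n).

Fixpoint iid (P : probability T R) n : probability (n.-tuple T) R :=
  if n is n'.+1 then distribution (P \x iid P n')%E (@tcons n') else dirac [tuple].

Local Open Scope ereal_scope.

Lemma integral_iid0 (P : probability T R) (f : 0.-tuple T -> \bar R) :
  (forall t, 0 <= f t) -> measurable_fun setT f -> \int[iid P 0]_t f t = f [tuple].
Proof.
by move=> f0 mf; rewrite /= integral_dirac// diracE in_setT mul1e.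
Qed.

Lemma integral_iidS (P : probability T R) n (f : n.+1.-tuple T -> \bar R) :
  measurable_fun setT f -> (forall t, 0 <= f t) ->
  \int[iid P n.+1]_t f t = \int[P]_z \int[iid P n]_t f (tcons (z, t)).
Proof.
move=> mf f0; rewrite [LHS]ge0_integral_distribution//.
rewrite (@fubini_tonelli1 _ _ _ _ _ P (iid P n) (f \o @tcons n))//.
  by apply: measurableT_comp => //; exact: measurable_tcons.
by move=> p /=.
Qed.
End iid.

(* A pair of linear forms with coefficients [p w] and [q w], where [w] is a phase. *)
Fixpoint forms {R : realType} (l : seq (R * R * (R * R))) (s : seq (R * R)) :
    (R * R) * (R * R) :=
  match l, s with
  | (p, q, w) :: l', z :: s' =>
    (axpy p (cmul w z) (forms l' s').1, axpy q (cmul w z) (forms l' s').2)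
  | _, _ => ((0, 0), (0, 0))
  end.

Lemma polar_pair {R : rcfType} (p a : R) : exists r k h : R,
  [/\ 0 <= r, k ^+ 2 + h ^+ 2 = 1, p = r * k & a = r * h].
Proof.
have [e|e] := eqVneq (p ^+ 2 + a ^+ 2) 0.
  exists 0, 1, 0; move/eqP: e; rewrite paddr_eq0 ?sqr_ge0// !sqrf_eq0 => /andP[/eqP-> /eqP->].
  by split; rewrite ?mul0r// expr1n expr0n addr0.
have r0 : 0 < Num.sqrt (p ^+ 2 + a ^+ 2).
  by rewrite sqrtr_gt0 lt_neqAle eq_sym e addr_ge0 ?sqr_ge0.
exists (Num.sqrt (p ^+ 2 + a ^+ 2)), (p / Num.sqrt (p ^+ 2 + a ^+ 2)), (a / Num.sqrt (p ^+ 2 + a ^+ 2)).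
split; [exact: ltW| |by rewrite mulrC divfK// gt_eqF|by rewrite mulrC divfK// gt_eqF].
by rewrite !expr_div_n sqr_sqrtr ?addr_ge0 ?sqr_ge0// -mulrDl divff.
Qed.

Section forms.
Context {R : realType}.
Local Notation gam2 := (gauss2 R).
Local Notation C := (R * R)%type.
Local Open Scope ereal_scope.

Lemma measurable_forms (l : seq (R * R * C)) :
  measurable_fun setT (fun t : (size l).-tuple C => forms l t).
Proof.
elim: l => [|[[p q] w] l IH]/=; first exact: measurable_cst.
have mz : measurable_fun setT (fun t : (size l).+1.-tuple C => cmul w (thead t)).
  by apply: measurable_cmul => //; exact: measurable_tnth.
have mt : measurable_fun setT (fun t : (size l).+1.-tuple C => forms l [tuple of behead t]).
  apply: (measurableT_comp (f := fun t : (size l).-tuple C => forms l t)) => //.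
  exact: measurable_behead.
rewrite (_ : (fun _ => _) = fun t : (size l).+1.-tuple C =>
  (axpy p (cmul w (thead t)) (forms l [tuple of behead t]).1,
   axpy q (cmul w (thead t)) (forms l [tuple of behead t]).2)).
  apply: measurable_fun_pair; apply: measurable_axpy => //.
    exact: (measurableT_comp measurable_fst).
  exact: (measurableT_comp measurable_snd).
by apply/funext => t; rewrite [in LHS](tuple_eta t).
Qed.

Lemma measurable_iterated_gam2 d (T : measurableType d) (f : T * C -> \bar R) :
  measurable_fun setT f -> (forall z, 0 <= f z) ->
  measurable_fun setT (fun x => \int[gam2]_z f (x, z)).
Proof. by move=> mf f0; apply: (@measurable_inner_integral _ _ _ _ _ gam2 f). Qed.

Lemma integral_gam2_cst (x : \bar R) : 0 <= x -> \int[gam2]_z x = x.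
Proof. by move=> x0; rewrite integral_cst//= probability_setT mule1. Qed.

Lemma integral_gam2Zl (k : R) (f : C -> \bar R) : (0 <= k)%R ->
  measurable_fun setT f -> (forall z, 0 <= f z) ->
  \int[gam2]_z (k%:E * f z) = k%:E * \int[gam2]_z f z.
Proof. by move=> k0 mf f0; rewrite ge0_integralZl. Qed.

Lemma merge1_gam2 (f : C -> \bar R) (p a r k h : R) : (k ^+ 2 + h ^+ 2 = 1)%R ->
  p = (r * k)%R -> a = (r * h)%R ->
  measurable_fun setT f -> (forall z, 0 <= f z) ->
  \int[gam2]_z \int[gam2]_x f (axpy p z (rscale a x)) = \int[gam2]_z f (rscale r z).
Proof.
move=> kh -> -> mf f0; have kh' : (k ^+ 2 + (- h) ^+ 2 = 1)%R by rewrite sqrrN.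
have mg : measurable_fun setT (fun u : C * C => f (rscale r u.1)).
  by apply: measurableT_comp => //; rewrite /rscale; meas.
have := @rotation_gam2 _ (fun u => f (rscale r u.1)) k (- h)%R kh' mg (fun u => f0 _).
move=> rot; transitivity (\int[gam2]_z \int[gam2]_x f (rscale r z)); last first.
  by apply: eq_integral => z _; exact: integral_gam2_cst.
apply: (etrans _ rot); apply: eq_integral => z _; apply: eq_integral => x _.
by congr f; rewrite /axpy/rscale/=; congr pair; ring.
Qed.

(* Rotations of pairs of independent Gaussians bring two linear forms to triangular shape. *)
Lemma law_forms (l : seq (R * R * C)) : (forall c, c \in l -> unit_circle c.2) ->
  exists a b c : R, [/\ (0 <= a)%R, (0 <= c)%R &
  [/\ (a ^+ 2 = \sum_(i <- l) i.1.1 ^+ 2)%R, (a * b = \sum_(i <- l) i.1.1 * i.1.2)%R,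
      (b ^+ 2 + c ^+ 2 = \sum_(i <- l) i.1.2 ^+ 2)%R &
  forall f : C * C -> \bar R, measurable_fun setT f -> (forall z, 0 <= f z) ->
    \int[iid gam2 (size l)]_t f (forms l t) =
    \int[gam2]_x \int[gam2]_y f (rscale a x, axpy b x (rscale c y))]].
Proof.
elim: l => [_|[[p q] w] l IH ul].
  exists 0%R, 0%R, 0%R; split => //; split; rewrite ?big_nil ?mul0r ?expr0n ?addr0//.
  move=> f mf f0; rewrite integral_iid0//; last by rewrite /=; exact: measurable_cst.
  rewrite (eq_integral (fun=> f ((0, 0), (0, 0))%R)) ?integral_gam2_cst// => x _.
  rewrite (eq_integral (fun=> f ((0, 0), (0, 0))%R)) ?integral_gam2_cst// => y _.
  by rewrite /rscale /axpy/= !mul0r !addr0.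
have [|a [b [c [a0 c0 [aE abE bcE law]]]]] := IH.
  by move=> i il; apply: ul; rewrite inE il orbT.
have w1 : unit_circle w by apply: (ul (p, q, w)); rewrite mem_head.
have [r [k [h [r0 kh pE aE']]]] := polar_pair p a.
have [c' [k' [h' [c'0 kh' eE cE]]]] := polar_pair (b * k - q * h)%R c.
exists r, (q * k + b * h)%R, c'; split => //; split; rewrite ?big_cons; [| | |move=> f mf f0].
- rewrite /= -aE pE aE' -[LHS]mulr1 -kh; ring.
- rewrite /= -abE pE aE'; ring.
- rewrite /= -bcE; transitivity ((q * k + b * h) ^+ 2 + ((b * k - q * h) ^+ 2 + c ^+ 2))%R.
    by congr (_ + _)%R; rewrite eE cE -[LHS]mulr1 -kh'; ring.
  transitivity ((q ^+ 2 + b ^+ 2) * (k ^+ 2 + h ^+ 2) + c ^+ 2)%R; first by ring.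
  by rewrite kh; ring.
pose F (y : C) (r : C * C) := f (axpy p y r.1, axpy q y r.2).
have mF y : measurable_fun setT (F y).
  by apply: measurableT_comp => //; rewrite /axpy/=; meas.
have mL : measurable_fun setT (fun t : (size l).+1.-tuple C => f (forms ((p, q, w) :: l) t)).
  exact: (measurableT_comp mf (@measurable_forms ((p, q, w) :: l))).
rewrite [LHS]integral_iidS//.
pose H (z : C) (x : C) (y : C) := f (axpy p z (rscale a x), axpy q z (axpy b x (rscale c y))).
have mH : measurable_fun setT (fun u : (C * C) * C => H u.1.1 u.1.2 u.2).
  by apply: measurableT_comp => //; rewrite /axpy /rscale/=; meas.
have mH1 : measurable_fun setT (fun u : C * C => \int[gam2]_y H u.1 u.2 y).
  exact: (measurable_iterated_gam2 mH (fun=> f0 _)).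
have mH2 : measurable_fun setT (fun z : C => \int[gam2]_x \int[gam2]_y H z x y).
  apply: (measurable_iterated_gam2 mH1) => z; apply: integral_ge0 => y _; exact: f0.
transitivity (\int[gam2]_z \int[gam2]_x \int[gam2]_y H (cmul w z) x y).
  by apply: eq_integral => z _; exact: (law (F (cmul w z)) (mF _) (fun=> f0 _)).
rewrite (@phase_gam2 _ (fun z => \int[gam2]_x \int[gam2]_y H z x y) w w1 mH2); last first.
  by move=> z; apply: integral_ge0 => x _; apply: integral_ge0 => y _; exact: f0.
pose K (z x y : C) := f (rscale r z, axpy (q * k + b * h)%R z (axpy (b * k - q * h)%R x (rscale c y))).
have mK : measurable_fun setT (fun u : (C * C) * C => K u.1.1 u.1.2 u.2).
  by apply: measurableT_comp => //; rewrite /axpy /rscale/=; meas.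
have mK1 : measurable_fun setT (fun u : C * C => \int[gam2]_y K u.1 u.2 y).
  exact: (measurable_iterated_gam2 mK (fun=> f0 _)).
have kh2 : (k ^+ 2 + (- h) ^+ 2 = 1)%R by rewrite sqrrN.
transitivity (\int[gam2]_z \int[gam2]_x \int[gam2]_y K z x y).
  have K0 u : 0 <= \int[gam2]_y K u.1 u.2 y by apply: integral_ge0 => y _; exact: f0.
  have := rotation_gam2 kh2 mK1 K0; rewrite /= => <-.
  apply: eq_integral => z _; apply: eq_integral => x _; apply: eq_integral => y _.
  rewrite /H /K /axpy /rscale/= pE aE'; congr (f (pair _ _)); congr pair.
  - by ring.
  - by ring.
  - by rewrite -[in LHS](mulr1 q) -[in LHS](mulr1 b) -kh; ring.
  - by rewrite -[in LHS](mulr1 q) -[in LHS](mulr1 b) -kh; ring.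
apply: eq_integral => z _.
have mf2 : measurable_fun setT (fun v : C => f (rscale r z, axpy (q * k + b * h)%R z v)).
  by apply: measurableT_comp => //; rewrite /axpy /rscale/=; meas.
exact: (merge1_gam2 kh' eE cE mf2).
Qed.
End forms.

(** * The expectation of [|l X - m Y|] for exponential variables *)

Section exponential.
Context {R : realType}.
Local Notation mu := (@lebesgue_measure R).
Local Notation gam := (gauss1 R).
Local Notation gam2 := (gauss2 R).

Lemma is_derive_expRZ (k x : R) : is_derive x 1 (fun t => expR (k * t)) (k * expR (k * x)).
Proof.
have h : is_derive x 1 (fun t : R => k * t) k.
  by apply: is_derive_eq; rewrite /GRing.scale/= mulr1 ?mul0r ?addr0.
have := is_derive1_comp (f := expR) (g := fun t => k * t) (is_derive_expR _) h.
by move=> h2; apply: is_derive_eq; rewrite mulrC.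
Qed.

Lemma cvg_expRN (k : R) : k < 0 -> expR (k * t) @[t --> +oo] --> (0 : R).
Proof.
move=> k0; have h : (- k * t) @[t --> +oo] --> +oo.
  by apply: gt0_cvgMry; [rewrite oppr_gt0|exact: cvg_id].
have := cvg_comp _ _ h (@cvgr_expR R).
by apply: cvg_trans; apply: near_eq_cvg; near=> t => /=; rewrite mulNr opprK.
Unshelve. all: by end_near. Qed.

Lemma cvg_mul_expRN : t * expR (- t) @[t --> +oo] --> (0 : R).
Proof.
have h : 2 * expR (- 2^-1 * t) @[t --> +oo] --> (0 : R).
  by rewrite -[X in _ --> X](mulr0 2); apply: cvgMr; apply: cvg_expRN; rewrite oppr_lt0.
apply: (squeeze_cvgr _ (cvg_cst 0) h); near=> t.
have t0 : 0 <= t by near: t; exact: nbhs_pinfty_ge.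
rewrite mulr_ge0 ?expR_ge0//=.
rewrite (_ : - t = - 2^-1 * t + - 2^-1 * t); last by rewrite mulNr -opprD -mulrDl; congr (- _); lra.
rewrite expRD mulrA ler_wpM2r ?expR_ge0//.
rewrite mulNr expRN ler_pdivrMr ?expR_gt0//.
have := @expR_ge1Dx R (2^-1 * t); lra.
Unshelve. all: by end_near. Qed.

Lemma integral_dist_exponential (c : R) : 0 <= c ->
  (\int[mu]_(t in `[0%R, +oo[) (`|c - t| * expR (- t))%:E = (c - 1 + 2 * expR (- c))%:E)%E.
Proof.
move=> c0; pose F : R -> R := fun t => (t - c + 1) * expR (- 1 * t).
have dF (t : R) : is_derive t 1 F ((c - t) * expR (- t)).
  have h := is_derive_expRZ (- 1) t.
  apply: is_derive_eq; rewrite /GRing.scale/= !mulN1r.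
  by rewrite subr0 addr0 mulr1; ring.
have cF : continuous F by move=> t; apply/differentiable_continuous/derivable1_diffP; exact: ex_derive.
have ce : continuous (fun t : R => expR (- t)).
  by move=> t; apply: (@continuous_comp _ _ _ -%R expR); [exact: opp_continuous|exact: continuous_expR].
have cf : continuous (fun t : R => `|c - t| * expR (- t)).
  move=> t; apply: cvgM; last exact: ce.
  by apply: cvg_norm; apply: cvgB; [exact: cvg_cst|exact: cvg_id].
have mf : measurable_fun setT (fun t : R => (`|c - t| * expR (- t))%:E).
  by apply/measurable_EFinP; exact: continuous_measurable_fun.
have cF0 : F x @[x --> +oo] --> 0.
  rewrite (_ : F = fun t => t * expR (- t) + (1 - c) * expR (- 1 * t)); last first.
    by apply/funext => t; rewrite /F mulN1r; ring.
  rewrite -[X in _ --> X](addr0 0); apply: cvgD; first exact: cvg_mul_expRN.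
  by rewrite -[X in _ --> X](mulr0 (1 - c)); apply: cvgMr; apply: cvg_expRN; rewrite oppr_lt0.
have I2 : (\int[mu]_(t in `[c, +oo[) (`|c - t| * expR (- t))%:E = (expR (- c))%:E)%E.
  rewrite (@ge0_continuous_FTC2y _ _ (fun t => - F t) _ 0).
  - by rewrite -EFinB sub0r opprK /F subrr add0r mul1r mulN1r.
  - by move=> x _; rewrite mulr_ge0 ?expR_ge0.
  - exact: continuous_subspaceT.
  - by rewrite -[X in _ --> X]oppr0; exact: cvgN.
  - by move=> x _; have := dF x => ?; exact: ex_derive.
  - by apply: cvg_at_right_filter; apply: cvgN; exact: cF.
  - move=> x; rewrite in_itv/= andbT => cx; rewrite derive1E.
    have h := dF x; have -> : `|c - x| * expR (- x) = - ((c - x) * expR (- x)).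
      by rewrite ltr0_norm ?subr_lt0// mulNr.
    exact: derive_val.
have [c1|c1] := eqVneq c 0.
  by move: I2; rewrite c1 => ->; rewrite oppr0 expR0; congr EFin; ring.
have c1' : 0 < c by rewrite lt_neqAle eq_sym c1.
have I1 : (\int[mu]_(t in `[0%R, c]) (`|c - t| * expR (- t))%:E = (expR (- c) + c - 1)%:E)%E.
  rewrite (@continuous_FTC2 _ _ F)//.
  - by rewrite -EFinB /F subrr add0r mul1r mulN1r mulr0 expR0; congr EFin; ring.
  - exact: continuous_subspaceT.
  - split; first by move=> x _; have := dF x => ?; exact: ex_derive.
      by apply: cvg_at_right_filter; exact: cF.
    by apply: cvg_at_left_filter; exact: cF.
  - move=> x; rewrite in_itv/= => /andP[_ xc]; rewrite derive1E.
    have h := dF x; rewrite ger0_norm ?subr_ge0 ?ltW//.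
    exact: derive_val.
have -> : `[0%R, +oo[%classic = `[0%R, c]%classic `|` `]c, +oo[%classic.
  apply/seteqP; split => t /=; rewrite !in_itv/= !andbT.
    by move=> t0; case: (leP t c) => tc; [left; rewrite t0|right].
  by move=> [/andP[]//|ct]; apply: ltW; exact: le_lt_trans ct.
rewrite ge0_integral_setU//=; first last.
- apply/disj_setPLR => t /=; rewrite !in_itv/= andbT => /andP[_ tc]; rewrite ltNge.
  by rewrite tc.
- exact: measurable_funTS.
rewrite I1 integral_itv_obnd_cbnd; last exact: measurable_funTS.
by rewrite I2 -EFinD; congr EFin; ring.
Qed.

Lemma integral_distM_exponential (l m s : R) : 0 <= l -> 0 < m -> 0 <= s ->
  (\int[mu]_(t in `[0%R, +oo[) (`|l * s - m * t| * expR (- t))%:E =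
   (l * s - m + 2 * m * expR (- (l * s / m)))%:E)%E.
Proof.
move=> l0 m0 s0.
have ls : 0 <= l * s / m by apply: divr_ge0; [exact: mulr_ge0|exact: ltW].
have -> : (\int[mu]_(t in `[0%R, +oo[) (`|l * s - m * t| * expR (- t))%:E =
    \int[mu]_(t in `[0%R, +oo[) (m%:E * (`|l * s / m - t| * expR (- t))%:E))%E.
  apply: eq_integral => t _; rewrite -EFinM mulrA; congr (_ * _)%:E.
  rewrite -{2}(gtr0_norm m0) -normrM; congr Num.norm; field.
  by rewrite gt_eqF.
rewrite ge0_integralZl//=; first last.
- by rewrite lee_fin ltW.
- apply: measurable_funTS; apply/measurable_EFinP; apply: measurable_funM.
    by apply: measurableT_comp => //; exact: measurable_funB.
  by apply: measurableT_comp.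
rewrite integral_dist_exponential// -!EFinM; congr EFin.
by field; rewrite gt_eqF.
Qed.

Lemma dist_exponential_ge0 (l m s : R) : 0 < m ->
  0 <= l * s - m + 2 * m * expR (- (l * s / m)).
Proof.
move=> m0.
have -> : l * s - m + 2 * m * expR (- (l * s / m)) =
    m * (l * s / m - 1 + 2 * expR (- (l * s / m))).
  by field; rewrite gt_eqF.
rewrite mulr_ge0 ?(ltW m0)//.
have := @expR_ge1Dx R (- (l * s / m)); have := expR_ge0 (- (l * s / m)).
by set y := l * s / m; set e := expR _; lra.
Qed.

Lemma integral_dist2_exponential (l m : R) : 0 < l -> 0 < m ->
  (\int[mu]_(s in `[0%R, +oo[)
     ((l * s - m + 2 * m * expR (- (l * s / m))) * expR (- s))%:E =
   ((l ^+ 2 + m ^+ 2) / (l + m))%:E)%E.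
Proof.
move=> l0 m0.
pose k := l / m + 1; have k0 : 0 < k by rewrite addr_gt0// divr_gt0.
pose f (s : R) := (l * s - m + 2 * m * expR (- (l * s / m))) * expR (- s).
have fE s : f s = (l * s) * expR (- s) - m * expR (- s) + 2 * m * expR (- k * s).
  have -> : expR (- k * s) = expR (- s) * expR (- (l * s / m)).
    by rewrite -expRD; congr expR; rewrite /k; ring.
  by rewrite /f; ring.
pose F : R -> R := fun s =>
  - l * (s * expR (- 1 * s)) + (m - l) * expR (- 1 * s) - 2 * m / k * expR (- k * s).
have dF (s : R) : is_derive s 1 F (f s).
  have h := is_derive_expRZ (- 1) s; have h2 := is_derive_expRZ (- k) s.
  rewrite /F; apply: is_derive_eq; rewrite /GRing.scale/= fE !mulN1r.
  field; by rewrite gt_eqF.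
have cf : continuous f.
  move=> s; have h := is_derive_expRZ (- 1) s; have h2 := is_derive_expRZ (- k) s.
  apply/differentiable_continuous/derivable1_diffP.
  rewrite (_ : f = fun s => (l * s) * expR (- 1 * s) - m * expR (- 1 * s) + 2 * m * expR (- k * s)).
    exact: ex_derive.
  by apply/funext => t; rewrite fE mulN1r.
rewrite (@ge0_continuous_FTC2y _ f F _ 0).
- rewrite -EFinB /F !mulr0 mul0r expR0 /k; congr EFin; field.
  by rewrite !gt_eqF// addr_gt0.
- by move=> x _; rewrite mulr_ge0 ?expR_ge0// dist_exponential_ge0.
- exact: continuous_subspaceT.
- have h0 (a b : R) : a * b @[_ --> +oo] --> a * b by exact: cvg_cst.
  rewrite -[X in _ --> X](_ : - l * 0 + (m - l) * 0 - 2 * m / k * 0 = 0); last by rewrite !mulr0 !addr0 subr0.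
  apply: cvgB; first apply: cvgD.
  + apply: cvgMr; rewrite (_ : (fun _ => _) = fun x => x * expR (- x)); first exact: cvg_mul_expRN.
    by apply/funext => x; rewrite mulN1r.
  + by apply: cvgMr; apply: cvg_expRN; rewrite oppr_lt0.
  + by apply: cvgMr; apply: cvg_expRN; rewrite oppr_lt0.
- by move=> x _; have := dF x => ?; exact: ex_derive.
- apply: cvg_at_right_filter; apply/differentiable_continuous/derivable1_diffP.
  by have := dF 0 => ?; exact: ex_derive.
- by move=> x _; rewrite derive1E; have := dF x => ?; exact: derive_val.
Qed.
End exponential.

Section radial.
Context {R : realType}.
Local Notation mu := (@lebesgue_measure R).
Local Notation gam2 := (gauss2 R).
Variable G : R -> R.
Hypotheses (cG : continuous G) (G0 : forall t, 0 <= G t).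

Let mG : measurable_fun setT G. Proof. exact: continuous_measurable_fun. Qed.

Lemma integral_comp_sqr (A : R) : 0 < A ->
  (\int[mu]_x (`|x| * G (A * x ^+ 2))%:E =
   (A^-1)%:E * \int[mu]_(s in `]0%R, +oo[) (G s)%:E)%E.
Proof.
move=> A0; pose f (x : R) := `|x| * G (A * x ^+ 2).
have cf : continuous f.
  move=> x; apply: cvgM; first by apply: cvg_norm; exact: cvg_id.
  apply: continuous_cvg; first exact: cG.
  by apply: cvgM; [exact: cvg_cst|exact: exprn_continuous].
rewrite (@ge0_symfun_integralT _ f)//; first last.
- by move=> x /=; rewrite /f normrN sqrrN.
- by move=> x; rewrite mulr_ge0.
have -> : [set x : R | 0 <= x] = `[0%R, +oo[%classic.
  by apply/seteqP; split => x /=; rewrite in_itv/= andbT.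
rewrite -integral_itv_obnd_cbnd; last first.
  by apply: measurable_funTS; apply/measurable_EFinP; exact: continuous_measurable_fun.
have oX : open (`]0%R, +oo[%classic : set R) by exact: interval_open.
have dh (x : R) : is_derive x 1 (fun x => A * x ^+ 2) (2 * A * x).
  by apply: is_derive_eq; rewrite /GRing.scale/=; ring.
have ch' (x : R) : {for x, continuous (fun x : R => 2 * A * x)}.
  by apply: cvgM; [exact: cvg_cst|exact: cvg_id].
have h'0 (x : R) : `]0, +oo[%classic x -> 2 * A * x != 0.
  by rewrite /= in_itv/= andbT => x0; rewrite !mulf_neq0 ?gt_eqF.
have af := area_formula1 oX (fun x _ => dh x) (fun x _ => ch' x) h'0
  (fun x _ => @cG (A * x ^+ 2)) G0 mG.
have -> : (\int[mu]_(x in `]0%R, +oo[) (f x)%:E =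
   ((2 * A)^-1)%:E * \int[mu]_(x in `]0%R, +oo[) (G (A * x ^+ 2) * `|2 * A * x|)%:E)%E.
  rewrite -ge0_integralZl//; first last.
  - by rewrite lee_fin invr_ge0 mulr_ge0 ?ltW.
  - by move=> x _; rewrite lee_fin mulr_ge0.
  - apply: measurable_funTS; apply/measurable_EFinP; apply: continuous_measurable_fun => x.
    apply: cvgM; last by apply: cvg_norm; apply: cvgM; [exact: cvg_cst|exact: cvg_id].
    apply: continuous_cvg; first exact: cG.
    by apply: cvgM; [exact: cvg_cst|exact: exprn_continuous].
  apply: eq_integral => x _; rewrite -EFinM; congr EFin.
  rewrite normrM gtr0_norm ?mulr_gt0// /f; field.
  by rewrite gt_eqF.
rewrite -af; have -> : (\int[mu]_t ((G t)%:E *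
    npoints [set x : R | `]0%R, +oo[%classic x /\ (A * x ^+ 2)%R = t]) =
    \int[mu]_(s in `]0%R, +oo[) (G s)%:E)%E.
  rewrite [RHS]integral_mkcond; apply: eq_integral => t _; rewrite patchE.
  case: ifPn => [/set_mem/=|/negP nt].
    rewrite in_itv/= andbT => t0.
    rewrite (_ : mkset _ = [set Num.sqrt (t / A)]); first by rewrite npointsE esum_set1 ?mule1.
    apply/seteqP; split => x /=; rewrite in_itv/= andbT.
      by move=> [x0 <-]; rewrite mulrAC divff ?mul1r ?gt_eqF// sqrtr_sqr gtr0_norm.
    move=> ->; split; first by rewrite sqrtr_gt0 divr_gt0.
    by rewrite sqr_sqrtr ?divr_ge0 ?ltW// mulrC divfK ?gt_eqF.
  rewrite (_ : mkset _ = set0) ?npoints0 ?mule0//.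
  apply/seteqP; split => x //=; rewrite in_itv/= andbT => -[x0 xt]; apply: nt.
  by apply: mem_set; rewrite /= in_itv/= andbT -xt mulr_gt0 ?exprn_gt0.
rewrite muleA -EFinM; congr (_%:E * _)%E; field; by rewrite gt_eqF.
Qed.

Lemma integral_radial :
  (\int[mu]_x \int[mu]_y (G (x ^+ 2 + y ^+ 2))%:E =
   pi%:E * \int[mu]_(s in `]0%R, +oo[) (G s)%:E)%E.
Proof.
have mf : measurable_fun setT (fun p : R * R => (G (p.1 ^+ 2 + p.2 ^+ 2))%:E).
  apply/measurable_EFinP; apply: measurableT_comp => //.
  by apply: measurable_funD; apply: measurable_funX.
have mg : measurable_fun setT (fun p : R * R => (`|p.1| * G ((1 + p.2 ^+ 2) * p.1 ^+ 2))%:E).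
  apply/measurable_EFinP; apply: measurable_funM; first by apply: measurableT_comp.
  apply: measurableT_comp => //; apply: measurable_funM; last exact: measurable_funX.
  by apply: measurable_funD => //; exact: measurable_funX.
have g0 (p : R * R) : (0 <= (`|p.1| * G ((1 + p.2 ^+ 2) * p.1 ^+ 2))%:E)%E.
  by rewrite lee_fin mulr_ge0.
transitivity (\int[mu]_x \int[mu]_t (`|x| * G ((1 + t ^+ 2) * x ^+ 2))%:E)%E.
  apply: ge0_ae_eq_integral => //.
  - by apply: (@measurable_inner_integral _ _ _ _ _ mu _ mf) => p; rewrite lee_fin.
  - exact: (@measurable_inner_integral _ _ _ _ _ mu _ mg).
  - by move=> x _; apply: integral_ge0 => y _; rewrite lee_fin.
  - by move=> x _; apply: integral_ge0 => y _; exact: (g0 (x, y)).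
  - have : mu.-negligible [set 0 : R].
      by apply/negligibleP => //; exact: lebesgue_measure_set1.
    apply: negligibleS => x /=; apply: contra_notP => /eqP x0 _.
    have m1 : measurable_fun setT (fun y : R => (G (x ^+ 2 + y ^+ 2))%:E).
      exact: (measurable_partial2 x mf).
    have aff := lebesgue_integral_affine 0 x0 m1 (fun y => _).
    transitivity (`|x|%:E * \int[mu]_t (G (x ^+ 2 + (x * t + 0) ^+ 2))%:E)%E.
      rewrite aff; last by move=> y; rewrite lee_fin.
      by rewrite muleA -EFinM mulfV ?mul1e// normr_eq0.
    rewrite -ge0_integralZl//=.
    + apply: eq_integral => t _; rewrite -EFinM addr0; congr (_ * G _)%:E; ring.
    + by apply: (measurableT_comp m1); apply: measurable_funD => //; exact: measurable_funM.
    + by move=> t _; rewrite lee_fin.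
rewrite (@fubini_tonelli _ _ _ _ _ mu mu _ mg g0)/=.
have A0 (t : R) : 0 < 1 + t ^+ 2 by rewrite ltr_wpDr ?sqr_ge0.
transitivity (\int[mu]_t ((\int[mu]_(s in `]0%R, +oo[) (G s)%:E) * ((oneDsqr t)^-1)%:E))%E.
  by apply: eq_integral => t _; rewrite integral_comp_sqr// muleC.
rewrite ge0_integralZl//; first last.
- by apply: integral_ge0 => s _; rewrite lee_fin.
- by apply/measurable_EFinP; apply: continuous_measurable_fun; exact: continuous_oneDsqrV.
rewrite muleC; congr (_ * _)%E.
rewrite (@ge0_symfun_integralT _ (fun t => (oneDsqr t)^-1)).
- have -> : [set x : R | 0 <= x] = `[0%R, +oo[%classic.
    by apply/seteqP; split => x /=; rewrite in_itv/= andbT.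
  by rewrite integral0y_oneDsqr -EFinM mulrC divfK.
- by move=> t; rewrite invr_ge0 ltW// A0.
- exact: continuous_oneDsqrV.
- by move=> t /=; rewrite /oneDsqr sqrrN.
Qed.
End radial.

Section radial_gauss.
Context {R : realType}.
Local Notation mu := (@lebesgue_measure R).
Local Notation gam2 := (gauss2 R).

Lemma integral_gauss2_radial (K : R -> R) : continuous K -> (forall t, 0 <= K t) ->
  (\int[gam2]_z (K (z.1 ^+ 2 + z.2 ^+ 2))%:E =
   \int[mu]_(s in `[0%R, +oo[) (K s * expR (- s))%:E)%E.
Proof.
move=> cK K0; pose G (s : R) := K s * expR (- s) / pi.
have ce : continuous (fun t : R => expR (- t)).
  by move=> t; apply: (@continuous_comp _ _ _ -%R expR); [exact: opp_continuous|exact: continuous_expR].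
have cG : continuous G.
  by move=> s; apply: cvgM; [apply: cvgM; [exact: cK|exact: ce]|exact: cvg_cst].
have G0 t : 0 <= G t by rewrite !mulr_ge0 ?expR_ge0 ?invr_ge0 ?pi_ge0.
have mf : measurable_fun setT (fun z : R * R => (K (z.1 ^+ 2 + z.2 ^+ 2))%:E).
  apply/measurable_EFinP; apply: measurableT_comp.
    exact: continuous_measurable_fun.
  by apply: measurable_funD; apply: measurable_funX.
rewrite integral_gauss2//; last by move=> z; rewrite lee_fin.
rewrite (@iterated_integral_gam _ _ mf)//; last by move=> z; rewrite lee_fin.
transitivity (\int[mu]_x \int[mu]_y (G (x ^+ 2 + y ^+ 2))%:E)%E.
  by apply: eq_integral => x _; apply: eq_integral => y _; rewrite -EFinM mulrA.
rewrite integral_radial// integral_itv_obnd_cbnd; last first.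
  by apply: measurable_funTS; apply/measurable_EFinP; exact: continuous_measurable_fun.
rewrite -ge0_integralZl//=; first last.
- by rewrite lee_fin pi_ge0.
- by move=> s _; rewrite lee_fin.
- by apply: measurable_funTS; apply/measurable_EFinP; exact: continuous_measurable_fun.
apply: eq_integral => s _; rewrite -EFinM /G mulrC divfK//.
by rewrite gt_eqF ?pi_gt0.
Qed.

Lemma expectation_dist_gauss2 (l m : R) : 0 < l -> 0 < m ->
  (\int[gam2]_z \int[gam2]_w
     `|l * (z.1 ^+ 2 + z.2 ^+ 2) - m * (w.1 ^+ 2 + w.2 ^+ 2)|%:E =
   ((l ^+ 2 + m ^+ 2) / (l + m))%:E)%E.
Proof.
move=> l0 m0.
have ca (k b : R) : continuous (fun t : R => b - k * t).
  by move=> t; apply: cvgB; [exact: cvg_cst|apply: cvgM; [exact: cvg_cst|exact: cvg_id]].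
rewrite -(integral_dist2_exponential l0 m0).
rewrite -(@integral_gauss2_radial (fun s => l * s - m + 2 * m * expR (- (l * s / m)))).
- apply: eq_integral => z _.
  rewrite (@integral_gauss2_radial (fun t => `|l * (z.1 ^+ 2 + z.2 ^+ 2) - m * t|))//.
    by rewrite integral_distM_exponential ?(ltW l0)// addr_ge0 ?sqr_ge0.
  by move=> t; apply: cvg_norm; exact: ca.
- move=> t; rewrite (_ : (fun _ => _) = fun s => - (m - l * s) + 2 * m * expR (0 - l / m * s)).
    apply: cvgD; first by apply: cvgN; exact: ca.
    apply: cvgM; first exact: cvg_cst.
    by apply: continuous_cvg; [exact: continuous_expR|exact: ca].
  by apply/funext => s; congr (_ + _ * expR _); ring.
- by move=> t; exact: dist_exponential_ge0.
Qed.
End radial_gauss.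

Definition normsq {R : realType} (z : R * R) : R := z.1 ^+ 2 + z.2 ^+ 2.

(** * Gaussian integrals of a difference of two squared moduli *)

Section quadratic.
Context {R : realType}.
Local Notation gam2 := (gauss2 R).
Local Notation C := (R * R)%type.
Implicit Type l : seq (R * R * C).

Definition gram11 l : R := \sum_(i <- l) i.1.1 ^+ 2.
Definition gram12 l : R := \sum_(i <- l) i.1.1 * i.1.2.
Definition gram22 l : R := \sum_(i <- l) i.1.2 ^+ 2.

Lemma measurable_normsq d (T : measurableType d) (f : T -> C) :
  measurable_fun setT f -> measurable_fun setT (fun x => normsq (f x)).
Proof.
move=> mf; apply: measurable_funD; apply: measurable_funX.
  exact: (measurableT_comp measurable_fst).
exact: (measurableT_comp measurable_snd).
Qed.

(* With a nondegenerate first form the triangular normal form is determined by the Gram matrix. *)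
Lemma eq_law_forms l l' (f : C * C -> \bar R) :
  (forall c, c \in l -> unit_circle c.2) -> (forall c, c \in l' -> unit_circle c.2) ->
  gram11 l = gram11 l' -> gram12 l = gram12 l' -> gram22 l = gram22 l' -> 0 < gram11 l ->
  measurable_fun setT f -> (forall z, 0 <= f z)%E ->
  (\int[iid gam2 (size l)]_t f (forms l t) = \int[iid gam2 (size l')]_t f (forms l' t))%E.
Proof.
move=> ul ul' e11 e12 e22 l0 mf f0.
have [a [b [c [a0 c0 [aE abE bcE law]]]]] := law_forms ul.
have [a' [b' [c' [a'0 c'0 [aE' abE' bcE' law']]]]] := law_forms ul'.
have aa : a = a' by apply/eqP; rewrite -(@eqrXn2 _ 2)// aE aE'; exact/eqP.
have a1 : a != 0 by apply/eqP => a1; move: l0; rewrite /gram11 -aE a1 expr0n ltxx.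
have bb : b = b' by apply: (mulfI a1); rewrite abE {1}aa abE'.
have cc : c = c'.
  apply/eqP; rewrite -(@eqrXn2 _ 2)//; apply/eqP; apply: (addrI (b ^+ 2)).
  by rewrite bcE bb bcE'.
apply: (etrans (law f mf f0)); apply: (etrans _ (esym (law' f mf f0))).
by rewrite aa bb cc.
Qed.

Lemma axpy1 (p : R) (z r : C) : axpy p (cmul (1, 0) z) r = axpy p z r.
Proof. by rewrite /axpy /cmul/= !mul1r !mul0r subr0 add0r. Qed.

Lemma axpy0 (p : R) (z : C) : axpy p z (0, 0) = rscale p z.
Proof. by rewrite /axpy /rscale/= !addr0. Qed.

Let measurable_formsE l (f : C * C -> \bar R) : measurable_fun setT f ->
  measurable_fun setT (fun t : (size l).-tuple C => f (forms l t)).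
Proof. by move=> mf; exact: (measurableT_comp mf (@measurable_forms _ l)). Qed.

Lemma integral_forms_cons (p q : R) (l : seq (R * R * C)) (f : C * C -> \bar R) :
  measurable_fun setT f -> (forall z, 0 <= f z)%E ->
  (\int[iid gam2 (size ((p, q, (1, 0)%R) :: l))]_t f (forms ((p, q, (1, 0)%R) :: l) t) =
   \int[gam2]_z \int[iid gam2 (size l)]_t
     f (axpy p z (forms l t).1, axpy q z (forms l t).2))%E.
Proof.
move=> mf f0; have mL := @measurable_formsE ((p, q, (1, 0)) :: l) f mf.
apply: (etrans (@integral_iidS _ _ _ gam2 (size l) (fun t => f (forms ((p, q, (1, 0)) :: l) t)) mL (fun=> f0 _))).
by apply: eq_integral => z _; apply: eq_integral => t _; rewrite /= !axpy1.
Qed.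

(* A hyperbolic rotation with entries [ch], [sh] preserves the indefinite form [|z|^2 - |w|^2] and
   makes the two forms independent, with squared moduli [lam] and [m] times exponential variables. *)
Lemma expectation_forms l : (forall c, c \in l -> unit_circle c.2) ->
  0 < gram11 l -> gram12 l ^+ 2 < gram11 l * gram22 l ->
  (\int[iid gam2 (size l)]_t `|normsq (forms l t).1 - normsq (forms l t).2|%:E =
   ((gram11 l ^+ 2 + gram22 l ^+ 2 - 2 * gram12 l ^+ 2) /
    Num.sqrt ((gram11 l + gram22 l) ^+ 2 - 4 * gram12 l ^+ 2))%:E)%E.
Proof.
set k11 := gram11 l; set k12 := gram12 l; set k22 := gram22 l => ul k110 kd.
have k220 : 0 < k22 by have := sqr_ge0 k12; rewrite -(pmulr_rgt0 _ k110); lra.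
pose D := (k11 + k22) ^+ 2 - 4 * k12 ^+ 2.
have D0 : (k11 - k22) ^+ 2 < D by rewrite /D; nra.
have D00 : 0 < D by apply: le_lt_trans D0; exact: sqr_ge0.
pose S := Num.sqrt D; have S0 : 0 < S by rewrite sqrtr_gt0.
have SS : S ^+ 2 = D by rewrite sqr_sqrtr// ltW.
have kS : `|k11 - k22| < S.
  by rewrite -(@ltr_pXn2r _ 2)// ?nnegrE ?normr_ge0 ?(ltW S0)// real_normK ?num_real// SS.
have [kS1 kS2] : - S < k11 - k22 /\ k11 - k22 < S by move: kS; rewrite ltr_norml => /andP.
pose lam := (S + k11 - k22) / 2; pose m := (S - k11 + k22) / 2.
have lam0 : 0 < lam by rewrite /lam; lra.
have m0 : 0 < m by rewrite /m; lra.
pose ch := Num.sqrt ((1 + (k11 + k22) / S) / 2).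
have u0 : 0 < (1 + (k11 + k22) / S) / 2.
  by rewrite divr_gt0// addr_gt0// divr_gt0// addr_gt0.
have ch0 : 0 < ch by rewrite sqrtr_gt0.
have chS : ch ^+ 2 = (1 + (k11 + k22) / S) / 2 by rewrite sqr_sqrtr// ltW.
pose sh := k12 / (S * ch).
have SN : S != 0 by rewrite gt_eqF.
have shS : sh ^+ 2 = ((k11 + k22) / S - 1) / 2.
  rewrite /sh expr_div_n exprMn chS.
  have k12S : k12 ^+ 2 = ((k11 + k22) ^+ 2 - S ^+ 2) / 4 by rewrite SS /D; lra.
  rewrite k12S; field; rewrite SN/=.
  by rewrite gt_eqF// addrC addr_gt0// addr_gt0.
have cs : ch * sh = k12 / S by rewrite /sh; field; rewrite SN gt_eqF.
clearbody sh.
pose l' : seq (R * R * C) := [:: (Num.sqrt lam * ch, Num.sqrt lam * sh, (1, 0));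
  (Num.sqrt m * sh, Num.sqrt m * ch, (1, 0))].
have slam : Num.sqrt lam ^+ 2 = lam by rewrite sqr_sqrtr// ltW.
have sm : Num.sqrt m ^+ 2 = m by rewrite sqr_sqrtr// ltW.
have e11 : gram11 l' = k11.
  rewrite /gram11 !big_cons big_nil /= !exprMn slam sm chS shS /lam /m.
  by field.
have e22 : gram22 l' = k22.
  rewrite /gram22 !big_cons big_nil /= !exprMn slam sm chS shS /lam /m.
  by field.
have e12 : gram12 l' = k12.
  rewrite /gram12 !big_cons big_nil /=.
  transitivity ((Num.sqrt lam ^+ 2 + Num.sqrt m ^+ 2) * (ch * sh)); first by ring.
  by rewrite slam sm cs /lam /m; field.
have ul' c : c \in l' -> unit_circle c.2.
  by rewrite !inE => /orP[|] /eqP-> /=; rewrite /unit_circle/= expr1n expr0n addr0.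
pose f (z : C * C) : \bar R := (`|normsq z.1 - normsq z.2|)%:E.
have mf : measurable_fun setT f.
  apply/measurable_EFinP; apply: measurableT_comp => //.
  by apply: measurable_funB; apply: measurable_normsq.
have f0 z : (0 <= f z)%E by rewrite lee_fin.
rewrite (@eq_law_forms l l' f)//.
rewrite (@integral_forms_cons _ _ _ f mf f0).
transitivity (\int[gam2]_z \int[gam2]_w
     `|lam * (z.1 ^+ 2 + z.2 ^+ 2) - m * (w.1 ^+ 2 + w.2 ^+ 2)|%:E)%E.
  apply: eq_integral => z _.
  pose g (z : C) (u : C * C) := f (axpy (Num.sqrt lam * ch) z u.1, axpy (Num.sqrt lam * sh) z u.2).
  have mg : measurable_fun setT (g z).
    by apply: measurableT_comp => //; apply: measurable_fun_pair; apply: measurable_axpy.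
  apply: (etrans (@integral_forms_cons _ _ [::] (g z) mg (fun=> f0 _))).
  apply: eq_integral => w _; rewrite integral_iid0//=; last by move=> t; exact: f0.
  rewrite /g !axpy0 /f /axpy /rscale /normsq /=; congr (`|_|)%:E.
  transitivity (Num.sqrt lam ^+ 2 * (ch ^+ 2 - sh ^+ 2) * (z.1 ^+ 2 + z.2 ^+ 2) -
    Num.sqrt m ^+ 2 * (ch ^+ 2 - sh ^+ 2) * (w.1 ^+ 2 + w.2 ^+ 2)); first by ring.
  rewrite slam sm chS shS; field; exact: SN.
rewrite expectation_dist_gauss2//; congr EFin.
have -> : lam + m = S by rewrite /lam /m; field.
congr (_ / _); rewrite /lam /m.
transitivity ((S ^+ 2 + (k11 - k22) ^+ 2) / 2); first by field.
by rewrite SS /D; field.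
Qed.
End quadratic.

Section tilt.
Context {R : realType}.
Local Notation gam2 := (gauss2 R).
Local Notation C := (R * R)%type.
Implicit Type l : seq (R * R * C).

Lemma normsq_ge0 (z : C) : 0 <= normsq z.
Proof. by rewrite /normsq addr_ge0 ?sqr_ge0. Qed.

Lemma normsq_rscale p (z : C) : normsq (rscale p z) = p ^+ 2 * normsq z.
Proof. by rewrite /normsq /rscale/=; ring. Qed.

Let Psi (z : C * C) : \bar R := `|normsq z.1 - normsq z.2|%:E.

Let mPsi : measurable_fun setT Psi.
Proof.
apply/measurable_EFinP; apply: measurableT_comp => //.
by apply: measurable_funB; apply: measurable_normsq.
Qed.

Let Psi0 z : (0 <= Psi z)%E. Proof. by rewrite lee_fin. Qed.

Let W (b c b' c' : R) (x x' : C) : \bar R :=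
  (\int[gam2]_y \int[gam2]_y' Psi (axpy b x (rscale c y), axpy b' x' (rscale c' y')))%E.

Let mW2 b c b' c' : measurable_fun setT
  (fun u : ((C * C) * C) * C => Psi (axpy b u.1.1.1 (rscale c u.1.2), axpy b' u.1.1.2 (rscale c' u.2))).
Proof. by apply: (measurableT_comp mPsi); rewrite /axpy /rscale/=; meas. Qed.

Let mW1 b c b' c' : measurable_fun setT (fun u : (C * C) * C =>
  (\int[gam2]_y' Psi (axpy b u.1.1 (rscale c u.2), axpy b' u.1.2 (rscale c' y')))%E).
Proof. exact: (measurable_iterated_gam2 (mW2 b c b' c') (fun=> Psi0 _)). Qed.

Let mW b c b' c' : measurable_fun setT (fun u : C * C => W b c b' c' u.1 u.2).
Proof.
apply: (measurable_iterated_gam2 (mW1 b c b' c')) => z; apply: integral_ge0 => y _; exact: Psi0.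
Qed.

Let W0 b c b' c' x x' : (0 <= W b c b' c' x x')%E.
Proof. by apply: integral_ge0 => y _; apply: integral_ge0 => y' _; exact: Psi0. Qed.

Let tilted (alpha0 : R) (g : C) : R := expR (- (alpha0^-1 * normsq g)).

Let mtilted d (T : measurableType d) alpha0 (g : T -> C) : measurable_fun setT g ->
  measurable_fun setT (fun x => (tilted alpha0 (g x))%:E).
Proof.
move=> mg; apply/measurable_EFinP; apply: measurableT_comp => //.
apply: measurableT_comp => //; apply: measurableT_comp => //.
by apply: measurable_funM => //; exact: measurable_normsq.
Qed.

Let law_pair (alpha0 : R) lA lB :
  (forall c, c \in lA -> unit_circle c.2) -> (forall c, c \in lB -> unit_circle c.2) ->
  exists a b c a' b' c' : R,
  [/\ a ^+ 2 = gram11 lA, a * b = gram12 lA & b ^+ 2 + c ^+ 2 = gram22 lA] /\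
  [/\ a' ^+ 2 = gram11 lB, a' * b' = gram12 lB, b' ^+ 2 + c' ^+ 2 = gram22 lB &
  (\int[iid gam2 (size lA)]_t \int[iid gam2 (size lB)]_t'
     ((tilted alpha0 (axpy 1 (forms lA t).1 (forms lB t').1))%:E *
      Psi ((forms lA t).2, (forms lB t').2)) =
   \int[gam2]_x \int[gam2]_x'
     ((tilted alpha0 (axpy a x (rscale a' x')))%:E * W b c b' c' x x'))%E].
Proof.
move=> uA uB.
have [a [b [c [_ _ [aE abE bcE lawA]]]]] := law_forms uA.
have [a' [b' [c' [_ _ [aE' abE' bcE' lawB]]]]] := law_forms uB.
exists a, b, c, a', b', c'; split => //; split => //.
pose F (u v : C * C) := ((tilted alpha0 (axpy 1 u.1 v.1))%:E * Psi (u.2, v.2))%E.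
have F0 u v : (0 <= F u v)%E by rewrite mule_ge0 ?Psi0// lee_fin expR_ge0.
have mF : measurable_fun setT (fun q : (C * C) * (C * C) => F q.1 q.2).
  apply: emeasurable_funM.
    by apply: mtilted; rewrite /axpy; meas.
  by apply: measurableT_comp => //; meas.
transitivity (\int[iid gam2 (size lA)]_t \int[gam2]_x' \int[gam2]_y'
    F (forms lA t) (rscale a' x', axpy b' x' (rscale c' y')))%E.
  apply: eq_integral => t _.
  exact: (lawB (F (forms lA t)) (measurable_partial2 (forms lA t) mF) (F0 _)).
have mF2 : measurable_fun setT (fun q : ((C * C) * C) * C =>
    F q.1.1 (rscale a' q.1.2, axpy b' q.1.2 (rscale c' q.2))).
  apply: (measurableT_comp mF (g := fun q : ((C * C) * C) * C =>
    (q.1.1, (rscale a' q.1.2, axpy b' q.1.2 (rscale c' q.2))))).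
  by rewrite /axpy /rscale/=; meas.
have mF1 : measurable_fun setT (fun q : (C * C) * C =>
    \int[gam2]_y' F q.1 (rscale a' q.2, axpy b' q.2 (rscale c' y')))%E.
  exact: (measurable_iterated_gam2 mF2 (fun=> F0 _ _)).
have mF' : measurable_fun setT (fun q : C * C => \int[gam2]_x' \int[gam2]_y'
    F q (rscale a' x', axpy b' x' (rscale c' y')))%E.
  by apply: (measurable_iterated_gam2 mF1) => q; apply: integral_ge0 => y _; exact: F0.
apply: (etrans (lawA _ mF' _)).
  by move=> q; apply: integral_ge0 => x' _; apply: integral_ge0 => y _; exact: F0.
apply: eq_integral => x _.
have mF3 : measurable_fun setT (fun q : C * C => \int[gam2]_y'
    F (rscale a x, axpy b x (rscale c q.1)) (rscale a' q.2, axpy b' q.2 (rscale c' y')))%E.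
  apply: (measurableT_comp mF1 (g := fun q : C * C => ((rscale a x, axpy b x (rscale c q.1)), q.2))).
  by rewrite /axpy /rscale/=; meas.
apply: (etrans (@fubini_tonelli _ _ _ _ _ gam2 gam2 _ mF3 _)).
  by move=> q; apply: integral_ge0 => y _; exact: F0.
apply: eq_integral => x' _; rewrite /W.
have mP2 : measurable_fun setT (fun u : C * C =>
    Psi (axpy b x (rscale c u.1), axpy b' x' (rscale c' u.2))).
  by apply: (measurableT_comp mPsi); rewrite /axpy /rscale/=; meas.
have e0 : (0 <= tilted alpha0 (axpy a x (rscale a' x')))%R by exact: expR_ge0.
apply: (etrans _ (integral_gam2Zl e0 (measurable_iterated_gam2 mP2 (fun=> Psi0 _)) _)); last first.
  by move=> y; apply: integral_ge0 => y' _; exact: Psi0.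
apply: eq_integral => y _.
apply: (etrans _ (integral_gam2Zl e0 (measurable_partial2 y mP2) (fun=> Psi0 _))).
apply: eq_integral => y' _; rewrite /F/=; congr ((tilted _ _)%:E * _)%E.
by rewrite /axpy /rscale/= !mul1r.
Qed.

Lemma unit_circle10 : unit_circle ((1, 0) : C).
Proof. by rewrite /unit_circle/= expr1n expr0n addr0. Qed.

(* After a rotation the weight involves one Gaussian variable only, on which it acts as a change of
   variance; what is left is [expectation_forms] for four new pairs of coefficients. *)
Lemma expectation_tilted_forms (alpha0 : R) lA lB :
  (forall c, c \in lA -> unit_circle c.2) -> (forall c, c \in lB -> unit_circle c.2) ->
  0 < alpha0 -> 0 < gram11 lB -> 0 < gram22 lA -> 0 < gram22 lB ->
  let r3 := alpha0 + gram11 lA + gram11 lB in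
  let r12 := gram12 lA * gram12 lB in
  let r1 := r3 * gram22 lA - gram12 lA ^+ 2 in
  let r2 := r3 * gram22 lB - gram12 lB ^+ 2 in
  (\int[iid gam2 (size lA)]_t \int[iid gam2 (size lB)]_t'
     ((expR (- (alpha0^-1 * normsq (axpy 1 (forms lA t).1 (forms lB t').1))))%:E *
      `|normsq (forms lA t).2 - normsq (forms lB t').2|%:E) =
   (alpha0 * ((r1 ^+ 2 + r2 ^+ 2 - 2 * r12 ^+ 2) /
     (r3 ^+ 2 * Num.sqrt ((r1 + r2) ^+ 2 - 4 * r12 ^+ 2))))%:E)%E.
Proof.
move=> uA uB al0 B0 A2 B2 r3 r12 r1 r2.
have [a [b [c [a' [b' [c' [[aE abE bcE] [aE' abE' bcE' law]]]]]]]] := law_pair alpha0 uA uB.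
apply: (etrans law) => {law}.
have [r [k [h [r0 kh ak ah]]]] := polar_pair a a'.
have rr : r ^+ 2 = gram11 lA + gram11 lB.
  by rewrite -aE -aE' ak ah -[LHS]mulr1 -kh; ring.
have A00 : 0 <= gram11 lA by rewrite -aE sqr_ge0.
have r30 : 0 < r3 by rewrite /r3; lra.
have mE : measurable_fun setT (fun u : C * C =>
    ((tilted alpha0 (axpy a u.1 (rscale a' u.2)))%:E * W b c b' c' u.1 u.2)%E).
  apply: emeasurable_funM; last exact: mW.
  by apply: mtilted; rewrite /axpy /rscale/=; meas.
have E0 (u : C * C) : (0 <= (tilted alpha0 (axpy a u.1 (rscale a' u.2)))%:E * W b c b' c' u.1 u.2)%E.
  by rewrite mule_ge0 ?W0// lee_fin expR_ge0.
apply: (etrans (esym (rotation_gam2 kh mE E0))) => /=.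
pose V X X' := W b c b' c' (axpy k X (rscale (- h) X')) (axpy h X (rscale k X')).
have mV : measurable_fun setT (fun u : C * C => V u.1 u.2).
  apply: (measurableT_comp (mW b c b' c') (g := fun u : C * C =>
    (axpy k u.1 (rscale (- h) u.2), axpy h u.1 (rscale k u.2)))).
  by rewrite /axpy /rscale/=; meas.
have V0 X X' : (0 <= V X X')%E by exact: W0.
pose t := Num.sqrt (1 + r ^+ 2 / alpha0).
have t2 : t ^+ 2 = 1 + r ^+ 2 / alpha0.
  by rewrite sqr_sqrtr// addr_ge0// divr_ge0 ?sqr_ge0// ltW.
have t0 : 0 < t.
  by rewrite sqrtr_gt0 ltr_wpDr// divr_ge0 ?sqr_ge0// ltW.
have tE : t ^- 2 = alpha0 / r3.
  by rewrite t2 rr /r3; field; rewrite !gt_eqF//; lra.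
transitivity (\int[gam2]_X ((expR (- (t ^+ 2 - 1) * (X.1 ^+ 2 + X.2 ^+ 2)))%:E *
    \int[gam2]_X' V X X'))%E.
  apply: eq_integral => X _; apply: (etrans _ (integral_gam2Zl (expR_ge0 _)
    (measurable_partial2 X mV) (fun=> V0 _ _))).
  apply: eq_integral => X' _; congr (_%:E * _)%E; congr expR.
  have -> : axpy a (axpy k X (rscale (- h) X')) (rscale a' (axpy h X (rscale k X'))) = rscale r X.
    rewrite /axpy /rscale/= ak ah; congr pair.
      by rewrite -[RHS]mulr1 -kh; ring.
    by rewrite -[RHS]mulr1 -kh; ring.
  rewrite normsq_rscale t2 /normsq; ring.
have mV1 : measurable_fun setT (fun X => \int[gam2]_X' V X X')%E.
  exact: (measurable_iterated_gam2 mV (fun=> V0 _ _)).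
rewrite (tilt_gam2 t0 mV1); last by move=> X; apply: integral_ge0 => X' _; exact: V0.
pose l4 : seq (R * R * C) := [:: (b * k / t, b' * h / t, (1, 0)); (- b * h, b' * k, (1, 0));
  (c, 0, (1, 0)); (0, c', (1, 0))].
have -> : (\int[gam2]_z \int[gam2]_X' V (rscale t^-1 z) X' =
    \int[iid gam2 (size l4)]_u Psi (forms l4 u))%E.
  apply: esym; apply: (etrans (@integral_forms_cons _ _ _ _ _ mPsi Psi0)).
  apply: eq_integral => X _.
  have mP (p q : R) z (f : C * C -> \bar R) : measurable_fun setT f ->
      measurable_fun setT (fun u : C * C => f (axpy p z u.1, axpy q z u.2)).
    by move=> mf; apply: (measurableT_comp mf); rewrite /axpy; meas.
  have m1 := mP (b * k / t) (b' * h / t) X _ mPsi.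
  apply: (etrans (@integral_forms_cons _ _ _ _ _ m1 (fun=> Psi0 _))).
  apply: eq_integral => X' _; rewrite /V /W.
  have m2 := mP (- b * h) (b' * k) X' _ m1.
  apply: (etrans (@integral_forms_cons _ _ _ _ _ m2 (fun=> Psi0 _))).
  apply: eq_integral => y _.
  have m3 := mP c 0 y _ m2.
  apply: (etrans (@integral_forms_cons _ _ _ [::] _ m3 (fun=> Psi0 _))).
  apply: eq_integral => y' _; rewrite integral_iid0//=.
  congr Psi; rewrite /axpy /rscale/=; congr (pair _ _); congr pair; ring.
have k11 : gram11 l4 = r1 / r3.
  rewrite /gram11 !big_cons big_nil /=.
  have -> : (b * k / t) ^+ 2 = b ^+ 2 * k ^+ 2 * (alpha0 / r3) by rewrite -tE; field; rewrite gt_eqF.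
  have -> : (- b * h) ^+ 2 = b ^+ 2 * (1 - k ^+ 2) by rewrite -kh; ring.
  rewrite /r1 -bcE -abE ak; have -> : alpha0 = r3 - r ^+ 2 by rewrite rr /r3; ring.
  by field; rewrite gt_eqF.
have k22 : gram22 l4 = r2 / r3.
  rewrite /gram22 !big_cons big_nil /=.
  have -> : (b' * h / t) ^+ 2 = b' ^+ 2 * h ^+ 2 * (alpha0 / r3) by rewrite -tE; field; rewrite gt_eqF.
  have -> : (b' * k) ^+ 2 = b' ^+ 2 * (1 - h ^+ 2) by rewrite -kh; ring.
  rewrite /r2 -bcE' -abE' ah; have -> : alpha0 = r3 - r ^+ 2 by rewrite rr /r3; ring.
  by field; rewrite gt_eqF.
have k12 : gram12 l4 = - r12 / r3.
  rewrite /gram12 !big_cons big_nil /=.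
  have -> : b * k / t * (b' * h / t) = b * b' * k * h * (alpha0 / r3) by rewrite -tE; field; rewrite gt_eqF.
  rewrite /r12 -abE -abE' ak ah; have -> : alpha0 = r3 - r ^+ 2 by rewrite rr /r3; ring.
  by field; rewrite gt_eqF.
have cauchyA : gram12 lA ^+ 2 <= gram11 lA * gram22 lA.
  by rewrite -abE -aE -bcE exprMn ler_wpM2l ?sqr_ge0// lerDl sqr_ge0.
have cauchyB : gram12 lB ^+ 2 <= gram11 lB * gram22 lB.
  by rewrite -abE' -aE' -bcE' exprMn ler_wpM2l ?sqr_ge0// lerDl sqr_ge0.
have r1_gt : gram22 lA * (alpha0 + gram11 lB) <= r1 by rewrite /r1 /r3; nra.
have r2_gt : gram22 lB * (alpha0 + gram11 lA) <= r2 by rewrite /r2 /r3; nra.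
have r10 : 0 < r1 by apply: lt_le_trans r1_gt; rewrite mulr_gt0// addr_gt0.
have r20 : 0 < r2 by apply: lt_le_trans r2_gt; rewrite mulr_gt0// ltr_wpDr.
have r12_lt : r12 ^+ 2 < r1 * r2.
  rewrite /r12 exprMn; apply: (@le_lt_trans _ _ ((gram11 lA * gram22 lA) * (gram11 lB * gram22 lB))).
    by apply: ler_pM => //; exact: sqr_ge0.
  apply: (@lt_le_trans _ _ ((gram22 lA * (alpha0 + gram11 lB)) * (gram22 lB * (alpha0 + gram11 lA)))).
    have A22 : 0 < gram22 lA * gram22 lB by exact: mulr_gt0.
    rewrite (_ : _ * _ = (gram22 lA * gram22 lB) * (gram11 lA * gram11 lB)); last by ring.
    rewrite [ltRHS](_ : _ = (gram22 lA * gram22 lB) * ((alpha0 + gram11 lB) * (alpha0 + gram11 lA))); last by ring.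
    by rewrite ltr_pM2l//; nra.
  by apply: ler_pM => //; apply: mulr_ge0; lra.
have r3N : r3 != 0 by rewrite gt_eqF.
rewrite /Psi expectation_forms; first last.
- rewrite k11 k12 k22 mulf_div expr_div_n sqrrN ltr_pM2r// invr_gt0.
  by rewrite exprn_gt0.
- by rewrite k11 divr_gt0.
- by move=> i; rewrite !inE => /or4P[] /eqP -> /=; exact: unit_circle10.
rewrite -EFinM; congr EFin; rewrite tE k11 k12 k22.
have -> : (r1 / r3 + r2 / r3) ^+ 2 - 4 * (- r12 / r3) ^+ 2 =
    ((r1 + r2) ^+ 2 - 4 * r12 ^+ 2) / r3 ^+ 2 by field.
have D0 : 0 < (r1 + r2) ^+ 2 - 4 * r12 ^+ 2.
  have := sqr_ge0 (r1 - r2); nra.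
rewrite sqrtrM ?(ltW D0)// sqrtrV ?sqr_ge0// sqrtr_sqr (gtr0_norm r30).
by field; rewrite r3N gt_eqF// sqrtr_gt0.
Qed.
End tilt.

(** * The Kac-Rice formula *)

Section tonelli_lebesgue2.
Context {R : realType} {d : measure_display} {M : measurableType d}.
Variable Q : {sigma_finite_measure set M -> \bar R}.
Local Notation mu := (@lebesgue_measure R).
Local Notation mu2 := (mu \x mu)%E.
Variable f : M * (R * R) -> \bar R.
Hypotheses (mf : measurable_fun setT f) (f0 : forall q, (0 <= f q)%E).
Local Open Scope ereal_scope.

Let m3 : measurable_fun setT (fun q : (M * R) * R => f (q.1.1, (q.1.2, q.2))).
Proof. by apply: (measurableT_comp mf); meas. Qed.

Let m2 : measurable_fun setT (fun q : M * R => \int[mu]_y f (q.1, (q.2, y))).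
Proof. exact: (@measurable_inner_integral _ _ _ _ _ mu _ m3 (fun=> f0 _)). Qed.

Let m20 (q : M * R) : 0 <= \int[mu]_y f (q.1, (q.2, y)).
Proof. by apply: integral_ge0 => y _; exact: f0. Qed.

Let secE t : \int[mu2]_p f (t, p) = \int[mu]_x \int[mu]_y f (t, (x, y)).
Proof.
exact: (@fubini_tonelli1 _ _ _ _ _ mu mu _ (measurable_partial2 t mf) (fun=> f0 _)).
Qed.

Lemma measurable_integral_lebesgue2 : measurable_fun setT (fun t => \int[mu2]_p f (t, p)).
Proof.
rewrite (_ : (fun _ => _) = fun t => \int[mu]_x \int[mu]_y f (t, (x, y))).
  exact: (@measurable_inner_integral _ _ _ _ _ mu _ m2 m20).
by apply/funext => t; exact: secE.
Qed.

Lemma tonelli_lebesgue2 :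
  \int[Q]_t \int[mu2]_p f (t, p) = \int[mu2]_p \int[Q]_t f (t, p).
Proof.
have mQ : measurable_fun setT (fun p : R * R => \int[Q]_t f (t, p)).
  exact: (@measurable_inner_integral' _ _ _ _ _ Q _ mf f0).
have Q0 (p : R * R) : 0 <= \int[Q]_t f (t, p) by apply: integral_ge0 => t _; exact: f0.
rewrite (@fubini_tonelli1 _ _ _ _ _ mu mu _ mQ Q0) /fubini_F.
transitivity (\int[Q]_t \int[mu]_x \int[mu]_y f (t, (x, y))).
  by apply: eq_integral => t _; exact: secE.
apply: (etrans (@fubini_tonelli _ _ _ _ _ Q mu _ m2 m20)); apply: eq_integral => x _.
have mx : measurable_fun setT (fun q : M * R => f (q.1, (x, q.2))).
  by apply: (measurableT_comp mf); meas.
exact: (@fubini_tonelli _ _ _ _ _ Q mu _ mx (fun=> f0 _)).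
Qed.
End tonelli_lebesgue2.

Section kac_rice.
Context {R : realType} {d : measure_display} {M : measurableType d}.
Variable Q : probability M R.
Local Notation mu := (@lebesgue_measure R).
Local Notation mu2 := (mu \x mu)%E.
Local Notation gam2 := (gauss2 R).
Variables u ux uy v vx vy : M -> R -> R -> R.
Hypothesis C1u : forall t, C1fun (u t) (ux t) (uy t).
Hypothesis C1v : forall t, C1fun (v t) (vx t) (vy t).
Local Notation measurable2 f :=
  (measurable_fun setT (fun q : M * (R * R) => f q.1 q.2.1 q.2.2)).
Hypotheses (mu_ : measurable2 u) (mux : measurable2 ux) (muy : measurable2 uy).
Hypotheses (mv_ : measurable2 v) (mvx : measurable2 vx) (mvy : measurable2 vy).
Let J t (p : R * R) := ux t p.1 p.2 * vy t p.1 p.2 - uy t p.1 p.2 * vx t p.1 p.2.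
Hypothesis nondegenerate : forall p : R * R, Q [set t | uy t p.1 p.2 * J t p = 0] = 0%E.

Let mJ : measurable_fun setT (fun q : M * (R * R) => J q.1 q.2).
Proof. by apply: measurable_funB; apply: measurable_funM. Qed.

Let D t p := uy t p.1 p.2 * J t p.

Let mD : measurable_fun setT (fun q : M * (R * R) => D q.1 q.2).
Proof. exact: measurable_funM. Qed.

Let mN : measurable [set q : M * (R * R) | D q.1 q.2 = 0].
Proof.
rewrite -[X in measurable X]setTI; exact: (mD measurableT (measurable_set1 (0 : R))).
Qed.

Let null_ae : {ae Q, forall t, mu2 [set p | D t p = 0] = 0%E}.
Proof.
pose f (q : M * (R * R)) : \bar R := (\1_[set q : M * (R * R) | D q.1 q.2 = 0] q)%:E.
have mf : measurable_fun setT f.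
  by apply/measurable_EFinP; exact: measurable_indic.
have f0 q : (0 <= f q)%E by rewrite lee_fin.
have mDt t : measurable [set p : R * R | D t p = 0].
  have := measurable_partial2 t mD => mDt.
  by rewrite -[X in measurable X]setTI; exact: (mDt measurableT _ (measurable_set1 (0 : R))).
have mDp (p : R * R) : measurable [set t | D t p = 0].
  have := measurable_partial1 p mD => mDp.
  by rewrite -[X in measurable X]setTI; exact: (mDp measurableT _ (measurable_set1 (0 : R))).
have sec t : (\int[mu2]_p f (t, p) = mu2 [set p : R * R | D t p = 0%R])%E.
  transitivity (\int[mu2]_p (\1_[set p : R * R | D t p = 0%R] p)%:E)%E.
    by apply: eq_integral => p _; rewrite /f !indicE.
  have := @integral_indic _ _ _ mu2 setT measurableT _ (mDt t); by rewrite setIT.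
have F0 : (\int[Q]_t \int[mu2]_p f (t, p) = 0)%E.
  rewrite (tonelli_lebesgue2 Q mf f0) integral0_eq// => p _.
  transitivity (\int[Q]_t (\1_[set t | D t p = 0%R] t)%:E)%E.
    by apply: eq_integral => t _; rewrite /f !indicE.
  by rewrite integral_indic ?setIT//; exact: nondegenerate.
have G0 t : (0 <= \int[mu2]_p f (t, p))%E by apply: integral_ge0 => p _; exact: f0.
have := measurable_integral_lebesgue2 mf f0 => mI.
have [+ _] := @ae_eq_integral_abs _ _ _ Q setT measurableT _ mI.
rewrite (eq_integral (fun t => \int[mu2]_p f (t, p))%E); last first.
  by move=> t _; rewrite gee0_abs.
by move=> /(_ F0); apply: filterS => t /(_ Logic.I); rewrite -sec.
Qed.

Let npts t (T : set (R * R)) c : \bar R :=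
  npoints (T `&` [set p | u t p.1 p.2 = c.1 /\ v t p.1 p.2 = c.2]).

Lemma measurable_npoints_level (T : set (R * R)) : open T ->
  measurable_fun setT (fun q : M * (R * R) => npts q.1 T q.2).
Proof.
move=> oT.
pose U (q : M * (R * R)) a b := u q.1 a b - q.2.1; pose V (q : M * (R * R)) a b := v q.1 a b - q.2.2.
have cU q : cont2 (U q).
  by have [_ _ cu _ _] := C1u q.1 => a b; apply: cvgB; [exact: cu|exact: cvg_cst].
have cV q : cont2 (V q).
  by have [_ _ cv _ _] := C1v q.1 => a b; apply: cvgB; [exact: cv|exact: cvg_cst].
have mU (p : R * R) : measurable_fun setT (fun q => U q p.1 p.2).
  apply: measurable_funB; last by meas.
  exact: (measurableT_comp (measurable_partial1 p mu_) measurable_fst).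
have mV (p : R * R) : measurable_fun setT (fun q => V q p.1 p.2).
  apply: measurable_funB; last by meas.
  exact: (measurableT_comp (measurable_partial1 p mv_) measurable_fst).
apply: eq_measurable_fun (measurable_npoints_zeros cU cV mU mV oT) => q _.
congr npoints; apply/seteqP; split => p [Tp [/= h1 h2]]; split => //; rewrite /U /V.
  by move: h1 h2; rewrite /U /V => /eqP + /eqP; rewrite !subr_eq0 => /eqP ? /eqP.
by rewrite h1 h2 !subrr.
Qed.

Lemma kac_rice (T : set (R * R)) : open T ->
  (\int[Q]_t \int[gam2]_c npts t T c =
   \int[mu2]_(p in T) \int[Q]_t
     (expR (- (u t p.1 p.2 ^+ 2 + v t p.1 p.2 ^+ 2)) / pi * `|J t p|)%:E)%E.
Proof.
move=> oT; have mnp := measurable_npoints_level oT.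
have np0 t c : (0 <= npts t T c)%E by exact: npoints_ge0.
pose K (q : M * (R * R)) : \bar R :=
  (expR (- (u q.1 q.2.1 q.2.2 ^+ 2 + v q.1 q.2.1 q.2.2 ^+ 2)) / pi * `|J q.1 q.2|)%:E.
have K0 q : (0 <= K q)%E.
  by rewrite lee_fin mulr_ge0// divr_ge0 ?expR_ge0 ?pi_ge0.
have mK : measurable_fun setT K.
  apply/measurable_EFinP; apply: measurable_funM; last by apply: measurableT_comp.
  apply: measurable_funM => //; apply: measurableT_comp => //; apply: measurableT_comp => //.
  by apply: measurable_funD; apply: measurable_funX.
pose KT (q : M * (R * R)) : \bar R := ((\1_T q.2)%:E * K q)%E.
have mKT : measurable_fun setT KT.
  apply: emeasurable_funM => //; apply/measurable_EFinP.
  have m1 : measurable_fun setT (\1_T : R * R -> R).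
    by apply: measurable_indic; exact: open_measurable2.
  exact: (measurableT_comp m1 measurable_snd).
have KT0 q : (0 <= KT q)%E by rewrite mule_ge0// lee_fin.
transitivity (\int[Q]_t \int[mu2]_p KT (t, p))%E; last first.
  rewrite (tonelli_lebesgue2 Q mKT KT0) [RHS]integral_mkcond; apply: eq_integral => p _.
  rewrite patchE; case: ifPn => pT.
    by apply: eq_integral => t _; rewrite /KT indicE pT mul1e.
  by rewrite integral0_eq// => t _; rewrite /KT indicE (negbTE pT) mul0e.
apply: ge0_ae_eq_integral => //.
- exact: (@measurable_inner_integral _ _ _ _ _ gam2 _ mnp (fun=> np0 _ _)).
- exact: (measurable_integral_lebesgue2 mKT KT0).
- by move=> t _; apply: integral_ge0 => c _; exact: np0.
- by move=> t _; apply: integral_ge0 => c _; exact: KT0.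
apply: filterS null_ae => t Dt _.
rewrite (integral_gam2 (measurable_partial2 t mnp) (fun=> np0 _ _)).
have cg1 : continuous (fun x : R => expR (- x ^+ 2)).
  by move=> x; exact: continuous_gauss_fun.
have cg2 : continuous (fun x : R => expR (- x ^+ 2) / pi).
  by move=> x; apply: cvgM; [exact: cg1|exact: cvg_cst].
have g1 (x : R) : 0 <= expR (- x ^+ 2) by exact: expR_ge0.
have g2 (x : R) : 0 <= expR (- x ^+ 2) / pi by rewrite divr_ge0 ?expR_ge0 ?pi_ge0.
have := area_formula (C1u t) (C1v t) cg1 cg2 g1 g2 oT Dt => af.
transitivity (\int[mu2]_c ((expR (- c.1 ^+ 2) * (expR (- c.2 ^+ 2) / pi))%:E * npts t T c))%E.
  apply: eq_integral => c _; rewrite muleC; congr (_%:E * _)%E.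
  by rewrite opprD expRD mulrA.
apply: (etrans af); rewrite [LHS]integral_mkcond; apply: eq_integral => p _.
rewrite patchE /KT/= indicE; case: ifPn => pT; last by rewrite mul0e.
by rewrite mul1e /K/= opprD expRD mulrA.
Qed.
End kac_rice.

(** * Random harmonic polynomials *)

Section C1fun_closure.
Context {R : realType}.

Lemma C1fun_eq (u ux uy ux' uy' : R -> R -> R) :
  (forall x y, ux x y = ux' x y) -> (forall x y, uy x y = uy' x y) ->
  C1fun u ux uy -> C1fun u ux' uy'.
Proof.
move=> ex ey; have -> : ux' = ux by apply/funext => x; apply/funext => y; rewrite ex.
by have -> : uy' = uy by apply/funext => x; apply/funext => y; rewrite ey.
Qed.

Lemma C1fun_cst (c : R) : C1fun (fun _ _ => c) (fun _ _ => 0) (fun _ _ => 0).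
Proof. by split => x y; [exact: is_derive_cst|exact: is_derive_cst|..]; exact: cvg_cst. Qed.

Lemma C1fun_x : C1fun (fun x _ : R => x) (fun _ _ => 1) (fun _ _ => 0).
Proof.
split => x y; [exact: is_derive_id|exact: is_derive_cst|exact: cvg_fst|..]; exact: cvg_cst.
Qed.

Lemma C1fun_y : C1fun (fun _ y : R => y) (fun _ _ => 0) (fun _ _ => 1).
Proof.
split => x y; [exact: is_derive_cst|exact: is_derive_id|exact: cvg_snd|..]; exact: cvg_cst.
Qed.

Lemma C1funD (u ux uy v vx vy : R -> R -> R) : C1fun u ux uy -> C1fun v vx vy ->
  C1fun (fun x y => u x y + v x y) (fun x y => ux x y + vx x y) (fun x y => uy x y + vy x y).
Proof.
move=> [dux duy cu cux cuy] [dvx dvy cv cvx cvy]; split => x y.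
- by have h := dux x y; have h' := dvx x y; exact: is_deriveD.
- by have h := duy x y; have h' := dvy x y; exact: is_deriveD.
- by apply: cvgD; [exact: cu|exact: cv].
- by apply: cvgD; [exact: cux|exact: cvx].
- by apply: cvgD; [exact: cuy|exact: cvy].
Qed.

Lemma C1funM (u ux uy v vx vy : R -> R -> R) : C1fun u ux uy -> C1fun v vx vy ->
  C1fun (fun x y => u x y * v x y) (fun x y => ux x y * v x y + u x y * vx x y)
    (fun x y => uy x y * v x y + u x y * vy x y).
Proof.
move=> [dux duy cu cux cuy] [dvx dvy cv cvx cvy]; split => x y.
- have h := dux x y; have h' := dvx x y; have := is_deriveM h h'.
  by move=> H; apply: (is_derive_eq H); rewrite /GRing.scale/=; ring.
- have h := duy x y; have h' := dvy x y; have := is_deriveM h h'.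
  by move=> H; apply: (is_derive_eq H); rewrite /GRing.scale/=; ring.
- by apply: cvgM; [exact: cu|exact: cv].
- by apply: cvgD; apply: cvgM; [exact: cux|exact: cv|exact: cu|exact: cvx].
- by apply: cvgD; apply: cvgM; [exact: cuy|exact: cv|exact: cu|exact: cvy].
Qed.

Lemma C1funZ (k : R) (u ux uy : R -> R -> R) : C1fun u ux uy ->
  C1fun (fun x y => k * u x y) (fun x y => k * ux x y) (fun x y => k * uy x y).
Proof.
by move=> Cu; apply: C1fun_eq (C1funM (C1fun_cst k) Cu) => x y; rewrite mul0r add0r.
Qed.

Lemma C1fun_sum (I : Type) (r : seq I) (u ux uy : I -> R -> R -> R) :
  (forall i, C1fun (u i) (ux i) (uy i)) ->
  C1fun (fun x y => \sum_(i <- r) u i x y) (fun x y => \sum_(i <- r) ux i x y)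
    (fun x y => \sum_(i <- r) uy i x y).
Proof.
move=> Cu; elim: r => [|i r IH].
  have e0 (f : I -> R -> R -> R) : (fun x y => \sum_(i <- [::]) f i x y) = (fun _ _ => 0).
    by apply/funext => x; apply/funext => y; rewrite big_nil.
  by rewrite !e0; exact: C1fun_cst.
have e (f : I -> R -> R -> R) : (fun x y => \sum_(j <- i :: r) f j x y) =
    (fun x y => f i x y + \sum_(j <- r) f j x y).
  by apply/funext => x; apply/funext => y; rewrite big_cons.
by rewrite !e; exact: C1funD.
Qed.
End C1fun_closure.

Section cpow.
Context {R : realType}.
Local Notation C := (R * R)%type.

Fixpoint cpow (p : C) j : C := if j is k.+1 then cmul p (cpow p k) else (1, 0).
Definition cconj (p : C) : C := (p.1, - p.2).

Lemma cpow_cconj p j : cpow (cconj p) j = cconj (cpow p j).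
Proof.
elim: j => [|j IH]/=; first by rewrite /cconj/= oppr0.
by rewrite IH /cmul /cconj/=; congr pair; ring.
Qed.

Lemma cpow_rscale k p j : cpow (rscale k p) j = rscale (k ^+ j) (cpow p j).
Proof.
elim: j => [|j IH]/=; first by rewrite /rscale/= expr0 !mul1r.
by rewrite IH exprS /cmul /rscale/=; congr pair; ring.
Qed.

Lemma normsq_cmul (w z : C) : normsq (cmul w z) = normsq w * normsq z.
Proof. by rewrite /normsq /cmul/=; ring. Qed.

Lemma unit_circle_cpow w j : unit_circle w -> unit_circle (cpow w j).
Proof.
rewrite /unit_circle => w1; elim: j => [|j IH]/=; first by rewrite expr1n expr0n addr0.
by have := normsq_cmul w (cpow w j); rewrite /normsq w1 IH mulr1.
Qed.

Lemma C1fun_cpow j :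
  C1fun (fun x y => (cpow (x, y) j).1) (fun x y => j%:R * (cpow (x, y) j.-1).1)
    (fun x y => - (j%:R * (cpow (x, y) j.-1).2)) /\
  C1fun (fun x y => (cpow (x, y) j).2) (fun x y => j%:R * (cpow (x, y) j.-1).2)
    (fun x y => j%:R * (cpow (x, y) j.-1).1).
Proof.
elim: j => [|j [IH1 IH2]]/=.
  by split; apply: C1fun_eq (C1fun_cst _) => x y; rewrite mul0r ?oppr0.
have jE x y : j%:R * (cpow (x, y) j).1 = j%:R * (x * (cpow (x, y) j.-1).1 - y * (cpow (x, y) j.-1).2) /\
    j%:R * (cpow (x, y) j).2 = j%:R * (y * (cpow (x, y) j.-1).1 + x * (cpow (x, y) j.-1).2).
  by case: j {IH1 IH2} => [|j]/=; rewrite ?mul0r.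
split.
- have := C1funD (C1funM C1fun_x IH1) (C1funZ (-1) (C1funM C1fun_y IH2)).
  rewrite (_ : (fun x y => x * _ + _) = fun x y => x * (cpow (x, y) j).1 - y * (cpow (x, y) j).2); last first.
    by apply/funext => x; apply/funext => y; rewrite mulN1r.
  apply: C1fun_eq => x y; have [e1 e2] := jE x y.
    by rewrite -natr1 mulrDl mul1r e1; ring.
  by rewrite -natr1 mulrDl mul1r e2; ring.
- have := C1funD (C1funM C1fun_y IH1) (C1funM C1fun_x IH2).
  apply: C1fun_eq => x y; have [e1 e2] := jE x y.
    by rewrite -natr1 mulrDl mul1r e2; ring.
  by rewrite -natr1 mulrDl mul1r e1; ring.
Qed.
End cpow.

Section clin.
Context {R : realType}.
Local Notation C := (R * R)%type.

Definition clin n (w : nat -> R) (e : nat -> C) (t : n.-tuple C) : C :=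
  (\sum_(j < n) w j * (cmul (tnth t j) (e j)).1, \sum_(j < n) w j * (cmul (tnth t j) (e j)).2).

Lemma eq_clin n (w w' : nat -> R) (e e' : nat -> C) (t : n.-tuple C) :
  (forall j a, rscale (w j) (cmul a (e j)) = rscale (w' j) (cmul a (e' j))) ->
  clin w e t = clin w' e' t.
Proof.
move=> E; rewrite /clin; congr pair; apply: eq_bigr => j _.
  by have := congr1 fst (E j (tnth t j)).
by have := congr1 snd (E j (tnth t j)).
Qed.

Lemma cmulC (w z : C) : cmul w z = cmul z w.
Proof. by rewrite /cmul; congr pair; ring. Qed.

Lemma cmul_clin n (w : nat -> R) (e : nat -> C) (p : C) (t : n.-tuple C) :
  cmul p (clin w e t) = clin w (fun j => cmul p (e j)) t.
Proof.
rewrite /clin /cmul/=; congr pair; rewrite !mulr_sumr.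
  by rewrite -sumrB; apply: eq_bigr => j _; ring.
by rewrite -big_split/=; apply: eq_bigr => j _; ring.
Qed.

Lemma clin_cons n (w : nat -> R) (e : nat -> C) (z : C) (t : n.-tuple C) :
  clin w e (tcons (z, t)) =
  axpy (w 0%N) (cmul z (e 0%N)) (clin (fun j => w j.+1) (fun j => e j.+1) t).
Proof.
rewrite /clin /axpy !big_ord_recl tnth0 /=; congr (_ + _, _ + _);
  by apply: eq_bigr => j _; rewrite tnthS.
Qed.

Lemma forms_clin n (f : nat -> R * R * C) (t : n.-tuple C) :
  forms (mkseq f n) t =
  (clin (fun j => (f j).1.1) (fun j => (f j).2) t, clin (fun j => (f j).1.2) (fun j => (f j).2) t).
Proof.
elim: n f t => [|n IH] f t.
  by rewrite /clin !big_ord0 /=; case: (tval t).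
rewrite (tuple_eta t) -[[tuple of _ :: _]]/(tcons (thead t, [tuple of behead t])) !clin_cons.
rewrite /mkseq /= -[X in map f X]/(iota (1 + 0) n) iotaDl -map_comp.
rewrite -[[seq _ | i <- _]]/(mkseq (f \o succn) n).
by case: (f 0%N) => -[p q] w /=; rewrite (IH _ [tuple of behead t]) (cmulC w).
Qed.

Lemma measurable_clin d (M : measurableType d) n (w : nat -> R) (e : nat -> M -> C)
    (t : M -> n.-tuple C) : (forall j, measurable_fun setT (e j)) -> measurable_fun setT t ->
  measurable_fun setT (fun x => clin w (fun j => e j x) (t x)).
Proof.
move=> me mt.
have mc (j : 'I_n) : measurable_fun setT (fun x => cmul (tnth (t x) j) (e j x)).
  by apply: measurable_cmul => //; apply: (measurableT_comp (measurable_tnth j)).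
apply: measurable_fun_pair; apply: measurable_sum => j; apply: measurable_funM => //.
  exact: (measurableT_comp measurable_fst (mc j)).
exact: (measurableT_comp measurable_snd (mc j)).
Qed.

Lemma measurable_cpow d (M : measurableType d) (p : M -> C) j :
  measurable_fun setT p -> measurable_fun setT (fun x => cpow (p x) j).
Proof.
move=> mp; elim: j => [|j IH]/=; first exact: measurable_cst.
exact: measurable_cmul.
Qed.

Lemma C1fun_clin n (w : nat -> R) (e : nat -> nat) (t : n.-tuple C) :
  C1fun (fun x y => (clin w (fun j => cpow (x, y) (e j)) t).1)
    (fun x y => (clin (fun j => w j * (e j)%:R) (fun j => cpow (x, y) (e j).-1) t).1)
    (fun x y => - (clin (fun j => w j * (e j)%:R) (fun j => cpow (x, y) (e j).-1) t).2) /\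
  C1fun (fun x y => (clin w (fun j => cpow (x, y) (e j)) t).2)
    (fun x y => (clin (fun j => w j * (e j)%:R) (fun j => cpow (x, y) (e j).-1) t).2)
    (fun x y => (clin (fun j => w j * (e j)%:R) (fun j => cpow (x, y) (e j).-1) t).1).
Proof.
split; rewrite /clin /cmul/=.
- have := C1fun_sum (index_enum _) (fun j : 'I_n => C1funZ (w j) (C1funD
    (C1funZ (tnth t j).1 (C1fun_cpow (e j)).1) (C1funZ (- (tnth t j).2) (C1fun_cpow (e j)).2))).
  set h := (X in C1fun X _ _); set h' := (X in _ -> C1fun X _ _).
  have -> : h = h' by apply/funext => x; apply/funext => y; apply: eq_bigr => j _; ring.
  apply: C1fun_eq => x y; first by apply: eq_bigr => j _; ring.
  by rewrite -sumrN; apply: eq_bigr => j _; ring.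
- have := C1fun_sum (index_enum _) (fun j : 'I_n => C1funZ (w j) (C1funD
    (C1funZ (tnth t j).2 (C1fun_cpow (e j)).1) (C1funZ (tnth t j).1 (C1fun_cpow (e j)).2))).
  apply: C1fun_eq => x y; first by apply: eq_bigr => j _; ring.
  by apply: eq_bigr => j _; ring.
Qed.

Lemma C1fun_clin_conj n (w : nat -> R) (e : nat -> nat) (t : n.-tuple C) :
  C1fun (fun x y => (clin w (fun j => cpow (cconj (x, y)) (e j)) t).1)
    (fun x y => (clin (fun j => w j * (e j)%:R) (fun j => cpow (cconj (x, y)) (e j).-1) t).1)
    (fun x y => (clin (fun j => w j * (e j)%:R) (fun j => cpow (cconj (x, y)) (e j).-1) t).2) /\
  C1fun (fun x y => (clin w (fun j => cpow (cconj (x, y)) (e j)) t).2)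
    (fun x y => (clin (fun j => w j * (e j)%:R) (fun j => cpow (cconj (x, y)) (e j).-1) t).2)
    (fun x y => - (clin (fun j => w j * (e j)%:R) (fun j => cpow (cconj (x, y)) (e j).-1) t).1).
Proof.
split; rewrite /clin /cmul/=.
- have := C1fun_sum (index_enum _) (fun j : 'I_n => C1funZ (w j) (C1funD
    (C1funZ (tnth t j).1 (C1fun_cpow (e j)).1) (C1funZ (tnth t j).2 (C1fun_cpow (e j)).2))).
  set h := (X in C1fun X _ _); set h' := (X in _ -> C1fun X _ _).
  have -> : h = h'.
    apply/funext => x; apply/funext => y; apply: eq_bigr => j _.
    by rewrite cpow_cconj /=; ring.
  apply: C1fun_eq => x y; first by apply: eq_bigr => j _; rewrite cpow_cconj /=; ring.
  by apply: eq_bigr => j _; rewrite cpow_cconj /=; ring.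
- have := C1fun_sum (index_enum _) (fun j : 'I_n => C1funZ (w j) (C1funD
    (C1funZ (tnth t j).2 (C1fun_cpow (e j)).1) (C1funZ (- (tnth t j).1) (C1fun_cpow (e j)).2))).
  set h := (X in C1fun X _ _); set h' := (X in _ -> C1fun X _ _).
  have -> : h = h'.
    apply/funext => x; apply/funext => y; apply: eq_bigr => j _.
    by rewrite cpow_cconj /=; ring.
  apply: C1fun_eq => x y; first by apply: eq_bigr => j _; rewrite cpow_cconj /=; ring.
  by rewrite -sumrN; apply: eq_bigr => j _; rewrite cpow_cconj /=; ring.
Qed.
End clin.

Lemma gauss1_countable (R : realType) (A : set R) :
  measurable A -> countable A -> gauss1 R A = 0%E.
Proof.
move=> mA cA; have /null_content_dominatesP dom := normal_prob_dominates 0 (Num.sqrt (2^-1 : R)).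
by apply: dom => //; exact: countable_lebesgue_measure0.
Qed.

(* For a random affine function [w -> a w + r] of a complex Gaussian [w], a vanishing imaginary
   part or a prescribed modulus leaves at most three values of [w.2] once [w.1] is fixed. *)
Lemma gauss2_affine_null (R : realType) (a : R) (r : R * R) (h K : R) (B : set (R * R)) :
  a != 0 -> measurable B ->
  (forall z, B z -> a * z.2 + r.2 = h \/ normsq (axpy a z r) = K) ->
  gauss2 R B = 0%E.
Proof.
move=> a0 mB BP.
have mf : measurable_fun setT (fun z : R * R => (\1_B z)%:E : \bar R).
  by apply/measurable_EFinP; exact: measurable_indic.
transitivity (\int[gauss2 R]_z (\1_B z)%:E)%E.
  by have := @integral_indic _ _ _ (gauss2 R) setT measurableT _ mB; rewrite setIT => ->.
rewrite integral_gauss2//.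
rewrite integral0_eq// => x _.
have mBx : measurable [set y | B (x, y)].
  have -> : [set y | B (x, y)] = xsection B x.
    by apply/seteqP; split => y; [exact: mem_set|exact: set_mem].
  exact: measurable_xsection.
transitivity (\int[gauss1 R]_y (\1_[set y | B (x, y)] y)%:E)%E.
  by apply: eq_integral => y _; rewrite !indicE.
have := @integral_indic _ _ _ (gauss1 R) setT measurableT _ mBx; rewrite setIT => ->.
apply: gauss1_countable => //; apply: finite_set_countable.
pose s := Num.sqrt (K - (a * x + r.1) ^+ 2).
apply: (@sub_finite_set _ _ [set (h - r.2) / a; (s - r.2) / a; (- s - r.2) / a]); last exact: finite_set3.
move=> y /= /BP[/= e|].
  by left; left; rewrite -e; field.
rewrite /normsq /axpy/= => e.
have /eqP : s ^+ 2 = (a * y + r.2) ^+ 2.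
  have -> : s = `|a * y + r.2| by rewrite -sqrtr_sqr /s -e addrAC subrr add0r.
  by rewrite real_normK ?num_real.
rewrite eqf_sqr => /orP[] /eqP se.
  by left; right; rewrite se; field.
by right; rewrite se; field.
Qed.

Definition coef_law (R : realType) n m :
    probability (n.-tuple (R * R) * m.-tuple (R * R))%type R :=
  (iid (gauss2 R) n \x iid (gauss2 R) m)%E.

Lemma integral_coef_law (R : realType) n m
    (f : n.-tuple (R * R) * m.-tuple (R * R) -> \bar R) :
  measurable_fun setT f -> (forall t, 0 <= f t)%E ->
  (\int[coef_law R n m]_t f t =
   \int[iid (gauss2 R) n]_t \int[iid (gauss2 R) m]_s f (t, s))%E.
Proof.
by move=> mf f0; apply: (@fubini_tonelli1 _ _ _ _ _ (iid (gauss2 R) n) (iid (gauss2 R) m) f mf f0).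
Qed.

Section harmonic.
Context {R : realType}.
Local Notation mu := (@lebesgue_measure R).
Local Notation mu2 := (mu \x mu)%E.
Local Notation gam2 := (gauss2 R).
Local Notation C := (R * R)%type.
Variables (n' m : nat) (alpha beta : nat -> R).
Local Notation n := n'.+1.
Hypothesis alpha_gt0 : forall j, (j <= n)%N -> 0 < alpha j.
Hypothesis m_gt0 : (0 < m)%N.
Hypothesis beta_gt0 : forall j, (j <= m)%N -> 0 < beta j.

Local Notation M := (n.-tuple C * m.+1.-tuple C)%type.
Local Notation Q := (coef_law R n m.+1).

(* [holo] and [anti] are the two parts of the harmonic polynomial without its [A_0] term, in terms
   of normalized coefficients; [dholo] and [danti] are their Wirtinger derivatives. *)
Definition holo (t : n.-tuple C) p :=
  clin (fun j => Num.sqrt (alpha j.+1)) (fun j => cpow p j.+1) t.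
Definition dholo (t : n.-tuple C) p :=
  clin (fun j => Num.sqrt (alpha j.+1) * j.+1%:R) (fun j => cpow p j) t.
Definition anti (t : m.+1.-tuple C) p :=
  clin (fun j => Num.sqrt (beta j)) (fun j => cpow (cconj p) j) t.
Definition danti (t : m.+1.-tuple C) p :=
  clin (fun j => Num.sqrt (beta j) * j%:R) (fun j => cpow (cconj p) j.-1) t.

Let k := (Num.sqrt (alpha 0%N))^-1.

Let k_gt0 : 0 < k. Proof. by rewrite invr_gt0 sqrtr_gt0 alpha_gt0. Qed.

Let u (t : M) x y := - k * ((holo t.1 (x, y)).1 + (anti t.2 (x, y)).1).
Let ux (t : M) x y := - k * ((dholo t.1 (x, y)).1 + (danti t.2 (x, y)).1).
Let uy (t : M) x y := - k * (- (dholo t.1 (x, y)).2 + (danti t.2 (x, y)).2).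
Let v (t : M) x y := - k * ((holo t.1 (x, y)).2 + (anti t.2 (x, y)).2).
Let vx (t : M) x y := - k * ((dholo t.1 (x, y)).2 + (danti t.2 (x, y)).2).
Let vy (t : M) x y := - k * ((dholo t.1 (x, y)).1 - (danti t.2 (x, y)).1).

Let C1u t : C1fun (u t) (ux t) (uy t).
Proof.
by apply: C1funZ; apply: C1funD; [have [] := C1fun_clin (fun j => Num.sqrt (alpha j.+1)) succn t.1
  |have [] := C1fun_clin_conj (fun j => Num.sqrt (beta j)) id t.2].
Qed.

Let C1v t : C1fun (v t) (vx t) (vy t).
Proof.
by apply: C1funZ; apply: C1funD; [have [] := C1fun_clin (fun j => Num.sqrt (alpha j.+1)) succn t.1
  |have [] := C1fun_clin_conj (fun j => Num.sqrt (beta j)) id t.2].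
Qed.

Let mfst : measurable_fun setT (fun q : M * C => q.1.1). Proof. by meas. Qed.
Let msnd : measurable_fun setT (fun q : M * C => q.1.2). Proof. by meas. Qed.
Let mpt : measurable_fun setT (fun q : M * C => (q.2.1, q.2.2)). Proof. by meas. Qed.
Let mconj : measurable_fun setT (fun q : M * C => cconj (q.2.1, q.2.2)).
Proof.
apply: measurable_fun_pair; first by rewrite /=; meas.
by apply: measurableT_comp => //; rewrite /=; meas.
Qed.

Let mholo : measurable_fun setT (fun q : M * C => holo q.1.1 (q.2.1, q.2.2)).
Proof. by apply: measurable_clin => // j; exact: (measurable_cpow j.+1 mpt). Qed.
Let mdholo : measurable_fun setT (fun q : M * C => dholo q.1.1 (q.2.1, q.2.2)).
Proof. by apply: measurable_clin => // j; exact: (measurable_cpow j mpt). Qed.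
Let manti : measurable_fun setT (fun q : M * C => anti q.1.2 (q.2.1, q.2.2)).
Proof. by apply: measurable_clin => // j; exact: (measurable_cpow j mconj). Qed.
Let mdanti : measurable_fun setT (fun q : M * C => danti q.1.2 (q.2.1, q.2.2)).
Proof. by apply: measurable_clin => // j; exact: (measurable_cpow j.-1 mconj). Qed.

Let m1 (f : M * C -> C) : measurable_fun setT f -> measurable_fun setT (fun q => (f q).1).
Proof. exact: (measurableT_comp measurable_fst). Qed.
Let m2 (f : M * C -> C) : measurable_fun setT f -> measurable_fun setT (fun q => (f q).2).
Proof. exact: (measurableT_comp measurable_snd). Qed.

Let mu_ : measurable_fun setT (fun q : M * C => u q.1 q.2.1 q.2.2).
Proof. by apply: measurable_funM => //; apply: measurable_funD; exact: m1. Qed.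
Let mux : measurable_fun setT (fun q : M * C => ux q.1 q.2.1 q.2.2).
Proof. by apply: measurable_funM => //; apply: measurable_funD; exact: m1. Qed.
Let muy : measurable_fun setT (fun q : M * C => uy q.1 q.2.1 q.2.2).
Proof.
apply: measurable_funM => //; apply: measurable_funD; last exact: m2.
by apply: measurableT_comp => //; exact: m2.
Qed.
Let mv_ : measurable_fun setT (fun q : M * C => v q.1 q.2.1 q.2.2).
Proof. by apply: measurable_funM => //; apply: measurable_funD; exact: m2. Qed.
Let mvx : measurable_fun setT (fun q : M * C => vx q.1 q.2.1 q.2.2).
Proof. by apply: measurable_funM => //; apply: measurable_funD; exact: m2. Qed.
Let mvy : measurable_fun setT (fun q : M * C => vy q.1 q.2.1 q.2.2).
Proof. by apply: measurable_funM => //; apply: measurable_funB; exact: m1. Qed.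

Let J t (p : C) := ux t p.1 p.2 * vy t p.1 p.2 - uy t p.1 p.2 * vx t p.1 p.2.

Let JE t p : J t p = k ^+ 2 * (normsq (dholo t.1 p) - normsq (danti t.2 p)).
Proof. by rewrite /J /ux /uy /vx /vy /normsq; case: p => a b /=; ring. Qed.

Let mD : measurable_fun setT (fun q : M * C => uy q.1 q.2.1 q.2.2 * J q.1 q.2).
Proof.
by apply: measurable_funM => //; apply: measurable_funB; apply: measurable_funM.
Qed.

Let measurable_bad (p : C) : measurable [set t : M | uy t p.1 p.2 * J t p = 0].
Proof.
have := measurable_partial1 p mD => mDp.
by rewrite -[X in measurable X]setTI; exact: (mDp measurableT _ (measurable_set1 (0 : R))).
Qed.
Let dholo_cons (z : C) (t : n'.-tuple C) (p : C) : dholo (tcons (z, t)) p =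
  axpy (Num.sqrt (alpha 1%N)) z (dholo (tcons ((0, 0) : C, t)) p).
Proof.
by rewrite /dholo !clin_cons /= /axpy /cmul/=; congr pair; ring.
Qed.

Let nondegenerate (p : C) : Q [set t : M | uy t p.1 p.2 * J t p = 0] = 0%E.
Proof.
set B := [set t : M | _]; have mB : measurable B by exact: measurable_bad.
have m1B : measurable_fun setT (fun t : M => (\1_B t)%:E : \bar R).
  by apply/measurable_EFinP; exact: measurable_indic.
have B0 (t : M) : (0 <= (\1_B t)%:E :> \bar R)%E by rewrite lee_fin.
transitivity (\int[Q]_t (\1_B t)%:E)%E.
  by have := @integral_indic _ _ _ Q setT measurableT _ mB; rewrite setIT => ->.
rewrite (integral_coef_law m1B B0).
have mI : measurable_fun setT (fun t => \int[iid gam2 m.+1]_s (\1_B (t, s))%:E)%E.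
  exact: (@measurable_inner_integral _ _ _ _ _ (iid gam2 m.+1) _ m1B B0).
have I0 t : (0 <= \int[iid gam2 m.+1]_s (\1_B (t, s))%:E)%E.
  by apply: integral_ge0 => s _; rewrite lee_fin.
rewrite (integral_iidS gam2 mI I0).
pose F (q : C * (n'.-tuple C * m.+1.-tuple C)) : \bar R := (\1_B (tcons (q.1, q.2.1), q.2.2))%:E.
have mtc : measurable_fun setT (fun q : C * (n'.-tuple C * m.+1.-tuple C) => (tcons (q.1, q.2.1), q.2.2)).
  apply: measurable_fun_pair; last by meas.
  apply: (measurableT_comp (@measurable_tcons _ _ n')
    (g := fun q : C * (n'.-tuple C * m.+1.-tuple C) => (q.1, q.2.1))).
  by meas.
have mF : measurable_fun setT F by exact: (measurableT_comp m1B mtc).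
have F0 q : (0 <= F q)%E by rewrite lee_fin.
transitivity (\int[gam2]_z \int[coef_law R n' m.+1]_q F (z, q))%E.
  apply: eq_integral => z _.
  exact: (esym (integral_coef_law (measurable_partial2 z mF) (fun=> F0 _))).
rewrite (@fubini_tonelli _ _ _ _ _ gam2 (coef_law R n' m.+1) _ mF F0).
rewrite integral0_eq// => -[t s] _.
have mBts : measurable [set z : C | B (tcons (z, t), s)].
  have mz : measurable_fun setT (fun z : C => (tcons (z, t), s)).
    exact: (measurable_partial1 (t, s) mtc).
  by rewrite -[X in measurable X]setTI; exact: (mz measurableT _ mB).
transitivity (\int[gam2]_z (\1_[set z : C | B (tcons (z, t), s)] z)%:E)%E.
  by apply: eq_integral => z _; rewrite /F !indicE.
have := @integral_indic _ _ _ gam2 setT measurableT _ mBts; rewrite setIT => ->.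
apply: (@gauss2_affine_null _ (Num.sqrt (alpha 1%N)) (dholo (tcons ((0, 0) : C, t)) p)
  (danti s p).2 (normsq (danti s p))) => //.
  by rewrite gt_eqF// sqrtr_gt0 alpha_gt0.
move=> z Bz; have : - k * (- (dholo (tcons (z, t)) p).2 + (danti s p).2) *
    (k ^+ 2 * (normsq (dholo (tcons (z, t)) p) - normsq (danti s p))) = 0.
  by move: Bz; rewrite /B /mkset JE /uy -surjective_pairing.
rewrite dholo_cons; set d0 := dholo _ p; set e0 := danti s p => /eqP.
rewrite mulf_eq0 => /orP[].
  rewrite mulf_eq0 oppr_eq0 (gt_eqF k_gt0) addrC subr_eq0 => /eqP e.
  by left; rewrite e.
rewrite mulf_eq0 sqrf_eq0 (gt_eqF k_gt0) subr_eq0 => /eqP e.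
by right.
Qed.

Let K (p : C) : \bar R := (\int[Q]_t
  (expR (- (u t p.1 p.2 ^+ 2 + v t p.1 p.2 ^+ 2)) / pi * `|J t p|)%:E)%E.

Let harmonic_kac_rice (T : set C) : open T ->
  (\int[Q]_t \int[gam2]_c
     npoints (T `&` [set p : C | u t p.1 p.2 = c.1 /\ v t p.1 p.2 = c.2]) =
   \int[mu2]_(p in T) K p)%E.
Proof. exact: (kac_rice C1u C1v mu_ mux muy mv_ mvx mvy nondegenerate). Qed.

Let mK : measurable_fun setT K.
Proof.
apply: (@measurable_inner_integral' _ _ _ _ _ Q (fun q : M * C =>
  (expR (- (u q.1 q.2.1 q.2.2 ^+ 2 + v q.1 q.2.1 q.2.2 ^+ 2)) / pi * `|J q.1 q.2|)%:E)).
  apply/measurable_EFinP; apply: measurable_funM; last first.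
    apply: measurableT_comp => //.
    by apply: measurable_funB; apply: measurable_funM.
  apply: measurable_funM => //; apply: measurableT_comp => //; apply: measurableT_comp => //.
  by apply: measurable_funD; apply: measurable_funX.
by move=> q; rewrite lee_fin mulr_ge0// divr_ge0 ?expR_ge0 ?pi_ge0.
Qed.

Let K0 p : (0 <= K p)%E.
Proof.
by apply: integral_ge0 => t _; rewrite lee_fin mulr_ge0// divr_ge0 ?expR_ge0 ?pi_ge0.
Qed.

Let listA (r : R) (w : C) : seq (R * R * C) := mkseq (fun j => (Num.sqrt (alpha j.+1) * r ^+ j.+1,
  Num.sqrt (alpha j.+1) * j.+1%:R * r ^+ j.+1, cpow w j.+1)) n.
Let listB (r : R) (w : C) : seq (R * R * C) := mkseq (fun j => (Num.sqrt (beta j) * r ^+ j,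
  Num.sqrt (beta j) * j%:R * r ^+ j, cpow (cconj w) j)) m.+1.

Let formsA r w (t : n.-tuple C) : forms (listA r w) t =
  (holo t (rscale r w), cmul (rscale r w) (dholo t (rscale r w))).
Proof.
rewrite /listA forms_clin /holo /dholo cmul_clin; congr pair; apply: eq_clin => j z.
  by rewrite cpow_rscale /rscale /cmul; congr pair; rewrite /=; ring.
by rewrite -[cmul _ (cpow _ j)]/(cpow _ j.+1) cpow_rscale /rscale /cmul; congr pair; rewrite /=; ring.
Qed.

Let formsB r w (t : m.+1.-tuple C) : forms (listB r w) t =
  (anti t (rscale r w), cmul (cconj (rscale r w)) (danti t (rscale r w))).
Proof.
have e : cconj (rscale r w) = rscale r (cconj w) by rewrite /cconj /rscale/= mulrN.
rewrite /listB forms_clin /anti /danti cmul_clin e; congr pair; apply: eq_clin => j z.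
  by rewrite cpow_rscale /rscale /cmul; congr pair; rewrite /=; ring.
case: j => [|j]; first by rewrite !mulr0 !mul0r /rscale !mul0r.
by rewrite -[cmul _ (cpow _ j.+1.-1)]/(cpow _ j.+1) cpow_rscale /rscale /cmul; congr pair; rewrite /=; ring.
Qed.

Let integral_size (l : seq (R * R * C)) j (f : seq C -> \bar R) : size l = j ->
  (\int[iid gam2 (size l)]_t f t = \int[iid gam2 j]_t f t)%E.
Proof. by move=> <-. Qed.

Let unitA r w c : unit_circle w -> c \in listA r w -> unit_circle c.2.
Proof. by move=> w1 /mapP[j _ ->] /=; exact: (unit_circle_cpow j.+1). Qed.

Let unitB r w c : unit_circle w -> c \in listB r w -> unit_circle c.2.
Proof.
move=> w1 /mapP[j _ ->] /=; apply: unit_circle_cpow.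
by move: w1; rewrite /unit_circle/= sqrrN.
Qed.

Let momentA i rho := \sum_(1 <= j < n.+1) (j%:R ^+ i * alpha j * rho ^+ j).
Let momentB i rho := \sum_(1 <= j < m.+1) (j%:R ^+ i * beta j * rho ^+ j).

Let gramA r w : [/\ gram11 (listA r w) = momentA 0 (r ^+ 2), gram12 (listA r w) = momentA 1 (r ^+ 2) &
  gram22 (listA r w) = momentA 2 (r ^+ 2)].
Proof.
have sa (j : 'I_n) : Num.sqrt (alpha j.+1) ^+ 2 = alpha j.+1.
  by rewrite sqr_sqrtr// ltW// alpha_gt0.
rewrite /gram11 /gram12 /gram22 /momentA !big_add1 /= !big_map.
rewrite -[iota 0 n]/(index_iota 0 n) !big_mkord; split; apply: eq_bigr => j _ /=;
  have := sa j; set x := Num.sqrt _ => <-; rewrite exprAC; ring.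
Qed.

Let gramB r w : [/\ gram11 (listB r w) = beta 0%N + momentB 0 (r ^+ 2),
  gram12 (listB r w) = momentB 1 (r ^+ 2) & gram22 (listB r w) = momentB 2 (r ^+ 2)].
Proof.
have sb (j : 'I_m.+1) : Num.sqrt (beta j) ^+ 2 = beta j.
  by rewrite sqr_sqrtr// ltW// beta_gt0// -ltnS.
have sb' (j : 'I_m) : Num.sqrt (beta j.+1) ^+ 2 = beta j.+1.
  by rewrite sqr_sqrtr// ltW// beta_gt0.
rewrite /gram11 /gram12 /gram22 /momentB !big_add1 /= !big_map.
rewrite -[iota 0 m.+1]/(index_iota 0 m.+1) !big_mkord !big_ord_recl/=; split.
- congr (_ + _); first by rewrite expr0 mulr1 (sb ord0).
  apply: eq_bigr => j _ /=; rewrite /bump leq0n add1n; have := sb' j; set x := Num.sqrt _ => <-; rewrite exprAC; ring.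
- rewrite mulr0 mul0r mulr0 add0r.
  apply: eq_bigr => j _ /=; rewrite /bump leq0n add1n; have := sb' j; set x := Num.sqrt _ => <-; rewrite exprAC; ring.
- rewrite mulr0 mul0r expr0n add0r.
  apply: eq_bigr => j _ /=; rewrite /bump leq0n add1n; have := sb' j; set x := Num.sqrt _ => <-; rewrite exprAC; ring.
Qed.

Lemma unit_circle_decomp (p : C) : p != (0, 0) -> exists r w,
  [/\ r ^+ 2 = normsq p, 0 < r, unit_circle w & p = rscale r w].
Proof.
move=> p0; have n0 : 0 < normsq p.
  rewrite lt_neqAle normsq_ge0 andbT eq_sym; apply: contra p0.
  rewrite /normsq paddr_eq0 ?sqr_ge0// !sqrf_eq0; case: p => a b /= /andP[/eqP-> /eqP->].
  exact: eqxx.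
have s0 : Num.sqrt (normsq p) != 0 by rewrite gt_eqF// sqrtr_gt0.
exists (Num.sqrt (normsq p)), (rscale (Num.sqrt (normsq p))^-1 p); split.
- by rewrite sqr_sqrtr// ltW.
- by rewrite sqrtr_gt0.
- rewrite /unit_circle -[LHS]/(normsq _) normsq_rscale exprVn sqr_sqrtr ?(ltW n0)//.
  by rewrite mulVf// gt_eqF.
- by rewrite /rscale/= !mulVKf//; case: p {p0 n0 s0}.
Qed.

Let KE p : p != (0, 0) -> K p = (pi^-1 * zero_density n m alpha beta p.1 p.2)%:E.
Proof.
move=> /unit_circle_decomp[r [w [rE r0 w1 pE]]].
have al0 : 0 < alpha 0%N by exact: alpha_gt0.
have rho0 : 0 < r ^+ 2 by rewrite exprn_gt0.
have k2 : k ^+ 2 = (alpha 0%N)^-1 by rewrite /k exprVn sqr_sqrtr ?ltW.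
have [A0 A1 A2] := gramA r w; have [B0 B1 B2] := gramB r w.
have mom_gt0 (N i : nat) (g : nat -> R) : (0 < N)%N -> (forall j, (j <= N)%N -> 0 < g j) ->
    0 < \sum_(1 <= j < N.+1) (j%:R ^+ i * g j * (r ^+ 2) ^+ j).
  move=> N0 g0; rewrite big_ltn ?ltnS// ltr_wpDr//.
    rewrite big_nat_cond; apply: sumr_ge0 => j /andP[/andP[_ jN] _].
    by rewrite !mulr_ge0 ?exprn_ge0 ?ler0n ?(ltW r0)// ltW// g0.
  by rewrite !mulr_gt0 ?exprn_gt0 ?ltr0n// g0.
pose f (t : M) : \bar R :=
  ((expR (- ((alpha 0%N)^-1 * normsq (axpy 1 (holo t.1 p) (anti t.2 p)))))%:E *
   `|normsq (cmul p (dholo t.1 p)) - normsq (cmul (cconj p) (danti t.2 p))|%:E)%E.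
have f0 t : (0 <= f t)%E by rewrite mule_ge0// lee_fin expR_ge0.
have mf : measurable_fun setT f.
  have pp : (p.1, p.2) = p by case: (p).
  have mh := measurable_partial1 p mholo; have mdh := measurable_partial1 p mdholo.
  have ma := measurable_partial1 p manti; have mda := measurable_partial1 p mdanti.
  rewrite /= pp in mh mdh ma mda.
  apply: emeasurable_funM; apply/measurable_EFinP.
    apply: measurableT_comp => //; apply: measurableT_comp => //; apply: measurable_funM => //.
    by apply: measurable_normsq; apply: measurable_axpy.
  apply: measurableT_comp => //; apply: measurable_funB; apply: measurable_normsq;
    exact: measurable_cmul.
have n2 : normsq p = r ^+ 2 by [].
have n2' : normsq (cconj p) = r ^+ 2 by rewrite -n2 /normsq/= sqrrN.
have c0 : (0 <= ((alpha 0%N)^-1 * (r ^+ 2)^-1 / pi)%:E)%E.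
  by rewrite lee_fin !mulr_ge0 ?invr_ge0 ?pi_ge0 ?(ltW al0) ?(ltW rho0).
transitivity (\int[Q]_t (((alpha 0%N)^-1 * (r ^+ 2)^-1 / pi)%:E * f t))%E.
  apply: eq_integral => t _; rewrite /f -!EFinM; congr EFin.
  have nM (a b : R) : 0 < a -> `|a * b| = a * `|b| by move=> a0; rewrite normrM gtr0_norm.
  rewrite JE k2 !normsq_cmul n2 n2' -mulrBr !nM ?invr_gt0//.
  have -> : (alpha 0%N)^-1 * normsq (axpy 1 (holo t.1 p) (anti t.2 p)) =
      u t p.1 p.2 ^+ 2 + v t p.1 p.2 ^+ 2.
    rewrite -k2 /u /v -surjective_pairing /normsq /axpy/=; ring.
  move: (pi_gt0 R); move: (pi : R) => q q0; field; rewrite !gt_eqF//.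
rewrite (ge0_integralZl Q measurableT mf (fun t _ => f0 t) c0).
rewrite (integral_coef_law mf f0).
have -> : (\int[iid gam2 n]_t \int[iid gam2 m.+1]_s f (t, s) =
    \int[iid gam2 (size (listA r w))]_t \int[iid gam2 (size (listB r w))]_t'
     ((expR (- ((alpha 0%N)^-1 * normsq (axpy 1 (forms (listA r w) t).1 (forms (listB r w) t').1))))%:E *
      `|normsq (forms (listA r w) t).2 - normsq (forms (listB r w) t').2|%:E))%E.
  pose G (x y : C * C) : \bar R := ((expR (- ((alpha 0%N)^-1 * normsq (axpy 1 x.1 y.1))))%:E *
    `|normsq x.2 - normsq y.2|%:E)%E.
  have sA : size (listA r w) = n by exact: size_mkseq.
  have sB : size (listB r w) = m.+1 by exact: size_mkseq.
  apply: (etrans _ (esym (integral_size (fun t => \int[iid gam2 (size (listB r w))]_t'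
    G (forms (listA r w) t) (forms (listB r w) t'))%E sA))).
  apply: eq_integral => t _.
  apply: (etrans _ (esym (integral_size (fun s => G (forms (listA r w) t) (forms (listB r w) s)) sB))).
  by apply: eq_integral => s _; rewrite formsA formsB -pE.
rewrite expectation_tilted_forms//; first last.
- by rewrite B2; exact: mom_gt0.
- by rewrite A2; exact: mom_gt0.
- by rewrite B0 addr_gt0//; [exact: beta_gt0|exact: mom_gt0].
- by move=> c; exact: unitB.
- by move=> c; exact: unitA.
rewrite A0 A1 A2 B0 B1 B2 -EFinM; congr EFin.
rewrite /zero_density -[p.1 ^+ 2 + p.2 ^+ 2]/(normsq p) n2.
rewrite -/(momentA 1 (r ^+ 2)) -/(momentA 2 (r ^+ 2)) -/(momentB 1 (r ^+ 2)) -/(momentB 2 (r ^+ 2)).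
have -> : \sum_(0 <= j < n.+1) (alpha j * (r ^+ 2) ^+ j) = alpha 0%N + momentA 0 (r ^+ 2).
  rewrite big_ltn// expr0 mulr1; congr (_ + _).
  by apply: eq_bigr => j _; rewrite expr0 mul1r.
have -> : \sum_(0 <= j < m.+1) (beta j * (r ^+ 2) ^+ j) = beta 0%N + momentB 0 (r ^+ 2).
  rewrite big_ltn// expr0 mulr1; congr (_ + _).
  by apply: eq_bigr => j _; rewrite expr0 mul1r.
have cancel Y : (alpha 0%N)^-1 / r ^+ 2 / pi * (alpha 0%N * Y) = pi^-1 * (r ^- 2 * Y).
  by move: (pi_gt0 R); move: (pi : R) => q q0; field; rewrite !gt_eqF.
by rewrite cancel addrA.
Qed.

Let fiberE (t : M) (c : C) :
  [set p : C | axpy (Num.sqrt (alpha 0%N)) c (axpy 1 (holo t.1 p) (anti t.2 p)) = (0, 0)] =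
  [set p : C | u t p.1 p.2 = c.1 /\ v t p.1 p.2 = c.2].
Proof.
have kN : k != 0 by rewrite gt_eqF.
have sE : Num.sqrt (alpha 0%N) = k^-1 by rewrite /k invrK.
have solve (X y : R) : k^-1 * y + X = 0 <-> - k * X = y.
  split=> [e|<-]; last by rewrite mulNr mulrN mulKf// addNr.
  have -> : X = - (k^-1 * y) by apply/eqP; rewrite -addr_eq0 addrC e.
  by rewrite mulrNN mulVKf.
apply/seteqP; split => p; rewrite /mkset /u /v -surjective_pairing sE.
  by move=> e; split; apply/solve; [move/(congr1 fst) : e|move/(congr1 snd) : e];
    rewrite /axpy/= !mul1r.
by move=> [/solve e1 /solve e2]; rewrite /axpy/= !mul1r e1 e2.
Qed.

Lemma measurable_fiber_count (T : set C) : open T ->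
  measurable_fun setT (fun q : M * C => npoints (T `&`
    [set p : C | axpy (Num.sqrt (alpha 0%N)) q.2 (axpy 1 (holo q.1.1 p) (anti q.1.2 p)) = (0, 0)])
    : \bar R).
Proof.
move=> oT; apply: eq_measurable_fun (measurable_npoints_level C1u C1v mu_ mv_ oT) => q _.
by rewrite fiberE.
Qed.

Lemma expected_fiber_count (T : set C) : open T ->
  (\int[Q]_t \int[gam2]_c npoints (T `&`
     [set p : C | axpy (Num.sqrt (alpha 0%N)) c (axpy 1 (holo t.1 p) (anti t.2 p)) = (0, 0)%R]) =
   (pi^-1)%:E * \int[mu2]_(p in T) (zero_density n m alpha beta p.1 p.2)%:E)%E.
Proof.
move=> oT.
transitivity (\int[Q]_t \int[gam2]_c
     npoints (T `&` [set p : C | u t p.1 p.2 = c.1 /\ v t p.1 p.2 = c.2]))%E.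
  by apply: eq_integral => t _; apply: eq_integral => c _; rewrite fiberE.
rewrite (harmonic_kac_rice oT).
pose T0 := T `\` [set (0, 0)].
have oT0 : open T0.
  rewrite /T0 setDE; apply: openI => //; apply: closed_openC.
  apply: accessible_closed_set1; apply: hausdorff_accessible; exact: norm_hausdorff.
have mT0 := open_measurable2 oT0.
have m0 : measurable [set ((0, 0) : C)].
  have -> : [set ((0, 0) : C)] = [set 0] `*` [set 0].
    by apply/seteqP; split => -[a b] /=; [case=> -> ->|case=> -> ->].
  exact: measurableX.
have mu0 : mu2 [set ((0, 0) : C)] = 0%E.
  have -> : [set ((0, 0) : C)] = [set 0] `*` [set 0].
    by apply/seteqP; split => -[a b] /=; [case=> -> ->|case=> -> ->].
  by rewrite product_measure1E// [X in (X * _)%E](_ : _ = 0%E) ?mul0e//; exact: lebesgue_measure_set1.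
have -> : (\int[mu2]_(p in T) K p = \int[mu2]_(p in T0) K p)%E.
  apply: (@ge0_negligible_integral _ _ _ mu2) => //.
  - exact: open_measurable2.
  - exact: measurable_funTS.
have -> : (\int[mu2]_(p in T) (zero_density n m alpha beta p.1 p.2)%:E =
    \int[mu2]_(p in T0) (zero_density n m alpha beta p.1 p.2)%:E)%E.
  rewrite [LHS]integral_mkcond [RHS]integral_mkcond; apply: eq_integral => p _.
  rewrite !patchE; have [->|p0] := eqVneq p ((0, 0) : C).
    rewrite (_ : zero_density _ _ _ _ _ _ = 0) ?if_same//.
    by rewrite /zero_density/= expr0n addr0 invr0 mul0r.
  congr (if _ then _ else _); apply/idP/idP => /set_mem => [Tp|[Tp _]]; apply: mem_set => //.
  by split => //= /eqP; exact/negP.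
have -> : (\int[mu2]_(p in T0) (zero_density n m alpha beta p.1 p.2)%:E =
    \int[mu2]_(p in T0) (pi%:E * K p))%E.
  apply: eq_integral => p /set_mem[_ /eqP p0]; rewrite KE// -EFinM mulVKf//.
  by rewrite gt_eqF ?pi_gt0.
rewrite (@ge0_integralZl _ _ _ mu2)//.
- by rewrite muleA -EFinM mulVf ?mul1e// gt_eqF ?pi_gt0.
- exact: measurable_funTS.
- by rewrite lee_fin pi_ge0.
Qed.
End harmonic.

(** * The joint law of the coefficients *)

Section product_law.
Context {R : realType} {d d1 d2 : measure_display} {Omega : measurableType d}
  {T1 : measurableType d1} {T2 : measurableType d2}.
Variables (P : probability Omega R) (P1 : probability T1 R) (P2 : probability T2 R).
Variables (X : Omega -> T1) (Y : Omega -> T2).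
Hypotheses (mX : measurable_fun setT X) (mY : measurable_fun setT Y).

Lemma product_law (E : set Omega) : measurable E ->
  (forall A B, measurable A -> measurable B ->
    P (E `&` (X @^-1` A `&` Y @^-1` B)) = (P E * (P1 A * P2 B))%E) ->
  forall D, measurable D ->
    P (E `&` (fun w => (X w, Y w)) @^-1` D) = (P E * (P1 \x P2) D)%E.
Proof.
move=> mE PAB D mD.
have mZ : measurable_fun setT (fun w => (X w, Y w)) by exact: measurable_fun_pair.
have mZD (B : set (T1 * T2)) : measurable B -> measurable ((fun w => (X w, Y w)) @^-1` B).
  by move=> mB; rewrite -[X in measurable X]setTI; exact: mZ.
have [PE0|PE0] := eqVneq (P E) 0%E.
  rewrite PE0 mul0e; apply: (subset_measure0 (mu := P)) PE0 => //.
  by apply: measurableI => //; exact: mZD.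
have PEfin : P E \is a fin_num by exact: fin_num_measure.
pose r := (fine (P E))^-1.
have PEr : P E = (fine (P E))%:E by rewrite fineK.
have rN : fine (P E) != 0 by apply: contra PE0 => /eqP e; rewrite PEr e.
have r0 : 0 <= r by rewrite invr_ge0 fine_ge0.
pose nu := mscale (NngNum r0)
  (measure_function_pushforward__canonical__measure_function_Measure (mrestr P mE) mZ).
have nuE B : nu B = (r%:E * P (E `&` (fun w => (X w, Y w)) @^-1` B))%E.
  by rewrite /nu /mscale/= /pushforward /mrestr setIC.
have -> : (P1 \x P2)%E D = nu D.
  apply: (product_measure_unique (m' := nu)) => // A B mA mB; apply: (etrans (nuE _)).
  rewrite (_ : _ @^-1` _ = X @^-1` A `&` Y @^-1` B)//.
  by rewrite PAB// muleA {1}PEr -EFinM mulVf// mul1e.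
by rewrite nuE muleA {1}PEr -EFinM mulfV// mul1e.
Qed.
End product_law.

Section independence.
Context {R : realType} {d : measure_display} {Omega : measurableType d} {K : eqType}.
Variable P : probability Omega R.
Variables X Y : K -> Omega -> R.
Hypotheses (mX : forall k, measurable_fun setT (X k)) (mY : forall k, measurable_fun setT (Y k)).
Local Notation gam := (gauss1 R).
Local Notation gam2 := (gauss2 R).
Local Notation C := (R * R)%type.
Implicit Types (E : set Omega) (s : seq K) (l : seq (K * (set R * set R))).

Let Z k w : C := (X k w, Y k w).

Definition rect l := \big[setI/setT]_(c <- l) (X c.1 @^-1` c.2.1 `&` Y c.1 @^-1` c.2.2).
Definition rect_law l : \bar R := (\prod_(c <- l) (gam c.2.1 * gam c.2.2))%E.
Fixpoint measurable_sides l :=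
  if l is c :: l' then [/\ measurable c.2.1, measurable c.2.2 & measurable_sides l'] else True.

(* The event [E] accumulates the variables that have already been integrated out. *)
Definition indep s E := forall l, map fst l = s -> measurable_sides l ->
  P (E `&` rect l) = (P E * rect_law l)%E.

Fixpoint ztuple s w : (size s).-tuple C :=
  if s is k :: s' then tcons (Z k w, ztuple s' w) else [tuple].

Let mZ k : measurable_fun setT (Z k). Proof. exact: measurable_fun_pair. Qed.

Let mXk k A : measurable A -> measurable (X k @^-1` A).
Proof. by move=> mA; rewrite -[X in measurable X]setTI; exact: mX. Qed.
Let mYk k A : measurable A -> measurable (Y k @^-1` A).
Proof. by move=> mA; rewrite -[X in measurable X]setTI; exact: mY. Qed.
Let mZk k A : measurable A -> measurable (Z k @^-1` A).
Proof. by move=> mA; rewrite -[X in measurable X]setTI; exact: mZ. Qed.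

Lemma measurable_ztuple s : measurable_fun setT (ztuple s).
Proof.
elim: s => [|k s IH]/=; first exact: measurable_cst.
apply: (measurableT_comp (@measurable_tcons _ _ (size s)) (g := fun w => (Z k w, ztuple s w))).
exact: measurable_fun_pair.
Qed.

Let mzt s A : measurable A -> measurable (ztuple s @^-1` A).
Proof. by move=> mA; rewrite -[X in measurable X]setTI; exact: (measurable_ztuple (s := s)). Qed.

Lemma measurable_rect l : measurable_sides l -> measurable (rect l).
Proof.
rewrite /rect; elim: l => [_|c l IH /= [m1 m2 ml]]; first by rewrite big_nil.
by rewrite big_cons; apply: measurableI; [apply: measurableI; [exact: mXk|exact: mYk]|exact: IH].
Qed.

Lemma rect_cons c l : rect (c :: l) = (X c.1 @^-1` c.2.1 `&` Y c.1 @^-1` c.2.2) `&` rect l.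
Proof. by rewrite /rect big_cons. Qed.

Lemma rect_law_cons c l : rect_law (c :: l) = (gam c.2.1 * gam c.2.2 * rect_law l)%E.
Proof. by rewrite /rect_law big_cons. Qed.

Let full s : seq (K * (set R * set R)) := [seq (k, (setT, setT)) | k <- s].

Let full_fst s : map fst (full s) = s. Proof. by rewrite /full -map_comp map_id. Qed.

Let full_sides s l : measurable_sides l -> measurable_sides (full s ++ l).
Proof. by move=> ml; elim: s => //= k s IH; split. Qed.

Let full_rect s l : rect (full s ++ l) = rect l.
Proof. by elim: s => //= k s IH; rewrite rect_cons !preimage_setT !setTI. Qed.

Let full_law s l : rect_law (full s ++ l) = rect_law l.
Proof. by elim: s => //= k s IH; rewrite rect_law_cons !probability_setT !mul1e. Qed.

Let indep_sub s s2 E l : indep (s ++ s2) E -> map fst l = s2 -> measurable_sides l ->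
  P (E `&` rect l) = (P E * rect_law l)%E.
Proof.
move=> ind ls ml; have := ind (full s ++ l); rewrite full_rect full_law; apply.
  by rewrite map_cat full_fst ls.
exact: full_sides.
Qed.

Let rect_nil : rect [::] = setT. Proof. by rewrite /rect big_nil. Qed.
Let rect_law_nil : rect_law [::] = 1%E. Proof. by rewrite /rect_law big_nil. Qed.

Let fullT s : rect (full s) = setT /\ rect_law (full s) = 1%E.
Proof. by have := full_rect s [::]; have := full_law s [::]; rewrite !cats0 rect_nil rect_law_nil. Qed.

Let full_sidesT s : measurable_sides (full s).
Proof. by have := @full_sides s [::] Logic.I; rewrite cats0. Qed.

Lemma indep_step k s E A : measurable E -> measurable A -> indep (k :: s) E ->
  indep s (E `&` Z k @^-1` A) /\ P (E `&` Z k @^-1` A) = (P E * gam2 A)%E.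
Proof.
move=> mE mA ind.
have key l : map fst l = s -> measurable_sides l ->
    P ((E `&` rect l) `&` Z k @^-1` A) = (P E * rect_law l * gam2 A)%E.
  move=> ls ml; have mr := measurable_rect ml.
  have mEl : measurable (E `&` rect l) by exact: measurableI.
  have step A1 A2 : measurable A1 -> measurable A2 ->
      P ((E `&` rect l) `&` (X k @^-1` A1 `&` Y k @^-1` A2)) =
      (P E * (gam A1 * gam A2 * rect_law l))%E.
    move=> m1 m2; have := ind ((k, (A1, A2)) :: l).
    rewrite /= ls rect_cons rect_law_cons/= => <-//.
    by rewrite -setIA [rect l `&` _]setIC.
  have El : P (E `&` rect l) = (P E * rect_law l)%E.
    have := step setT setT measurableT measurableT.
    by rewrite !preimage_setT !setIT !probability_setT !mul1e.
  rewrite -El; apply: (product_law (P1 := gam) (P2 := gam) (mX k) (mY k)) => // A1 A2 m1 m2.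
  by rewrite step// El -[RHS]muleA; congr (_ * _)%E; exact: muleC.
have PEA : P (E `&` Z k @^-1` A) = (P E * gam2 A)%E.
  have := key _ (full_fst s) (full_sidesT s); have [-> ->] := fullT s.
  by rewrite setIT mule1.
split=> // l ls ml; rewrite setIAC key// PEA muleAC//.
Qed.

Lemma indep_ztuple s s2 E D : measurable E -> measurable D -> indep (s ++ s2) E ->
  indep s2 (E `&` ztuple s @^-1` D) /\
  P (E `&` ztuple s @^-1` D) = (P E * iid gam2 (size s) D)%E.
Proof.
elim: s E D => [|k s IH] E D mE mD ind.
  have e : ztuple [::] @^-1` D = if [tuple] \in D then setT else set0.
    case: ifPn => [/set_mem|/negP] h; apply/seteqP; split => w //=.
    by move=> /mem_set.
  have -> : iid gam2 (size [::]) D = ([tuple] \in D)%:R%:E by rewrite /= diracE.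
  rewrite e; case: ifPn => _; first by rewrite setIT mule1.
  rewrite setI0 measure0 mule0; split => // l _ _.
  by rewrite set0I measure0 mul0e.
have El l : map fst l = s2 -> measurable_sides l -> P (E `&` rect l) = (P E * rect_law l)%E.
  by move=> ls ml; exact: (indep_sub (s := k :: s)) ind ls ml.
have key l : map fst l = s2 -> measurable_sides l ->
    P ((E `&` rect l) `&` ztuple (k :: s) @^-1` D) = (P E * rect_law l * iid gam2 (size s).+1 D)%E.
  move=> ls ml; have mr := measurable_rect ml; rewrite -(El l ls ml).
  have mtD : measurable (@tcons _ _ (size s) @^-1` D).
    by rewrite -[X in measurable X]setTI; exact: measurable_tcons.
  have mEl : measurable (E `&` rect l) by exact: measurableI.
  apply: (product_law (P1 := gam2) (P2 := iid gam2 (size s)) (mZ k) (@measurable_ztuple s)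
    mEl _ mtD) => A B mA mB.
  have [ind1 P1] := indep_step mE mA ind.
  have mEA : measurable (E `&` Z k @^-1` A) by apply: measurableI => //; exact: mZk.
  have [ind2 P2] := IH _ _ mEA mB ind1.
  rewrite (_ : _ `&` _ = (E `&` Z k @^-1` A `&` ztuple s @^-1` B) `&` rect l); last first.
    by rewrite setIAC -!setIA.
  by rewrite (ind2 l ls ml) P2 P1 El// -!muleA; congr (_ * _)%E; rewrite [RHS]muleC muleA.
have PED : P (E `&` ztuple (k :: s) @^-1` D) = (P E * iid gam2 (size (k :: s)) D)%E.
  have := key _ (full_fst s2) (full_sidesT s2); have [-> ->] := fullT s2.
  by rewrite setIT mule1.
by split=> // l ls ml; rewrite setIAC key// PED muleAC.
Qed.

Lemma ztupleE s w : tval (ztuple s w) = [seq (X k w, Y k w) | k <- s].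
Proof. by elim: s => //= k s ->. Qed.

Lemma joint_law k0 sA sB (N N' : nat) (eA : size sA = N) (eB : size sB = N')
    (F : (N.-tuple C * N'.-tuple C) * C -> \bar R) :
  indep (k0 :: sA ++ sB) setT -> measurable_fun setT F -> (forall q, 0 <= F q)%E ->
  (\int[P]_w F ((tcast eA (ztuple sA w), tcast eB (ztuple sB w)), (X k0 w, Y k0 w)) =
   \int[coef_law R N N']_t \int[gam2]_c F (t, c))%E.
Proof.
case: _ / eA F => F; case: _ / eB F => F ind mF F0.
pose V w := (ztuple sA w, ztuple sB w).
have mV : measurable_fun setT V by apply: measurable_fun_pair; exact: measurable_ztuple.
have mVZ : measurable_fun setT (fun w => (V w, Z k0 w)) by exact: measurable_fun_pair.
have law D : measurable D -> P ((fun w => (V w, Z k0 w)) @^-1` D) =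
    (coef_law R (size sA) (size sB) \x gam2)%E D.
  move=> mD; rewrite -[X in P X]setTI -[RHS]mul1e -(probability_setT P).
  apply: (product_law (P1 := coef_law R (size sA) (size sB)) (P2 := gam2) mV (mZ k0)) => // D1 A m1 mA.
  have [ind1] := indep_step measurableT mA ind; rewrite !setTI probability_setT !mul1e => P1.
  rewrite setIC [RHS]muleC -P1.
  apply: (product_law (P1 := iid gam2 (size sA)) (P2 := iid gam2 (size sB))
    (@measurable_ztuple sA) (@measurable_ztuple sB)) => //; first exact: mZk.
  move=> DA DB mA' mB'; have mE1 : measurable (Z k0 @^-1` A) by exact: mZk.
  rewrite setTI in ind1.
  have [ind2 P2] := indep_ztuple mE1 mA' ind1.
  have mE2 : measurable (Z k0 @^-1` A `&` ztuple sA @^-1` DA) by apply: measurableI => //; exact: mzt.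
  have [_ P3] := @indep_ztuple sB [::] _ _ mE2 mB' (eq_ind_r (indep^~ _) ind2 (cats0 sB)).
  by rewrite setIA P3 P2 muleA.
transitivity (\int[coef_law R (size sA) (size sB) \x gam2]_q F q)%E; last first.
  exact: (@fubini_tonelli1 _ _ _ _ _ (coef_law R (size sA) (size sB)) gam2 F mF F0).
apply: (etrans (esym (ge0_integral_pushforward mVZ P measurableT mF (fun q _ => F0 q)))).
apply: eq_measure_integral => D mD _; exact: law.
Qed.
End independence.

Lemma gauss1_normalize (R : realType) (v : R) (A : set R) : 0 < v -> measurable A ->
  normal_prob 0 (Num.sqrt (v / 2)) [set x | A (x / Num.sqrt v)] = gauss1 R A.
Proof.
move=> v0 mA; have s0 : 0 < Num.sqrt v by rewrite sqrtr_gt0.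
have m1 : measurable_fun setT (fun y : R => (\1_A y)%:E : \bar R).
  by apply/measurable_EFinP; exact: measurable_indic.
have mS : measurable_fun setT (fun x : R => x / Num.sqrt v) by exact: measurable_funM.
have mB : measurable [set x : R | A (x / Num.sqrt v)].
  by rewrite -[X in measurable X]setTI; exact: mS.
have mB1 : measurable_fun setT (fun y : R => (\1_[set x : R | A (x / Num.sqrt v)] y)%:E : \bar R).
  by apply/measurable_EFinP; exact: measurable_indic.
have -> : gauss1 R A = (\int[gauss1 R]_y (\1_A y)%:E)%E.
  by have := @integral_indic _ _ _ (gauss1 R) setT measurableT _ mA; rewrite setIT => ->.
have -> : normal_prob 0 (Num.sqrt (v / 2)) [set x | A (x / Num.sqrt v)] =
    (\int[normal_prob 0 (Num.sqrt (v / 2))]_y (\1_[set x : R | A (x / Num.sqrt v)] y)%:E)%E.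
  by have := @integral_indic _ _ _ (normal_prob 0 (Num.sqrt (v / 2))) setT measurableT _ mB;
    rewrite setIT => ->.
rewrite ge0_integral_normal_prob//.
rewrite ge0_integral_gam//.
pose g (y : R) : \bar R := ((\1_A y)%:E * (expR (- y ^+ 2) / Num.sqrt pi)%:E)%E.
have mw : measurable_fun setT (fun x : R => (expR (- x ^+ 2) / Num.sqrt pi)%:E).
  apply/measurable_EFinP; apply: measurable_funM => //; apply: measurableT_comp => //.
  by apply: measurableT_comp => //; exact: measurable_funX.
have mg : measurable_fun setT g by exact: emeasurable_funM.
have g0 y : (0 <= g y)%E by rewrite mule_ge0// lee_fin// divr_ge0 ?expR_ge0 ?sqrtr_ge0.
have sV0 : (Num.sqrt v)^-1 != 0 by rewrite invr_eq0 gt_eqF.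
have aff := lebesgue_integral_affine 0 sV0 mg g0.
have mga : measurable_fun setT (fun x => g ((Num.sqrt v)^-1 * x + 0)).
  by apply: (measurableT_comp mg); apply: measurable_funD => //; exact: measurable_funM.
have c0 : (0 <= ((Num.sqrt v)^-1)%:E)%E by rewrite lee_fin invr_ge0 ltW.
transitivity ((Num.sqrt v)^-1%:E * \int[@lebesgue_measure R]_x g ((Num.sqrt v)^-1 * x + 0)%R)%E; last first.
  by rewrite aff muleA -EFinM normfV gtr0_norm// invrK mulVf ?mul1e// gt_eqF.
rewrite -(@ge0_integralZl _ _ _ (@lebesgue_measure R))//.
apply: eq_integral => x _; rewrite /g addr0 muleCA [_^-1 * x]mulrC !indicE.
congr (_ * _)%E; rewrite -EFinM; congr EFin; rewrite normal_pdfE ?gt_eqF ?sqrtr_gt0 ?divr_gt0//.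
rewrite /normal_peak /normal_fun sqr_sqrtr ?divr_ge0 ?(ltW v0)// subr0 expr_div_n sqr_sqrtr ?(ltW v0)//.
have v2 : v / 2 *+ 2 = v by rewrite -mulr_natr divfK.
have -> : v / 2 * pi *+ 2 = v * pi by rewrite -mulrnAl v2.
rewrite v2 sqrtrM ?(ltW v0)// invfM mulNr.
by rewrite -mulrA; congr (_ * _); rewrite mulrC.
Qed.

Section complex_pairs.
Context {R : realType}.
Local Notation C := (R * R)%type.
Local Open Scope complex_scope.

Definition toC (p : C) : R[i] := p.1 +i* p.2.

Lemma toC_inj : injective toC.
Proof. by move=> [a b] [c d] [-> ->]. Qed.

Lemma toC_cmul (w z : C) : toC (cmul w z) = toC w * toC z.
Proof.
by case: w => a b; case: z => c d; apply/eqP; rewrite eq_complex /= eqxx/= addrC eqxx.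
Qed.

Lemma toC_cpow p j : toC (cpow p j) = toC p ^+ j.
Proof. by elim: j => [|j IH]//=; rewrite toC_cmul IH exprS. Qed.

Lemma toC_cconj p : toC (cconj p) = (toC p)^*%C.
Proof. by []. Qed.

Lemma toC_axpy (k : R) (z r : C) : toC (axpy k z r) = k%:C * toC z + toC r.
Proof.
by case: z => a b; case: r => c d; apply/eqP; rewrite eq_complex /= !mul0r subr0 addr0 !eqxx.
Qed.

Lemma toC_clin n (w : nat -> R) (e : nat -> C) (t : n.-tuple C) :
  toC (clin w e t) = \sum_(j < n) (w j)%:C * toC (tnth t j) * toC (e j).
Proof.
have toC_sum (I : Type) (r : seq I) (F G : I -> R) :
    toC (\sum_(i <- r) F i, \sum_(i <- r) G i) = \sum_(i <- r) toC (F i, G i).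
  by elim: r => [|i r IH]; rewrite ?big_nil// !big_cons -IH; apply/eqP; rewrite eq_complex /= !eqxx.
rewrite toC_sum; apply: eq_bigr => j _; rewrite -mulrA -toC_cmul.
by apply/eqP; rewrite eq_complex /= !mul0r subr0 addr0 !eqxx.
Qed.

Lemma toC_normalize (v x y : R) : 0 < v ->
  (Num.sqrt v)%:C * toC (x / Num.sqrt v, y / Num.sqrt v) = x +i* y.
Proof.
move=> v0; have s0 : Num.sqrt v != 0 by rewrite gt_eqF// sqrtr_gt0.
apply/eqP; rewrite eq_complex /= !mul0r subr0 addr0.
by rewrite ![Num.sqrt v * _]mulrC !divfK// !eqxx.
Qed.
End complex_pairs.

Section normalization.
Context {R : realType} {d : measure_display} {Omega : measurableType d} {I K : finType}.
Variables (P : probability Omega R) (W : I -> Omega -> R) (v : K -> R) (f : K * bool -> I).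
Hypotheses (v_gt0 : forall k, 0 < v k) (f_bij : bijective f).
Hypothesis W_indep : mutually_independent P W.
Hypothesis W_normal : forall k b, centered_normal_rv P (W (f (k, b))) (v k / 2).
Implicit Types (l : seq (K * (set R * set R))).

Let measurable_nth_sides l i : measurable_sides l ->
  measurable (nth (setT, setT) (unzip2 l) i).1 /\ measurable (nth (setT, setT) (unzip2 l) i).2.
Proof.
elim: l i => [|c l IH] [|i] //=; try by move=> _; split.
  by case.
by case=> _ _; exact: IH.
Qed.

Lemma indep_normalized (s : seq K) : uniq s -> (forall k, k \in s) ->
  indep P (fun k w => W (f (k, false)) w / Num.sqrt (v k))
    (fun k w => W (f (k, true)) w / Num.sqrt (v k)) s setT.
Proof.
move=> us sT l ls ml; have [g fK gK] := f_bij; have [mW indW] := W_indep.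
pose A k := nth (setT, setT) (unzip2 l) (index k s).
have lE : l = [seq (k, A k) | k <- s].
  have sl : size s = size l by rewrite -ls size_map.
  case: l => [|c0 l'] in ls ml A sl *; first by rewrite -ls.
  apply: (@eq_from_nth _ c0); first by rewrite size_map.
  move=> i il; rewrite (nth_map c0.1) ?sl//.
  have il' : (i < size s)%N by rewrite sl.
  rewrite /A index_uniq// -ls (nth_map c0)// (nth_map c0)//.
  by case: (nth c0 _ i).
have mA k : measurable (A k).1 /\ measurable (A k).2 by exact: measurable_nth_sides.
pose side kb := if kb.2 then (A kb.1).2 else (A kb.1).1.
have mside kb : measurable (side kb) by rewrite /side; case: ifP => _; have [] := mA kb.1.
pose B i : set R := [set x | side (g i) (x / Num.sqrt (v (g i).1))].
have mB i : measurable (B i).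
  rewrite /B -[X in measurable X]setTI.
  have mS : measurable_fun setT (fun x : R => x / Num.sqrt (v (g i).1)) by exact: measurable_funM.
  exact: mS.
have big_K (T : Type) (idx : T) (op : Monoid.com_law idx) (F : I -> T) :
    \big[op/idx]_(i in finset.setT) F i =
    \big[op/idx]_(c <- l) op (F (f (c.1, false))) (F (f (c.1, true))).
  rewrite (eq_bigl xpredT); last by move=> i; rewrite finset.in_setT.
  rewrite (reindex f) /=; last exact: onW_bij.
  rewrite (eq_bigr (fun kb : K * bool => F (f (kb.1, kb.2)))); last by case.
  rewrite -(pair_bigA _ (fun k b => F (f (k, b)))) /= lE big_map /=.
  rewrite (perm_big s) /=; last first.
    by apply: uniq_perm => // [|k]; rewrite ?index_enum_uniq// mem_index_enum sT.
  by apply: eq_bigr => k _; rewrite big_bool Monoid.mulmC.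
have /= := indW finset.setT B mB.
rewrite (big_K _ _ setI) (big_K _ _ (@mule R)).
rewrite setTI probability_setT mul1e => h.
have lA c : c \in l -> c.2 = A c.1 by rewrite lE => /mapP[k _ ->].
rewrite /rect (eq_big_seq (fun c => W (f (c.1, false)) @^-1` B (f (c.1, false)) `&`
    W (f (c.1, true)) @^-1` B (f (c.1, true)))); last first.
  by move=> c /lA ->; rewrite /B !fK.
rewrite h /rect_law; apply: eq_big_seq => c /lA ->; have [mA1 mA2] := mA c.1.
rewrite -(gauss1_normalize (v_gt0 c.1) mA1) -(gauss1_normalize (v_gt0 c.1) mA2).
by congr (_ * _)%E; apply: (etrans (W_normal _ _ (mB _))); rewrite /B fK.
Qed.
End normalization.

Theorem theorem2p1 (R : realType) (d : measure_display) (Omega : measurableType d)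
  (P : probability Omega R) (n m : nat) (alpha beta : nat -> R)
  (a a' b b' : nat -> Omega -> R) :
  (1 <= m)%N -> (m <= n)%N ->
  (forall j, (j <= n)%N -> 0 < alpha j) ->
  (forall j, (j <= m)%N -> 0 < beta j) ->
  (* A_j = a j + i a' j, B_j = b j + i b' j: circularly-symmetric complex
     Gaussians with E|A_j|^2 = alpha j, E|B_j|^2 = beta j *)
  (forall j, (j <= n)%N -> centered_normal_rv P (a j) (alpha j / 2)
                         /\ centered_normal_rv P (a' j) (alpha j / 2)) ->
  (forall j, (j <= m)%N -> centered_normal_rv P (b j) (beta j / 2)
                         /\ centered_normal_rv P (b' j) (beta j / 2)) ->
  (* mutual independence of A_0..A_n, B_0..B_m (and of their real/imaginary parts) *)
  mutually_independent P
    (fun (i : (('I_n.+1 * bool) + ('I_m.+1 * bool))%type) =>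
       match i with
       | inl (j, false) => a j | inl (j, true) => a' j
       | inr (j, false) => b j | inr (j, true) => b' j
       end) ->
  forall T : set (R * R), open T ->
    (\int[P]_w zero_count n m (fun j => (a j w +i* a' j w)%C)
                              (fun j => (b j w +i* b' j w)%C) T)%E
    = ((pi^-1)%:E *
       \int[(@lebesgue_measure R \x @lebesgue_measure R)%E]_(p in T)
          (zero_density n m alpha beta p.1 p.2)%:E)%E.
Proof.
case: n => [|n']; first by case: m.
move=> m_gt0 mn alpha_gt0 beta_gt0 lawA lawB indW T oT.
pose K := ('I_n'.+2 + 'I_m.+1)%type.
pose var (k : K) := match k with inl j => alpha j | inr j => beta j end.
have var_gt0 k : 0 < var k.
  by case: k => j /=; [apply: alpha_gt0|apply: beta_gt0]; rewrite -ltnS.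
pose f (kb : K * bool) : ('I_n'.+2 * bool) + ('I_m.+1 * bool) :=
  match kb.1 with inl j => inl (j, kb.2) | inr j => inr (j, kb.2) end.
have f_bij : bijective f.
  exists (fun i => match i with inl jb => (inl jb.1, jb.2) | inr jb => (inr jb.1, jb.2) end).
    by move=> [[j|j] c].
  by move=> [[j c]|[j c]].
set W := (X in mutually_independent P X) in indW.
have f_normal k c : centered_normal_rv P (W (f (k, c))) (var k / 2).
  case: k c => j [] /=; [have [] := lawA j|have [] := lawA j|have [] := lawB j|have [] := lawB j] => //;
    by rewrite -ltnS.
pose sA : seq K := [seq inl (lift ord0 j) | j <- enum 'I_n'.+1].
pose sB : seq K := [seq inr j | j <- enum 'I_m.+1].
pose k0 : K := inl ord0.
have eA : size sA = n'.+1 by rewrite size_map size_enum_ord.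
have eB : size sB = m.+1 by rewrite size_map size_enum_ord.
have s_uniq : uniq (k0 :: sA ++ sB).
  rewrite /= mem_cat negb_or cat_uniq; apply/andP; split.
    by apply/andP; split; apply/negP => /mapP[j _] //; case.
  have uA : uniq sA by rewrite map_inj_uniq ?enum_uniq// => i j [] e; apply: val_inj.
  have uB : uniq sB by rewrite map_inj_uniq ?enum_uniq// => i j [].
  by rewrite uA uB andbT; apply/hasPn => _ /mapP[j _ ->]; apply/negP => /mapP[].
have s_full k : k \in k0 :: sA ++ sB.
  rewrite inE mem_cat; case: k => j; last by rewrite (map_f inr) ?mem_enum ?orbT.
  case: (unliftP ord0 j) => [i ->|->]; last by rewrite eqxx.
  by rewrite (map_f (fun i => inl (lift ord0 i))) ?mem_enum ?orbT.
have [mW _] := indW.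
have ind := indep_normalized var_gt0 f_bij indW f_normal s_uniq s_full.
set X := (X in indep _ X _ _ _) in ind.
set Y := (X in indep _ _ X _ _) in ind.
have mX k : measurable_fun setT (X k) by apply: measurable_funM => //; exact: mW.
have mY k : measurable_fun setT (Y k) by apply: measurable_funM => //; exact: mW.
pose F (q : (n'.+1.-tuple (R * R) * m.+1.-tuple (R * R)) * (R * R)) : \bar R :=
  npoints (T `&` [set p | axpy (Num.sqrt (alpha 0%N)) q.2
    (axpy 1 (holo alpha q.1.1 p) (anti beta q.1.2 p)) = (0, 0)]).
have mF : measurable_fun setT F by exact: measurable_fiber_count.
have F0 q : (0 <= F q)%E by exact: npoints_ge0.
rewrite -expected_fiber_count//.
rewrite -(joint_law mX mY eA eB ind mF F0).
apply: eq_integral => w _; rewrite /F /zero_count.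
rewrite -(@npoints_image _ _ _ toC); last by move=> p q _ _; exact: toC_inj.
congr npoints.
set tA := tcast eA (ztuple X Y sA w); set tB := tcast eB (ztuple X Y sB w).
have tAE (j : 'I_n'.+1) : tnth tA j = (X (inl (lift ord0 j)) w, Y (inl (lift ord0 j)) w).
  rewrite (tnth_nth (0, 0)) val_tcast ztupleE -map_comp (nth_map j) ?size_enum_ord//=.
  by rewrite nth_ord_enum.
have tBE (j : 'I_m.+1) : tnth tB j = (X (inr j) w, Y (inr j) w).
  rewrite (tnth_nth (0, 0)) val_tcast ztupleE -map_comp (nth_map j) ?size_enum_ord//=.
  by rewrite nth_ord_enum.
have harmE p : toC (axpy (Num.sqrt (alpha 0%N)) (X k0 w, Y k0 w)
    (axpy 1 (holo alpha tA p) (anti beta tB p))) =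
    harm_poly n'.+1 m (fun j => (a j w +i* a' j w)%C) (fun j => (b j w +i* b' j w)%C) (toC p).
  rewrite !toC_axpy mul1r !toC_clin /harm_poly [in RHS]big_ord_recl expr0 mulr1 -addrA.
  have norm k := toC_normalize (W (f (k, false)) w) (W (f (k, true)) w) (var_gt0 k).
  congr (_ + (_ + _)); first exact: (norm k0).
    apply: eq_bigr => j _; rewrite toC_cpow tAE; congr (_ * _).
    exact: (norm (inl (lift ord0 j))).
  apply: eq_bigr => j _; rewrite toC_cpow toC_cconj tBE; congr (_ * _).
  exact: (norm (inr j)).
apply/seteqP; split => [z [Tz z0]|_ [p [Tp /= p0] <-]].
  exists (complex.Re z, complex.Im z); last by case: z {Tz z0}.
  split => //=; apply: toC_inj; rewrite harmE (_ : toC _ = z); last by case: z {Tz z0}.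
  by rewrite z0.
by split; [case: p Tp {p0}|rewrite -harmE p0].
Qed.
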